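(* If $\mathbf{p}^*\in Y$ is a solution of $$(\mathrm{P})\quad\min_{\mathbf{p}\in Y}\mathcal{J}(\mathbf{p})+\chi_C(\mathbf{p}),$$ then $\Phi\mathbf{p}^*$ is a primal solution of the saddle point problem $$(\mathrm{S})\quad\min_{\tilde{\mathbf{p}}\in\tilde Y}\ \max_{\lambda\in\mathbb{R}^{|\mathcal{I}_\Gamma|}}\left\{\mathcal{L}(\tilde{\mathbf{p}},\lambda):=\tilde{\mathcal{J}}(\tilde{\mathbf{p}})+\chi_{\tilde C}(\tilde{\mathbf{p}})+\langle B\tilde{\mathbf{p}},\lambda\rangle_{\mathbb{R}^{|\mathcal{I}_\Gamma|}}\right\}.$$ Conversely, if $\tilde{\mathbf{p}}^*\in\ker B\subset\tilde Y$ is a primal solution of $(\mathrm{S})$, then $\Phi^{-1}\tilde{\mathbf{p}}^*$ is a solution of $(\mathrm{P})$.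
   Context: Discretization. $\Omega=(0,M)\times(0,N)$ is the domain of an $M\times N$ image; $\mathcal{T}$ is the collection of the pixels, the unit squares $T_{ij}=(i-1,i)\times(j-1,j)$, $1\le i\le M$, $1\le j\le N$. $\alpha>0$ and $f\in L^2(\Omega)$ are given. $H(\mathrm{div};\Omega)=\{\mathbf{p}\in(L^2(\Omega))^2:\mathrm{div}\,\mathbf{p}\in L^2(\Omega)\}$, and $H_0(\mathrm{div};\Omega)$ is its subspace of fields with vanishing normal component on $\partial\Omega$. $\mathcal{RT}_0(T)$ is the set of fields on $T$ of the form $(a_1+b_1x_1,\,a_2+b_2x_2)$, and $Y=\{\mathbf{q}\in H_0(\mathrm{div};\Omega):\mathbf{q}|_T\in\mathcal{RT}_0(T)\ \forall T\in\mathcal{T}\}$. The degrees of freedom of $\mathbf{q}\in Y$ are the (constant) values $(\mathbf{q})_i$ of $\mathbf{q}\cdot\mathbf{n}$ on the interior pixel edges $i\in\mathcal{I}$ (edges shared by two pixels), with $\mathbf{n}$ a fixed unit normal (positive coordinate direction). $\mathcal{J}(\mathbf{p})=\frac1{2\alpha}\int_\Omega(\mathrm{div}\,\mathbf{p}+\alpha f)^2dx$, $C=\{\mathbf{p}\in Y:|(\mathbf{p})_i|\le1\ \forall i\in\mathcal{I}\}$. $\chi_S$ is $0$ on $S$ and $+\infty$ off $S$. Domain decomposition. $\Omega$ is decomposed in a checkerboard fashion into a $K\times K$ array of disjoint square subdomains $\{\Omega_s\}_{s=1}^{\mathcal{N}}$, $\mathcal{N}=K\times K$, each a union of pixels (up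 to edges). $\mathbf{n}_s$ is the outer normal to $\partial\Omega_s$. For adjacent $\Omega_s,\Omega_t$ with $s<t$, $\Gamma_{st}=\partial\Omega_s\cap\partial\Omega_t$ with normal $\mathbf{n}_{st}=\mathbf{n}_s=-\mathbf{n}_t$, and $\Gamma=\bigcup_{s<t}\Gamma_{st}$; $\mathcal{I}_\Gamma\subset\mathcal{I}$ is the set of pixel edges lying on $\Gamma$. With $\mathcal{T}_s$ the set of pixels in $\Omega_s$, $\tilde Y_s=\{\tilde{\mathbf{q}}_s\in H(\mathrm{div};\Omega_s):\tilde{\mathbf{q}}_s\cdot\mathbf{n}_s=0\text{ on }\partial\Omega_s\setminus\Gamma,\ \tilde{\mathbf{q}}_s|_T\in\mathcal{RT}_0(T)\ \forall T\in\mathcal{T}_s\}$, whose degrees of freedom $(\tilde{\mathbf{q}}_s)_i$, $i\in\tilde{\mathcal{I}}_s$, are the normal components on the pixel edges inside $\Omega_s$ or on $\partial\Omega_s\cap\Gamma$. $\tilde C_s=\{\tilde{\mathbf{p}}_s\in\tilde Y_s:|(\tilde{\mathbf{p}}_s)_i|\le1\ \forall i\in\tilde{\mathcal{I}}_s\}$, $\tilde Y=\bigoplus_s\tilde Y_s$, $\tilde C=\bigoplus_s\tilde C_s$. For $\tilde{\mathbf{p}}=\bigoplus_s\tilde{\mathbf{p}}_s\in\tilde Y$, $\tilde{\mathcal{J}}(\tilde{\mathbf{p}})=\sum_s\frac1{2\alpha}\int_{\Omega_s}(\mathrm{div}\,\tilde{\mathbf{p}}_s+\alpha f)^2dx$,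 and $B:\tilde Y\to\mathbb{R}^{|\mathcal{I}_\Gamma|}$ is the jump operator whose entries on the edges of $\Gamma_{st}$ ($s<t$) are $B\tilde{\mathbf{p}}|_{\Gamma_{st}}=\tilde{\mathbf{p}}_s\cdot\mathbf{n}_{st}-\tilde{\mathbf{p}}_t\cdot\mathbf{n}_{st}$. $\Phi:Y\to\ker B$, $\Phi\mathbf{p}=\bigoplus_s\mathbf{p}|_{\Omega_s}$, which is an isomorphism. A primal solution of $(\mathrm{S})$ is the component $\tilde{\mathbf{p}}^*$ of a saddle point $(\tilde{\mathbf{p}}^*,\lambda^* )$, i.e. $\mathcal{L}(\tilde{\mathbf{p}}^*,\lambda)\le\mathcal{L}(\tilde{\mathbf{p}}^*,\lambda^* )\le\mathcal{L}(\tilde{\mathbf{p}},\lambda^* )$ for all $\tilde{\mathbf{p}}\in\tilde Y$, $\lambda\in\mathbb{R}^{|\mathcal{I}_\Gamma|}$, with $\mathcal{L}(\tilde{\mathbf{p}}^*,\lambda^* )$ finite. *)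

(* Defs.v *)
From HB Require Import structures.
From mathcomp Require Import all_boot all_order all_algebra.
From mathcomp Require Import all_classical all_reals all_analysis.

Set Implicit Arguments.
Unset Strict Implicit.
Unset Printing Implicit Defensive.

Import Order.TTheory GRing.Theory Num.Theory.
Import numFieldNormedType.Exports.

Local Open Scope classical_set_scope.
Local Open Scope ring_scope.

(* An element of L^2(D) is given by a function on the whole plane that is Borel
   measurable on D; its values off D are irrelevant, and equality in L^2(D) is
   ae_eq_on D. *)
Definition scalar_field (R : realType) : Type := R * R -> R.
Definition vector_field (R : realType) : Type := R * R -> R * R.

Notation area R :=
  (@lebesgue_measure R \x @lebesgue_measure R)%E (only parsing).

Definition boundary (R : realType) (D : set (R * R)) : set (R * R) :=
  closure D `\` interior D.

Definition ae_eq_on (R : realType) (D : set (R * R)) (p q : vector_field R)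
    : Prop :=
  {ae (area R), forall x, D x -> p x = q x}.

Definition L2 (R : realType) (D : set (R * R)) (g : scalar_field R) : Prop :=
  measurable_fun D g /\ (area R).-integrable D (fun x => ((g x) ^+ 2)%:E).

Definition C1 (R : realType) (phi : scalar_field R) : Prop :=
  (forall x, differentiable phi x) /\ (forall v, continuous ('D_v phi)).

Definition fsupport (R : realType) (phi : scalar_field R) : set (R * R) :=
  closure [set x | phi x != 0].

Definition test (R : realType) (U : set (R * R)) (phi : scalar_field R)
    : Prop :=
  [/\ C1 phi, compact (fsupport phi) & fsupport phi `<=` U].

Definition dot_grad (R : realType) (p : vector_field R) (phi : scalar_field R)
    : scalar_field R :=
  fun x => (p x).1 * 'D_((1, 0) : R * R) phi x
         + (p x).2 * 'D_((0, 1) : R * R) phi x.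

Definition is_div (R : realType) (D : set (R * R)) (p : vector_field R)
    (g : scalar_field R) : Prop :=
  L2 D g /\
  forall phi, test D phi ->
    \int[area R]_(x in D) dot_grad p phi x
    = - \int[area R]_(x in D) (g x * phi x).

Definition Hdiv (R : realType) (D : set (R * R)) (p : vector_field R) : Prop :=
  [/\ L2 D (fun x => (p x).1), L2 D (fun x => (p x).2)
    & exists g, is_div D p g].

(* The weak divergence (determined almost everywhere on D); 0 if there is
   none. *)
Definition div (R : realType) (D : set (R * R)) (p : vector_field R)
    : scalar_field R :=
  xget (fun=> 0) [set g | is_div D p g].

(* p . n = 0 on the relatively open part Z of the boundary of D, where the
   normal trace of p is the functional
   phi |-> int_D p . grad phi + int_D (div p) phi. *)
Definition normal_zero (R : realType) (D Z : set (R * R)) (p : vector_field R)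
    : Prop :=
  forall phi, test setT phi -> fsupport phi `&` boundary D `<=` Z ->
    \int[area R]_(x in D) dot_grad p phi x
    + \int[area R]_(x in D) (div D p x * phi x) = 0.

Definition rt0 (R : realType) (a b : R * R) : vector_field R :=
  fun x => (a.1 + b.1 * x.1, a.2 + b.2 * x.2).

Definition open_rect (R : realType) (x0 x1 y0 y1 : nat) : set (R * R) :=
  `]x0%:R, x1%:R[ `*` `]y0%:R, y1%:R[.
Arguments open_rect : clear implicits.

Definition image_domain (R : realType) (M N : nat) : set (R * R) :=
  open_rect R 0 M 0 N.
Arguments image_domain : clear implicits.

(* Indices start at 0, so that ij = (i, j) stands for the pixel
   (i, i+1) x (j, j+1). *)
Definition pixel_index (M N : nat) : finType := ('I_M * 'I_N)%type.

Definition pixel (R : realType) (M N : nat) (T : pixel_index M N)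
    : set (R * R) :=
  open_rect R T.1 T.1.+1 T.2 T.2.+1.
Arguments pixel R {M N} T _ : rename.

(* Interior edges: inl (i, j) is the vertical edge {i+1} x (j, j+1) and
   inr (i, j) is the horizontal edge (i, i+1) x {j+1}. *)
Definition edge (M N : nat) : finType :=
  ('I_M.-1 * 'I_N + 'I_M * 'I_N.-1)%type.

Definition segment (R : realType) (M N : nat) (e : edge M N) : set (R * R) :=
  match e with
  | inl ij => [set (ij.1.+1)%:R] `*` `](ij.2)%:R, (ij.2.+1)%:R[
  | inr ij => `](ij.1)%:R, (ij.1.+1)%:R[ `*` [set (ij.2.+1)%:R]
  end.
Arguments segment R {M N} e _ : rename.

(* The pixel having e as its right or upper edge *)
Definition low_pixel (M N : nat) (e : edge M N) : pixel_index M N :=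
  match e with
  | inl ij => (widen_ord (leq_pred M) ij.1, ij.2)
  | inr ij => (ij.1, widen_ord (leq_pred N) ij.2)
  end.

(* v . n for the unit normal n of e in the positive coordinate direction *)
Definition normal_comp (R : realType) (M N : nat) (e : edge M N) (v : R * R)
    : R :=
  if e is inl _ then v.1 else v.2.

Definition in_RT0 (R : realType) (M N : nat) (T : pixel_index M N)
    (q : vector_field R) : Prop :=
  exists a b, ae_eq_on (pixel R T) q (rt0 a b).

(* On the edge e of T, the polynomial that q equals on T has the constant
   normal component v. *)
Definition normal_value (R : realType) (M N : nat) (T : pixel_index M N)
    (q : vector_field R) (e : edge M N) (v : R) : Prop :=
  exists a b, ae_eq_on (pixel R T) q (rt0 a b) /\
    forall x, segment R e x -> normal_comp e (rt0 a b x) = v.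

(* (q)_e for a field q on D, as the common value seen from the pixels of D
   that have e as an edge. Membership in H(div; D) makes the values from the
   two sides of an edge inside D agree. *)
Definition dof (R : realType) (M N : nat) (D : set (R * R))
    (q : vector_field R) (e : edge M N) : R :=
  xget 0 [set v | forall T : pixel_index M N, pixel R T `<=` D ->
    segment R e `<=` closure (pixel R T) -> normal_value T q e v].

(* Raviart-Thomas fields on D with vanishing normal component on Z *)
Definition RT_space (R : realType) (M N : nat) (D Z : set (R * R))
    (q : vector_field R) : Prop :=
  [/\ Hdiv D q, normal_zero D Z q
    & forall T : pixel_index M N, pixel R T `<=` D -> in_RT0 T q].
Arguments RT_space {R} M N D Z q.

Definition energy (R : realType) (alpha : R) (f : scalar_field R)
    (D : set (R * R)) (p : vector_field R) : \bar R :=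
  ((2 * alpha)^-1%:E *
     \int[area R]_(x in D) (((div D p x + alpha * f x) ^+ 2)%:E))%E.

Definition chi (R : realType) (X : Type) (S : set X) (x : X) : \bar R :=
  if `[< S x >] then 0%E else +oo%E.
Arguments chi {R X} S x.

Definition Yspace (R : realType) (M N : nat) : set (vector_field R) :=
  RT_space M N (image_domain R M N) (boundary (image_domain R M N)).
Arguments Yspace {R} M N _.

Definition Cset (R : realType) (M N : nat) : set (vector_field R) :=
  [set p | Yspace M N p /\
     forall e : edge M N, `|dof (image_domain R M N) p e| <= 1].
Arguments Cset {R} M N _.

Definition objective (R : realType) (M N : nat) (alpha : R) (f : scalar_field R)
    (p : vector_field R) : \bar R :=
  (energy alpha f (image_domain R M N) p + chi (Cset M N) p)%E.
Arguments objective {R} M N alpha f p.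

Definition solves_P (R : realType) (M N : nat) (alpha : R) (f : scalar_field R)
    (p : vector_field R) : Prop :=
  Yspace M N p /\
  forall q, Yspace M N q ->
    (objective M N alpha f p <= objective M N alpha f q)%E.
Arguments solves_P {R} M N alpha f p.

(* A K x K array of squares with pixel-aligned grid lines x = xcut a and
   y = ycut b, and an arbitrary numbering of the squares by 'I_(K * K). *)
Record square_array (M N K : nat) := SquareArray {
  xcut : nat -> nat;
  ycut : nat -> nat;
  position : 'I_(K * K) -> 'I_K * 'I_K;
  xcut0 : xcut 0 = 0%N;
  xcutK : xcut K = M;
  ycut0 : ycut 0 = 0%N;
  ycutK : ycut K = N;
  xcut_lt : forall a, (a < K)%N -> (xcut a < xcut a.+1)%N;
  ycut_lt : forall b, (b < K)%N -> (ycut b < ycut b.+1)%N;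
  cut_square : forall a b, (a < K)%N -> (b < K)%N ->
    (xcut a.+1 - xcut a = ycut b.+1 - ycut b)%N;
  position_bij : bijective position }.

Section Decomposition.
Context (R : realType) (M N K : nat) (G : square_array M N K).
Implicit Types (s t : 'I_(K * K)) (e : edge M N) (p : vector_field R)
  (P : 'I_(K * K) -> vector_field R).

Definition subdomain s : set (R * R) :=
  let a := (position G s).1 in let b := (position G s).2 in
  open_rect R (xcut G a) (xcut G a.+1) (ycut G b) (ycut G b.+1).

Definition adjacent s t : bool :=
  let: (a, b) := position G s in let: (a', b') := position G t in
  ((a == a') && ((b.+1 == b' :> nat) || (b'.+1 == b :> nat))) ||
  ((b == b') && ((a.+1 == a' :> nat) || (a'.+1 == a :> nat))).

Definition Gamma_st s t : set (R * R) :=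
  boundary (subdomain s) `&` boundary (subdomain t).

Definition Gamma : set (R * R) :=
  [set x | exists s t, [/\ (s < t)%N, adjacent s t & Gamma_st s t x]].

Definition I_Gamma : {set edge M N} :=
  [set e | `[< segment R e `<=` Gamma >]]%SET.

Definition I_sub s : set (edge M N) :=
  [set e | segment R e `<=` subdomain s \/
           segment R e `<=` boundary (subdomain s) `&` Gamma].

Definition Ysub s : set (vector_field R) :=
  RT_space M N (subdomain s) (boundary (subdomain s) `\` Gamma).

Definition Csub s : set (vector_field R) :=
  [set p | Ysub s p /\
     forall e, I_sub s e -> `|dof (subdomain s) p e| <= 1].

(* An element of the direct sum of the local spaces is the family of its
   components. *)
Definition Ytilde : set ('I_(K * K) -> vector_field R) :=
  [set P | forall s, Ysub s (P s)].

Definition Ctilde : set ('I_(K * K) -> vector_field R) :=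
  [set P | forall s, Csub s (P s)].

Definition energy_tilde (alpha : R) (f : scalar_field R) P : \bar R :=
  (\sum_(s < K * K) energy alpha f (subdomain s) (P s))%E.

(* The outer normal n_s of Omega_s on an edge e of its boundary is
   outer_sign s e * n. *)
Definition outer_sign s e : R :=
  if `[< pixel R (low_pixel e) `<=` subdomain s >] then 1 else -1.

(* The sum has exactly one term when e lies on Gamma. *)
Definition jump P e : R :=
  \sum_(s < K * K) \sum_(t < K * K |
      [&& (s < t)%N, adjacent s t & `[< segment R e `<=` Gamma_st s t >]])
    (outer_sign s e * dof (subdomain s) (P s) e
     - outer_sign s e * dof (subdomain t) (P t) e).

Definition B P : 'rV[R]_#|I_Gamma| := \row_k jump P (enum_val k).

Definition inner (n : nat) (u v : 'rV[R]_n) : R := \sum_k u 0 k * v 0 k.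

Definition Lagrangian (alpha : R) (f : scalar_field R) P
    (lam : 'rV[R]_#|I_Gamma|) : \bar R :=
  (energy_tilde alpha f P + chi Ctilde P + (inner (B P) lam)%:E)%E.

Definition saddle_point (alpha : R) (f : scalar_field R) P
    (lam : 'rV[R]_#|I_Gamma|) : Prop :=
  [/\ Ytilde P,
      Lagrangian alpha f P lam \is a fin_num,
      forall mu, (Lagrangian alpha f P mu <= Lagrangian alpha f P lam)%E
    & forall Q, Ytilde Q ->
        (Lagrangian alpha f P lam <= Lagrangian alpha f Q lam)%E].

Definition primal_solution (alpha : R) (f : scalar_field R) P : Prop :=
  exists lam, saddle_point alpha f P lam.

Definition kerB : set ('I_(K * K) -> vector_field R) :=
  [set P | Ytilde P /\ B P = 0].

Definition Phi p : 'I_(K * K) -> vector_field R := fun s => p \_ (subdomain s).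

(* Equality in Ytilde *)
Definition tilde_eq P Q : Prop :=
  forall s, ae_eq_on (subdomain s) (P s) (Q s).

End Decomposition.

(* Main.v *)
Require Import Defs.
From HB Require Import structures.
From mathcomp Require Import all_boot all_order all_algebra.
From mathcomp Require Import all_classical all_reals all_analysis.
From mathcomp Require Import measurable_realfun.
From mathcomp Require Import ring lra zify.

Set Implicit Arguments.
Unset Strict Implicit.
Unset Printing Implicit Defensive.

Import Order.TTheory GRing.Theory Num.Theory.
Import numFieldNormedType.Exports.

Local Open Scope classical_set_scope.
Local Open Scope ring_scope.

(** A field of the image problem or of a subdomain is the same thing as a
    choice of normal components on the pixel edges.  Write [u i j] for the
    value on the vertical edge [{i} x (j, j+1)] and [v i j] for the value on
    the horizontal edge [(i, i+1) x {j}].  A piecewise Raviart-Thomas field lies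
    in H(div) exactly when the normal components seen from the two sides of each
    inner edge agree, and its normal trace vanishes on a part Z of the boundary
    exactly when the edge values on Z are zero.  Both facts follow from Green's
    formula on one pixel ([rt0_green]), summed over the pixels
    ([piecewise_green]): tested with a bump concentrated on one edge, the sum
    isolates the jump of the normal component across that edge
    ([RT_edge_repr]); conversely, if the values agree, the sum telescopes to the
    outer edges ([edge_green], [edge_repr_RT]).  The fundamental lemma of the
    calculus of variations ([test_ae0]) shows that the weak divergence is the
    constant [edge_div u v i j] on each pixel, so that the energy is a finite
    sum of quadratic functions of these constants ([energy_edge]).  Fields of
    the direct sum are described in the same way, with separate values for every
    subdomain ([Ytilde_repr]); the jump operator then compares, on each edge of
    the interface, the value [low_val] of the subdomain of the left or lower
    pixel with the value [high_val] of the subdomain of the right or upper pixel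
    ([jumpE]).

    What remains is convex duality in finite dimension.  Let p be a solution of
    (P), let [d_T] be its divergence on the pixel T, and let [w_T] be the
    derivative at [d_T] of the energy of T.  Minimality gives the variational
    inequality [sum_T w_T (d_T(q) - d_T(p)) >= 0] for all admissible q
    ([variational_ineq]).  The multiplier can be written down:
    [lambda_e = - w_T], where T is the left or lower pixel of e.  Given a family
    Q in the direct sum that satisfies the constraints, let q be the global
    field that has on each edge the value seen from the right or upper pixel
    ([glue_u], [glue_v]).  It is admissible, and passing from Q to q changes
    [sum_T w_T d_T] by exactly [<B Q, lambda>] ([glue_div_sum]); with the
    convexity of the energy ([px_energyD]) this gives
    [L(Q, lambda) >= L(Phi p, lambda)].  The inequality in lambda is trivial
    because the jumps of Phi p are zero.

    Conversely, a primal solution P in the kernel of B glues to a field p with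
    Phi p = P ([glued_field]).  All fields of the form Phi q have zero jumps, so
    the right-hand saddle point inequality, restricted to them, says that p
    minimizes the objective of (P) ([solution_of_primal]). *)

(** * Measure on rectangles of the plane *)

(** The product of the two Borel structures on which the area is defined; sets
    of points are annotated with it so that measurability refers to its
    sigma-algebra. *)
Notation mplane R := (measurableTypeR R * measurableTypeR R)%type (only parsing).

Section plane_measure.
Context {R : realType}.
Implicit Types (F : R * R -> R).

(** An open set is the union of the countably many squares with rational
    centre and radius 1/(n+1) that it contains. *)
Lemma plane_open_measurable (U : set (R * R)) : open U -> measurable U.
Proof.
move=> oU.
pose box (p q : rat) (n : nat) : set (R * R) :=
  `](ratr p - n.+1%:R^-1), (ratr p + n.+1%:R^-1)[%classic `*`
  `](ratr q - n.+1%:R^-1), (ratr q + n.+1%:R^-1)[%classic.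
have -> : U = \bigcup_(p : rat) \bigcup_(q : rat) \bigcup_n
    [set x | box p q n `<=` U /\ box p q n x].
  apply/seteqP; split => [[x y] Uxy|z [p _ [q _ [n _ [sub bz]]]]]; last exact: sub.
  have := open_nbhs_nbhs (conj oU Uxy).
  rewrite -nbhs_ballE => -[e /= e0 sub].
  have [n ne] : exists n, n.+1%:R^-1 < e / 2.
    exists (Num.truncn (2 / e)).
    rewrite -[ltRHS]invrK ltf_pV2 ?posrE ?invr_gt0 ?divr_gt0//.
    by rewrite invf_div truncnS_gt.
  have ni0 : 0 < n.+1%:R^-1 :> R by rewrite invr_gt0.
  have apx (t : R) : exists p : rat, `|t - ratr p| < n.+1%:R^-1.
    move: (n.+1%:R^-1) ni0 => h h0.
    have [|p] := @rat_in_itvoo R (t - h) (t + h); first by lra.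
    by rewrite in_itv/= => pP; exists p; rewrite ltr_norml; lra.
  have [p px] := apx x; have [q qy] := apx y.
  exists p => //; exists q => //; exists n => //=; split; last first.
    rewrite /box /= !in_itv/=; move: px qy; rewrite !ltr_norml.
    by move: (n.+1%:R^-1) => h px qy; split; lra.
  move=> [x' y']; rewrite /box /= !in_itv/= => -[h1 h2]; apply: sub.
  move: px qy h1 h2 ne; rewrite !ltr_norml.
  move: (n.+1%:R^-1) => h px qy h1 h2 ne.
  by split; rewrite /= /ball/= ltr_norml; apply/andP; split; lra.
apply: bigcupT_measurable_rat => p; apply: bigcupT_measurable_rat => q.
apply: bigcup_measurable => n _.
have [sub|nsub] := pselect (box p q n `<=` U).
  rewrite (_ : [set _ | _] = box p q n).
    by apply: measurableX; exact: measurable_itv.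
  by apply/seteqP; split => [z []//|z bz]; split.
by rewrite (_ : [set _ | _] = set0)//; apply/seteqP; split => // z [].
Qed.

Lemma plane_continuous_measurable F : continuous F -> measurable_fun setT F.
Proof.
move=> /continuousP cF; apply: (measurability _ (RGenOpens.measurableE R)).
move=> _ [_ [a [b ->] <-]]; rewrite setTI; apply: plane_open_measurable.
exact/cF/interval_open.
Qed.

Definition rect (a b c d : R) : set (R * R) := `]a, b[ `*` `]c, d[.

Lemma measurable_rect a b c d : measurable (rect a b c d : set (mplane R)).
Proof. by apply: measurableX; exact: measurable_itv. Qed.

Lemma area_rect a b c d : a <= b -> c <= d ->
  area R (rect a b c d) = ((b - a) * (d - c))%:E.
Proof.
move=> ab cd; rewrite product_measure1E; [|exact: measurable_itv..].
by rewrite /= !lebesgue_measure_itv/= !lte_fin;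
  case: ltP => h1; case: ltP => h2; rewrite -?EFinD -?EFinM ?mul0e ?mule0//; congr EFin; nra.
Qed.

Lemma area_rect_lty a b c d : (area R (rect a b c d) < +oo)%E.
Proof.
rewrite product_measure1E; [|exact: measurable_itv..].
rewrite /= !lebesgue_measure_itv/=.
by case: ifP => _; case: ifP => _; rewrite -?EFinD -?EFinM ?mul0e ?mule0// ltry.
Qed.

Lemma bounded_on_rect F a b c d : continuous F ->
  exists2 k : R, 0 < k & forall z, rect a b c d z -> `|F z| <= k.
Proof.
move=> cF.
have cK : compact (`[a, b]%classic `*` `[c, d]%classic : set (R * R)).
  by apply: compact_setX; exact: segment_compact.
have := @compact_bounded _ _ _ (continuous_compact (continuous_subspaceT cF) cK).
move=> [k [_ kP]]; exists (`|k| + 1); first by rewrite ltr_wpDl.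
move=> z [z1 z2]; apply: (kP (`|k| + 1)); first by rewrite ltr_pwDr// ler_norm.
by exists z => //; split; apply: subset_itv_oo_cc.
Qed.

Lemma bounded_integrable_rect F a b c d k : measurable_fun (rect a b c d) F ->
  (forall z, rect a b c d z -> `|F z| <= k) ->
  (area R).-integrable (rect a b c d) (EFin \o F).
Proof.
move=> mF Fk; apply: measurable_bounded_integrable => //.
- exact: measurable_rect.
- exact: area_rect_lty.
- exists k; split; first exact: num_real.
  by move=> M kM z /Fk /le_trans; apply; exact: ltW.
Qed.

Lemma continuous_integrable_rect F a b c d : continuous F ->
  (area R).-integrable (rect a b c d) (EFin \o F).
Proof.
move=> cF; have [k _ kP] := bounded_on_rect a b c d cF.
apply: bounded_integrable_rect kP.
exact: measurable_funS (plane_continuous_measurable cF).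
Qed.

End plane_measure.

(** * Smooth test functions *)

Section C1_functions.
Context {R : realType}.
Implicit Types (F phi psi : scalar_field R).

Lemma C1_continuous phi : C1 phi -> continuous phi.
Proof. by move=> [dphi _] z; apply: differentiable_continuous. Qed.

Lemma C1D phi psi : C1 phi -> C1 psi -> C1 (fun z => phi z + psi z).
Proof.
move=> [d1 c1] [d2 c2]; split=> [x|v]; first exact: differentiableD.
rewrite (_ : 'D_v _ = fun z => 'D_v phi z + 'D_v psi z); last first.
  by apply/funext => z; rewrite deriveD//; apply: diff_derivable.
by move=> z; apply: cvgD; [exact: c1|exact: c2].
Qed.

Lemma C1M phi psi : C1 phi -> C1 psi -> C1 (fun z => phi z * psi z).
Proof.
move=> C1p C1q; have [d1 c1] := C1p; have [d2 c2] := C1q; split=> [x|v].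
  exact: differentiableM.
rewrite (_ : 'D_v _ = fun z => phi z * 'D_v psi z + psi z * 'D_v phi z); last first.
  by apply/funext => z; rewrite deriveM//; apply: diff_derivable.
move=> z; apply: cvgD; apply: cvgM.
- exact: (C1_continuous C1p).
- exact: c2.
- exact: (C1_continuous C1q).
- exact: c1.
Qed.

Lemma C1_cst (k : R) : C1 (fun=> k).
Proof.
split=> [x|v]; first exact: differentiable_cst.
rewrite (_ : 'D_v _ = fun=> 0); last by apply/funext => z; rewrite derive_cst.
exact: cst_continuous.
Qed.

Lemma C1X phi n : C1 phi -> C1 (fun z => phi z ^+ n).
Proof.
move=> C1p; elim: n => [|n ih]; first exact: C1_cst.
rewrite (_ : (fun _ => _) = (fun z => phi z * phi z ^+ n)); first exact: C1M.
by apply/funext => z; rewrite exprS.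
Qed.

(** Derivatives in the direction v of a function of one variable are v times
    the derivative; this turns directional derivatives of functions of one
    coordinate into ordinary ones. *)
Lemma derive_line (h : R -> R) (t v : R) : derivable h t 1 ->
  'D_v h t = v * 'D_1 h t.
Proof.
move=> dh; rewrite !deriveE; [|exact/derivable1_diffP..].
have -> : v = v *: (1 : R) by rewrite /GRing.scale/= mulr1.
by rewrite linearZ /= /GRing.scale/= mulr1.
Qed.

(** A function of one variable, read as a function of a point of the plane, is
    C1; with its analogue for the second variable and with products, this
    provides all the test functions that are used. *)
Lemma C1_fst (h dh : R -> R) : (forall t : R, is_derive t (1 : R) h (dh t)) -> continuous dh ->
  C1 (fun z : R * R => h z.1).
Proof.
move=> hd ch; split=> [x|v].
  apply: (@differentiable_comp _ _ _ _ (@fst R R) h).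
    by apply: linear_differentiable => z; exact: cvg_fst.
  by apply/derivable1_diffP; case: (hd x.1).
rewrite (_ : 'D_v _ = fun z : R * R => v.1 * dh z.1).
  move=> z; apply: cvgM; first exact: cvg_cst.
  by apply: (@continuous_comp _ _ _ fst dh); [exact: cvg_fst|exact: ch].
apply/funext => z; case: (hd z.1) => dhz <-.
by rewrite -derive_line.
Qed.

Lemma C1_snd (h dh : R -> R) : (forall t : R, is_derive t (1 : R) h (dh t)) -> continuous dh ->
  C1 (fun z : R * R => h z.2).
Proof.
move=> hd ch; split=> [x|v].
  apply: (@differentiable_comp _ _ _ _ (@snd R R) h).
    by apply: linear_differentiable => z; exact: cvg_snd.
  by apply/derivable1_diffP; case: (hd x.2).
rewrite (_ : 'D_v _ = fun z : R * R => v.2 * dh z.2).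
  move=> z; apply: cvgM; first exact: cvg_cst.
  by apply: (@continuous_comp _ _ _ snd dh); [exact: cvg_snd|exact: ch].
apply/funext => z; case: (hd z.2) => dhz <-.
by rewrite -derive_line.
Qed.

(** Partial derivatives are derivatives of sections, so that the
    one-dimensional fundamental theorem applies after Fubini. *)
Lemma derivable_section1 phi x y : differentiable phi (x, y) ->
  is_derive x 1 (fun t => phi (t, y)) ('D_((1, 0) : R * R) phi (x, y)).
Proof.
move=> /(@diff_derivable _ _ _ _ _ ((1, 0) : R * R)) dphi.
have E : (fun h : R => h^-1 *: (phi (h *: 1 + x, y) - phi (x, y))) =
         (fun h : R => h^-1 *: (phi (h *: ((1, 0) : R * R) + (x, y)) - phi (x, y))).
  apply/funext => h; congr (_ *: (phi _ - _)).
  by congr (_, _); rewrite /= /GRing.scale/= mulr0 add0r.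
by split; rewrite /derivable /derive /= E.
Qed.

Lemma derivable_section2 phi x y : differentiable phi (x, y) ->
  is_derive y 1 (fun t => phi (x, t)) ('D_((0, 1) : R * R) phi (x, y)).
Proof.
move=> /(@diff_derivable _ _ _ _ _ ((0, 1) : R * R)) dphi.
have E : (fun h : R => h^-1 *: (phi (x, h *: 1 + y) - phi (x, y))) =
         (fun h : R => h^-1 *: (phi (h *: ((0, 1) : R * R) + (x, y)) - phi (x, y))).
  apply/funext => h; congr (_ *: (phi _ - _)).
  by congr (_, _); rewrite /= /GRing.scale/= mulr0 add0r.
by split; rewrite /derivable /derive /= E.
Qed.

Lemma continuous_section1 F y : continuous F -> continuous (fun t => F (t, y)).
Proof.
move=> cF t.
have cp : (fun t : R => (t, y)) @ t --> ((t, y) : R * R).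
  exact: (cvg_pair cvg_id (cvg_cst y)).
exact: (@continuous_comp _ _ _ (fun t : R => (t, y) : R * R) F t cp (cF _)).
Qed.

Lemma continuous_section2 F x : continuous F -> continuous (fun t => F (x, t)).
Proof.
move=> cF t.
have cp : (fun t : R => (x, t)) @ t --> ((x, t) : R * R).
  exact: (cvg_pair (cvg_cst x) cvg_id).
exact: (@continuous_comp _ _ _ (fun t : R => (x, t) : R * R) F t cp (cF _)).
Qed.

(** The square makes the positive part continuously differentiable at 0, which
    is the regularity asked of test functions. *)
Definition sqpos (t : R) : R := Num.max 0 t ^+ 2.

Lemma sqpos_derive (t : R) : is_derive t (1 : R) sqpos (2 * Num.max 0 t).
Proof.
have cv : (fun h => h^-1 *: (sqpos (h *: 1 + t) - sqpos t)) @ 0^' --> 2 * Num.max 0 t.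
  apply/cvgrPdist_le => e e0; near=> h.
  have h0 : h != 0 by near: h; exact: nbhs_dnbhs_neq.
  have he : `|h| <= e.
    near: h; apply: dnbhs0_le; exact: e0.
  have : `|sqpos (h *: 1 + t) - sqpos t - 2 * Num.max 0 t * h| <= `|h| * `|h|.
    rewrite -normrM ler_norml -[h *: 1]/(h * 1) mulr1 /sqpos ger0_norm ?sqr_ge0 -?expr2 //.
    rewrite !maxEle; case: (leP 0 t) => t0; case: (leP 0 (h + t)) => ht0;
      rewrite ?expr0n /=; nra.
  rewrite /= -[h^-1 *: _]/(h^-1 * _) => H.
  have hp : 0 < `|h| by rewrite normr_gt0.
  rewrite -(ler_pM2l hp) -normrM mulrBr mulVKf// distrC mulrC.
  by apply: le_trans H _; rewrite ler_wpM2l.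
by split; [apply/cvg_ex; eexists; exact: cv|exact/cvg_lim].
Unshelve. all: by end_near.
Qed.

Lemma continuous_maxr0 : continuous (fun t : R => Num.max 0 t).
Proof.
move=> t; apply: (@continuous_max _ _ (fun=> 0) id); [exact: cvg_cst|exact: cvg_id].
Qed.

Definition bump1 (a b t : R) : R := sqpos (t - a) * sqpos (b - t).

Lemma bump1_derive (a b t : R) : is_derive t (1 : R) (bump1 a b)
  (sqpos (t - a) * - (2 * Num.max 0 (b - t)) + sqpos (b - t) * (2 * Num.max 0 (t - a))).
Proof.
have h1 : is_derive t (1 : R) (fun t => sqpos (t - a)) (2 * Num.max 0 (t - a)).
  have d : is_derive t (1 : R) (fun t => t - a) (1 : R).
    by apply: is_derive_eq; rewrite oppr0 addr0.
  by have := @is_derive1_comp _ sqpos (fun t => t - a) t _ _ (sqpos_derive (t - a)) d; rewrite mulr1.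
have h2 : is_derive t (1 : R) (fun t => sqpos (b - t)) (- (2 * Num.max 0 (b - t))).
  have d : is_derive t (1 : R) (fun t => b - t) (-1 : R).
    by have := is_deriveB (is_derive_cst b t 1) (is_derive_id t (1 : R)); rewrite sub0r.
  by have := @is_derive1_comp _ sqpos (fun t => b - t) t _ _ (sqpos_derive (b - t)) d; rewrite mulrN1.
exact: (is_deriveM h1 h2).
Qed.

Lemma continuous_sqpos : continuous sqpos.
Proof.
move=> t; rewrite /sqpos; apply: (@cvgM _ _ _ (nbhs_filter t)); exact: continuous_maxr0.
Qed.

Lemma bump1_derive_continuous (a b : R) : continuous (fun t =>
  sqpos (t - a) * - (2 * Num.max 0 (b - t)) + sqpos (b - t) * (2 * Num.max 0 (t - a))).
Proof.
have ca t : (fun t => t - a) @ t --> t - a by apply: cvgB; [exact: cvg_id|exact: cvg_cst].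
have cb t : (fun t => b - t) @ t --> b - t by apply: cvgB; [exact: cvg_cst|exact: cvg_id].
move=> t; apply: cvgD; apply: cvgM.
- exact: (continuous_comp (ca t) (@continuous_sqpos _)).
- by apply: cvgN; apply: cvgMr; exact: (continuous_comp (cb t) (@continuous_maxr0 _)).
- exact: (continuous_comp (cb t) (@continuous_sqpos _)).
- by apply: cvgMr; exact: (continuous_comp (ca t) (@continuous_maxr0 _)).
Qed.

Lemma bump1_gt0 a b t : a < t < b -> 0 < bump1 a b t.
Proof.
move=> /andP[at_ tb]; rewrite /bump1 /sqpos.
by rewrite !max_r ?subr_ge0 1?ltW// mulr_gt0// exprn_gt0// subr_gt0.
Qed.

Lemma bump1_ge0 a b t : 0 <= bump1 a b t.
Proof. by rewrite mulr_ge0// sqr_ge0. Qed.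

Lemma bump1_eq0 a b t : ~~ (a < t < b) -> bump1 a b t = 0.
Proof.
rewrite negb_and -!leNgt /bump1 /sqpos => /orP[h|h].
  by rewrite (max_l (_ : t - a <= 0)) ?subr_le0// expr0n mul0r.
by rewrite (max_l (_ : b - t <= 0)) ?subr_le0// expr0n mulr0.
Qed.

(** On an interval of length at most 1 the bump needs no normalization to stay
    below 1. *)
Lemma bump1_le1 a b t : b <= a + 1 -> bump1 a b t <= 1.
Proof.
move=> ab; have [/andP[h1 h2]|/bump1_eq0 ->//] := boolP (a < t < b).
have e1 : Num.max 0 (t - a) = t - a by apply: max_r; lra.
have e2 : Num.max 0 (b - t) = b - t by apply: max_r; lra.
by rewrite /bump1 /sqpos e1 e2 -exprMn expr_le1//; nra.
Qed.

Definition bump2 (a b c d : R) : scalar_field R := fun z => bump1 a b z.1 * bump1 c d z.2.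

Lemma bump2_C1 a b c d : C1 (bump2 a b c d).
Proof.
apply: C1M.
  by apply: C1_fst (bump1_derive_continuous (a := a) (b := b)) => t; exact: bump1_derive.
by apply: C1_snd (bump1_derive_continuous (a := c) (b := d)) => t; exact: bump1_derive.
Qed.

Lemma bump2_ge0 a b c d z : 0 <= bump2 a b c d z.
Proof. by rewrite mulr_ge0// bump1_ge0. Qed.

Lemma bump2_gt0 a b c d z : rect a b c d z -> 0 < bump2 a b c d z.
Proof. by rewrite /rect /= !in_itv/= => -[? ?]; rewrite mulr_gt0// bump1_gt0. Qed.

Lemma bump2_eq0 a b c d z : ~ rect a b c d z -> bump2 a b c d z = 0.
Proof.
rewrite /rect /= !in_itv/= => /not_andP[]/negP h.
  by rewrite /bump2 bump1_eq0 ?mul0r.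
by rewrite /bump2 [X in _ * X]bump1_eq0 ?mulr0.
Qed.

Lemma closed_box a b c d : closed (`[a, b]%classic `*` `[c, d]%classic : set (R * R)).
Proof.
apply: compact_closed; first exact: norm_hausdorff.
by apply: compact_setX; exact: segment_compact.
Qed.

Lemma fsupport_box phi a b c d :
  (forall z, ~ rect a b c d z -> phi z = 0) ->
  fsupport phi `<=` `[a, b]%classic `*` `[c, d]%classic.
Proof.
move=> phi0; rewrite /fsupport; rewrite [X in _ `<=` X](closure_id _).1; last exact: closed_box.
apply: closure_subset => z /= /eqP phiz.
have [[z1 z2]|/phi0//] := pselect (rect a b c d z).
by split; apply: subset_itv_oo_cc.
Qed.

(** Compactness of the support comes from the closed box containing it. *)
Lemma test_box phi U a b c d : C1 phi ->
  (forall z, ~ rect a b c d z -> phi z = 0) ->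
  `[a, b]%classic `*` `[c, d]%classic `<=` U -> test U phi.
Proof.
move=> C1phi phi0 sub; have sb := fsupport_box phi0; split => //.
  apply: (subclosed_compact _ _ sb); first exact: closed_closure.
  by apply: compact_setX; exact: segment_compact.
exact: subset_trans sub.
Qed.

End C1_functions.

(** * Green's formula for Raviart-Thomas fields on a rectangle *)

Section green.
Context {R : realType}.
Notation leb := (@lebesgue_measure R).
Implicit Types (F phi psi : scalar_field R).

Lemma continuous_integrable_itv (h : R -> R) a b (s t : bool) : continuous h ->
  leb.-integrable [set` Interval (BSide s a) (BSide t b)] (EFin \o h).
Proof.
move=> ch.
have H : leb.-integrable `[a, b] (EFin \o h).
  apply: continuous_compact_integrable; first exact: segment_compact.
  exact: continuous_subspaceT.
apply: integrableS H; [exact: measurable_itv|exact: measurable_itv|].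
by apply: subset_itv; [case: s|case: t]; rewrite bnd_simp.
Qed.

Lemma affine_derive (a b t : R) : is_derive t (1 : R) (fun t => a + b * t) b.
Proof.
have := is_deriveD (is_derive_cst a t 1) (is_deriveZ b (is_derive_id t (1 : R))).
by rewrite add0r /GRing.scale /= mulr1.
Qed.

(** The fundamental theorem of calculus for the Lebesgue integral over an open
    interval, whose end points have measure zero. *)
Lemma Rintegral_derive (h dh : R -> R) a b : a < b -> continuous dh ->
  (forall t : R, is_derive t (1 : R) h (dh t)) ->
  \int[leb]_(t in `]a, b[) dh t = h b - h a.
Proof.
move=> ab cdh hd.
have ch : continuous h.
  move=> t; apply: differentiable_continuous; apply/derivable1_diffP.
  by case: (hd t).
rewrite Rintegral_itv_obnd_cbnd; last exact: continuous_integrable_itv.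
rewrite Rintegral_itv_bndo_bndc; last exact: continuous_integrable_itv.
rewrite /Rintegral (@continuous_FTC2 _ dh h)//.
- exact: continuous_subspaceT.
- split; first by move=> t _; case: (hd t).
  + exact: (cvg_at_right_filter (ch a)).
  + exact: (cvg_at_left_filter (ch b)).
- by move=> t _; rewrite derive1E; case: (hd t).
Qed.

(** Fubini for continuous functions, in both orders: the first coordinate is
    integrated first for horizontal derivatives and last for vertical ones. *)
Lemma Rintegral_rect F a b c d : continuous F ->
  \int[area R]_(z in rect a b c d) F z =
  \int[leb]_(y in `]c, d[) \int[leb]_(x in `]a, b[) F (x, y) /\
  \int[area R]_(z in rect a b c d) F z =
  \int[leb]_(x in `]a, b[) \int[leb]_(y in `]c, d[) F (x, y).
Proof.
move=> cF.
have iF : (area R).-integrable setT (EFin \o (F \_ (rect a b c d))).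
  rewrite -restrict_EFin.
  have H := @continuous_integrable_rect R F a b c d cF.
  have mr := @measurable_rect R a b c d.
  by have := integrable_restrict (area R) mr measurableT (EFin \o F); rewrite setTI => -[+ _]; apply.
have pE x y : (F \_ (rect a b c d)) (x, y) =
    if (a < x < b) && (c < y < d) then F (x, y) else 0.
  rewrite patchE; case: ifPn; rewrite ?inE /rect/= ?in_itv/=.
    by move=> [/= -> ->].
  rewrite notin_setE /= !in_itv/=.
  by case: (_ < _ < _); case: (_ < _ < _) => // H; exfalso; apply: H.
split; rewrite [LHS]Rintegral_mkcond [LHS]/Rintegral.
- rewrite -integral21_prod_meas1// [RHS]Rintegral_mkcond [RHS]/Rintegral; congr fine.
  apply: eq_integral => y _; rewrite /fubini_G /= patchE mem_setE in_itv/=.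
  case: ifPn => yP.
    rewrite /Rintegral fineK; last first.
      apply: integrable_fin_num; first exact: measurable_itv.
      exact/continuous_integrable_itv/continuous_section1.
    rewrite [RHS]integral_mkcond.
    by apply: eq_integral => x _ /=; rewrite pE yP andbT patchE mem_setE in_itv/=; case: ifP.
  rewrite (_ : (fun x => _) = cst 0%E) ?integral0//.
  by apply/funext => x /=; rewrite pE (negbTE yP) andbF.
- rewrite -integral12_prod_meas1// [RHS]Rintegral_mkcond [RHS]/Rintegral; congr fine.
  apply: eq_integral => x _; rewrite /fubini_F /= patchE mem_setE in_itv/=.
  case: ifPn => xP.
    rewrite /Rintegral fineK; last first.
      apply: integrable_fin_num; first exact: measurable_itv.
      exact/continuous_integrable_itv/continuous_section2.
    rewrite [RHS]integral_mkcond.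
    by apply: eq_integral => y _ /=; rewrite pE xP/= patchE mem_setE in_itv/=; case: ifP.
  rewrite (_ : (fun y => _) = cst 0%E) ?integral0//.
  by apply/funext => y /=; rewrite pE (negbTE xP).
Qed.

Lemma Rintegral_partial1 psi a b c d : a < b -> C1 psi ->
  \int[area R]_(z in rect a b c d) 'D_((1, 0) : R * R) psi z =
  \int[leb]_(y in `]c, d[) psi (b, y) - \int[leb]_(y in `]c, d[) psi (a, y).
Proof.
move=> ab C1p; have [dp cp] := C1p.
rewrite (Rintegral_rect a b c d (cp _)).1 -RintegralB//; last 2 first.
- exact/continuous_integrable_itv/continuous_section2/C1_continuous.
- exact/continuous_integrable_itv/continuous_section2/C1_continuous.
apply: eq_Rintegral => y _; apply: (Rintegral_derive (h := fun x => psi (x, y))) => //.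
  exact: (@continuous_section1 R _ y (cp _)).
by move=> t; exact: derivable_section1.
Qed.

Lemma Rintegral_partial2 psi a b c d : c < d -> C1 psi ->
  \int[area R]_(z in rect a b c d) 'D_((0, 1) : R * R) psi z =
  \int[leb]_(x in `]a, b[) psi (x, d) - \int[leb]_(x in `]a, b[) psi (x, c).
Proof.
move=> ab C1p; have [dp cp] := C1p.
rewrite (Rintegral_rect a b c d (cp _)).2 -RintegralB//; last 2 first.
- exact/continuous_integrable_itv/continuous_section1/C1_continuous.
- exact/continuous_integrable_itv/continuous_section1/C1_continuous.
apply: eq_Rintegral => x _; apply: (Rintegral_derive (h := fun y => psi (x, y))) => //.
  exact: (@continuous_section2 R _ x (cp _)).
by move=> t; exact: derivable_section2.
Qed.

Lemma affine1_C1 (a b : R) : C1 (fun z : R * R => a + b * z.1).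
Proof.
apply: (@C1_fst _ (fun t => a + b * t) (fun=> b)); last exact: cst_continuous.
by move=> t; exact: affine_derive.
Qed.

Lemma affine2_C1 (a b : R) : C1 (fun z : R * R => a + b * z.2).
Proof.
apply: (@C1_snd _ (fun t => a + b * t) (fun=> b)); last exact: cst_continuous.
by move=> t; exact: affine_derive.
Qed.

Lemma partial1_affine (a b : R) phi z : C1 phi ->
  'D_((1, 0) : R * R) (fun z => (a + b * z.1) * phi z) z =
  (a + b * z.1) * 'D_((1, 0) : R * R) phi z + b * phi z.
Proof.
move=> [dphi _]; case: z => x y.
have h1 := derivable_section1 (dphi (x, y)).
have h3 := is_deriveM (affine_derive a b x) h1.
have [da _] := affine1_C1 a b.
have /derivable_section1 h4 := differentiableM (da (x, y)) (dphi (x, y)).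
by have [_ <-] := h4; have [_ ->] := h3; rewrite /= [phi _ *: _]mulrC.
Qed.

Lemma partial2_affine (a b : R) phi z : C1 phi ->
  'D_((0, 1) : R * R) (fun z => (a + b * z.2) * phi z) z =
  (a + b * z.2) * 'D_((0, 1) : R * R) phi z + b * phi z.
Proof.
move=> [dphi _]; case: z => x y.
have h1 := derivable_section2 (dphi (x, y)).
have h3 := is_deriveM (affine_derive a b y) h1.
have [da _] := affine2_C1 a b.
have /derivable_section2 h4 := differentiableM (da (x, y)) (dphi (x, y)).
by have [_ <-] := h4; have [_ ->] := h3; rewrite /= [phi _ *: _]mulrC.
Qed.

(** Apply the fundamental theorem of calculus to the two functions (u_k + v_k
    x_k) phi. The components of a Raviart-Thomas field are constant on each
    side of the rectangle, so they leave the boundary integrals. *)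
Lemma rt0_green phi (u v : R * R) a b c d : a < b -> c < d -> C1 phi ->
  \int[area R]_(z in rect a b c d)
     (dot_grad (rt0 u v) phi z + (v.1 + v.2) * phi z) =
  (u.1 + v.1 * b) * \int[leb]_(y in `]c, d[) phi (b, y)
  - (u.1 + v.1 * a) * \int[leb]_(y in `]c, d[) phi (a, y)
  + ((u.2 + v.2 * d) * \int[leb]_(x in `]a, b[) phi (x, d)
     - (u.2 + v.2 * c) * \int[leb]_(x in `]a, b[) phi (x, c)).
Proof.
move=> ab cd C1p.
have C1a := C1M (affine1_C1 u.1 v.1) C1p.
have C1b := C1M (affine2_C1 u.2 v.2) C1p.
have [_ ca] := C1a; have [_ cb] := C1b.
have i1 x : leb.-integrable `]c, d[ (EFin \o (fun y => phi (x, y))).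
  exact/continuous_integrable_itv/continuous_section2/C1_continuous.
have i2 y : leb.-integrable `]a, b[ (EFin \o (fun x => phi (x, y))).
  exact/continuous_integrable_itv/continuous_section1/C1_continuous.
rewrite -!RintegralZl//.
rewrite -(Rintegral_partial1 (psi := fun z => (u.1 + v.1 * z.1) * phi z))//.
rewrite -(Rintegral_partial2 (psi := fun z => (u.2 + v.2 * z.2) * phi z))//.
rewrite -RintegralD; [|exact: measurable_rect|exact: continuous_integrable_rect..].
apply: eq_Rintegral => z _; rewrite partial1_affine// partial2_affine// /dot_grad /rt0/=.
ring.
Qed.

End green.

(** * The fundamental lemma of the calculus of variations *)

Section fundamental_lemma.
Context {R : realType}.
Implicit Types (h phi : scalar_field R).

Definition rects : set (set (R * R)) :=
  [set A | exists a b c d, A = rect a b c d].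

Lemma rectI a b c d a' b' c' d' : rect a b c d `&` rect a' b' c' d' =
  rect (Num.max a a') (Num.min b b') (Num.max c c') (Num.min d d') :> set (R * R).
Proof.
apply/seteqP; split=> z; rewrite /rect /= !in_itv/= !gt_max !lt_min.
  by move=> [[/andP[-> ->] /andP[-> ->]] [/andP[-> ->] /andP[-> ->]]].
by move=> [/andP[/andP[-> ->] /andP[-> ->]] /andP[/andP[-> ->] /andP[-> ->]]].
Qed.

(** Open rectangles form a pi-system generating the Borel sets of the plane,
    which is what the Dynkin argument below needs. *)
Lemma rects_generate : @measurable _ (measurableTypeR R * measurableTypeR R)%type = <<s rects >>.
Proof.
rewrite measurable_prod_measurableType; apply/seteqP; split; last first.
  apply: smallest_sub; first exact: smallest_sigma_algebra.
  move=> _ [a [b [c [d ->]]]]; apply: sub_sigma_algebra.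
  by exists `]a, b[%classic; [exact: measurable_itv|exists `]c, d[%classic; [exact: measurable_itv|]].
apply: smallest_sub; first exact: smallest_sigma_algebra.
pose T : measurableType _ := g_sigma_algebraType rects.
have strip (a b : R) : <<s rects >> (`]a, b[ `*` setT).
  rewrite (_ : _ `*` _ = \bigcup_n rect a b (- n%:R) n%:R).
    apply: (@bigcupT_measurable _ T) => n; apply: sub_sigma_algebra.
    by exists a, b, (- n%:R), n%:R.
  apply/seteqP; split=> [[x y] [/= xab _]|[x y] [n _ [/= ? ?]]//].
  exists (Num.truncn `|y|).+1 => //; split => //=; rewrite in_itv/=.
  by rewrite -ltr_norml truncnS_gt.
have strip2 (a b : R) : <<s rects >> (setT `*` `]a, b[).
  rewrite (_ : _ `*` _ = \bigcup_n rect (- n%:R) n%:R a b).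
    apply: (@bigcupT_measurable _ T) => n; apply: sub_sigma_algebra.
    by exists (- n%:R), n%:R, a, b.
  apply/seteqP; split=> [[x y] [/= _ xab]|[x y] [n _ [/= ? ?]]//].
  exists (Num.truncn `|x|).+1 => //; split => //=; rewrite in_itv/=.
  by rewrite -ltr_norml truncnS_gt.
have m1 : measurable_fun setT (fst : T -> measurableTypeR R).
  apply: (measurability _ (RGenOpens.measurableE R)).
  move=> _ [_ [a [b ->] <-]]; rewrite setTI.
  rewrite (_ : _ @^-1` _ = `]a, b[ `*` setT); first exact: strip.
  by apply/seteqP; split=> [[x y]//|[x y] []].
have m2 : measurable_fun setT (snd : T -> measurableTypeR R).
  apply: (measurability _ (RGenOpens.measurableE R)).
  move=> _ [_ [a [b ->] <-]]; rewrite setTI.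
  rewrite (_ : _ @^-1` _ = setT `*` `]a, b[ ); first exact: strip2.
  by apply/seteqP; split=> [[x y]//|[x y] []].
move=> _ [A mA [B mB <-]].
rewrite (_ : A `*` B = (setT `&` fst @^-1` A) `&` (setT `&` snd @^-1` B)).
  by apply: (@measurableI _ T); [exact: m1|exact: m2].
by rewrite !setTI; apply/seteqP; split=> [[x y]//|[x y] []].
Qed.

(** The sets on which the integral of h vanishes form a Dynkin system; it
    contains the open rectangles, hence all measurable sets. *)
Lemma ae0_of_rects (h : R * R -> \bar R) : (area R).-integrable setT h ->
  (\int[area R]_z h z = 0)%E ->
  (forall a b c d, \int[area R]_(z in rect a b c d) h z = 0)%E ->
  {ae (area R), forall z, h z = 0%E}.
Proof.
move=> ih h0 hr.
have hA (A : set (mplane R)) : measurable A -> (\int[area R]_(z in A) h z = 0)%E.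
  move=> mA; have {mA} : <<s rects >> A by rewrite -rects_generate.
  pose P (A : set (R * R)) := (\int[area R]_(z in A) h z = 0)%E.
  apply: (@dynkin_induction _ (measurableTypeR R * measurableTypeR R)%type rects P rects_generate).
  - move=> _ _ [a [b [c [d ->]]]] [a' [b' [c' [d' ->]]]].
    by rewrite rectI; do 4 eexists.
  - exact: h0.
  - by move=> _ [a [b [c [d ->]]]].
  - move=> S mS S0.
    have := integral_setU (area R) mS (measurableC mS) (f := h).
    rewrite setUv h0 (S0 : (\int[area R]_(z in S) h z = 0)%E) add0e => H.
    apply/esym/H; first exact: measurable_int ih.
    by apply/disj_setPS; rewrite setICr.
  - move=> F mF tF F0; rewrite /P integral_bigcup//.
      by apply: eseries0 => n _ _; exact: F0.
    by apply: integrableS ih => //; exact: bigcup_measurable.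
have [|N [mN N0 sub]] := integral_ae_eq (measurableT : measurable [set: mplane R]) ih (measurable_cst 0%E).
  by move=> E _ mE; rewrite hA// integral0.
by exists N; split => // z /= hz; apply: sub => /= hz'; apply: hz; exact: hz'.
Qed.

Lemma one_sub_pow_cvg (t : R) : 0 < t <= 1 -> (1 - (1 - t) ^+ n) @[n --> \oo] --> (1 : R).
Proof.
move=> /andP[t0 t1].
have : (fun n => (1 - t) ^+ n) @ \oo --> (0 : R).
  by apply: cvg_expr; rewrite ger0_norm; lra.
by move=> /(cvgB (cvg_cst (1 : R))); rewrite subr0.
Qed.

(** With a bump W with values in (0, 1] on the smaller rectangle and 0
    outside, the functions 1 - (1 - W)^n are C1, have the same support, and
    increase to the indicator of the smaller rectangle; dominated convergence
    passes to the limit. *)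
Lemma test_integral_rect h (a b c d a' b' c' d' : R) : b <= a + 1 -> d <= c + 1 ->
  (area R).-integrable (rect a b c d) (EFin \o h) ->
  (forall phi, test (rect a b c d) phi ->
     \int[area R]_(z in rect a b c d) (h z * phi z) = 0) ->
  a < a' -> b' < b -> c < c' -> d' < d ->
  (\int[area R]_(z in rect a' b' c' d') (h z)%:E = 0)%E.
Proof.
move=> ab cd ih hphi aa bb cc dd.
have mD := @measurable_rect R a b c d; have mE := @measurable_rect R a' b' c' d'.
have sub : rect a' b' c' d' `<=` rect a b c d.
  by move=> z; rewrite /rect /= !in_itv/=; lra.
pose W := bump2 a' b' c' d'.
have W1 z : 0 <= W z <= 1.
  rewrite bump2_ge0 /W /bump2 mulr_ile1 ?bump1_ge0//; apply: bump1_le1; lra.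
(* the approximations of the indicator of the smaller rectangle *)
pose phi n z := 1 - (1 - W z) ^+ n.
have C1phi n : C1 (phi n).
  have h1 : C1 (fun z => (-1) * W z) by apply: C1M; [exact: C1_cst|exact: bump2_C1].
  have h2 : C1 (fun z => 1 - W z).
    rewrite (_ : (fun _ => _) = (fun z => 1 + (-1) * W z)); first exact: (C1D (C1_cst _) h1).
    by apply/funext => z; rewrite mulN1r.
  have h3 := C1M (C1_cst (-1)) (C1X n h2).
  rewrite /phi (_ : (fun _ => _) = (fun z => 1 + (-1) * (1 - W z) ^+ n)).
    exact: (C1D (C1_cst _) h3).
  by apply/funext => z; rewrite mulN1r.
have phi0 n z : ~ rect a' b' c' d' z -> phi n z = 0.
  by move=> /bump2_eq0 W0; rewrite /phi /W W0 subr0 expr1n subrr.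
have phi1 n z : `|phi n z| <= 1.
  have /andP[w0 w1] := W1 z.
  have : 0 <= (1 - W z) ^+ n <= 1.
    by rewrite exprn_ge0 ?exprn_ile1//; lra.
  by rewrite /phi ler_norml; lra.
have tphi n : test (rect a b c d) (phi n).
  apply: (test_box (C1phi n) (@phi0 n)).
  by move=> z; rewrite /rect /= !in_itv/=; lra.
have mphi n : measurable_fun (rect a b c d) (phi n).
  exact: measurable_funS (plane_continuous_measurable (C1_continuous (C1phi n))).
have mh : measurable_fun (rect a b c d) h by apply/measurable_EFinP; exact: measurable_int ih.
pose f_ n z := (h z * phi n z)%:E.
pose f := (EFin \o h) \_ (rect a' b' c' d').
have [|||||_ _] := @dominated_convergence _ _ _ (area R) _ mD f_ f (abse \o (EFin \o h)).
- by move=> n; apply/measurable_EFinP; exact: (measurable_funM mh (mphi n)).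
- apply/(measurable_restrict _ mE mD); rewrite setIidr//.
  by apply: measurable_funS (measurable_int _ ih).
- apply: aeW => z _; rewrite /f patchE; case: ifPn; rewrite ?inE ?notin_setE => zE.
    rewrite /= /f_; apply/fine_cvgP; split; first by near=> n.
    rewrite -[X in _ --> X]mulr1; apply: cvgMr; apply: one_sub_pow_cvg.
    by rewrite bump2_gt0//; have /andP[] := W1 z.
  rewrite (_ : f_ ^~ z = cst 0%E); first exact: cvg_cst.
  by apply/funext => n; rewrite /f_ phi0// mulr0.
- exact: integrable_abse.
- apply: aeW => z n _; rewrite /f_ /= lee_fin normrM -[leRHS]mulr1.
  by apply: ler_wpM2l.
rewrite (_ : [sequence _]_n = cst 0%E); last first.
  apply/funext => n /=; have := hphi _ (tphi n); rewrite /Rintegral => H.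
  rewrite -[LHS]fineK; first by rewrite H.
  apply: integrable_fin_num => //.
  apply: le_integrable (integrable_abse ih) => //.
    by apply/measurable_EFinP; exact: (measurable_funM mh (mphi n)).
  move=> z _ /=; rewrite lee_fin normr_id normrM -[leRHS]mulr1.
  exact: ler_wpM2l.
move=> cv; have /cvg_lim := cv => /(_ (@ereal_hausdorff R)).
by rewrite lim_cst// /f -integral_mkcondr setIidr// => <-.
Unshelve. all: by end_near.
Qed.

(** Integrals over rectangles strictly inside vanish, so h is zero almost
    everywhere on each rectangle shrunk by 1/(n+1), and these exhaust the
    given one. The bounds on the side lengths are met by pixels. *)
Lemma test_ae0 h (a b c d : R) : b <= a + 1 -> d <= c + 1 ->
  (area R).-integrable (rect a b c d) (EFin \o h) ->
  (forall phi, test (rect a b c d) phi ->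
     \int[area R]_(z in rect a b c d) (h z * phi z) = 0) ->
  {ae (area R), forall z, rect a b c d z -> h z = 0}.
Proof.
move=> ab cd ih hphi.
pose E n := rect (a + n.+1%:R^-1) (b - n.+1%:R^-1) (c + n.+1%:R^-1) (d - n.+1%:R^-1).
have mE n : measurable (E n : set (mplane R)) by exact: measurable_rect.
have n0 n : 0 < n.+1%:R^-1 :> R by rewrite invr_gt0.
have key n : {ae (area R), forall z, E n z -> h z = 0}.
  have sub : E n `<=` rect a b c d.
    move=> z; rewrite /E; move: (n0 n); move: (n.+1%:R^-1) => e e0.
    by rewrite /rect /= !in_itv/=; lra.
  have iE : (area R).-integrable (E n) (EFin \o h).
    by apply: integrableS ih; [exact: measurable_rect|exact: mE|exact: sub].
  have H0 a' b' c' d' : (\int[area R]_(z in rect a' b' c' d' `&` E n) (h z)%:E = 0)%E.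
    rewrite /E rectI; apply: (test_integral_rect ab cd ih hphi).
    - by rewrite lt_max ltrDl n0 orbT.
    - by rewrite gt_min gtrBl n0 orbT.
    - by rewrite lt_max ltrDl n0 orbT.
    - by rewrite gt_min gtrBl n0 orbT.
  have := @ae0_of_rects ((EFin \o h) \_ (E n)).
  case.
  - by have [+ _] := @integrable_mkcond _ _ _ (area R) _ (EFin \o h) (mE n); apply.
  - by rewrite -integral_mkcond -[X in (\int[_]_(_ in X) _)%E]setIid /E H0.
  - by move=> a' b' c' d'; rewrite -integral_mkcondr H0.
  move=> N [mN N0 subN]; exists N; split => // z /= /not_implyP[Ez hz]; apply: subN => /=.
  by rewrite patchE mem_set// => -[].
have [N [mN N0 subN]] := ae_foralln key; exists N; split=> // z /= /not_implyP[Dz hz].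
apply: subN => /= H; apply: hz.
move: Dz; rewrite /rect/= !in_itv/= => -[/andP[z1 z2] /andP[z3 z4]].
pose e := Num.min (Num.min (z.1 - a) (b - z.1)) (Num.min (z.2 - c) (d - z.2)).
have e0 : 0 < e by rewrite /e !lt_min !subr_gt0 z1 z2 z3 z4.
have [n ne] : exists n, n.+1%:R^-1 < e.
  exists (Num.truncn e^-1).
  by rewrite -[ltRHS]invrK ltf_pV2 ?posrE ?invr_gt0// truncnS_gt.
apply: (H n); rewrite /E; move: ne; rewrite /e !lt_min.
move: (n.+1%:R^-1) => x; rewrite /rect /= !in_itv/=; lra.
Qed.

End fundamental_lemma.

(** * Integration over the pixels of a rectangle *)

Section pixel_grid.
Context {R : realType}.
Implicit Types (g phi : scalar_field R) (q : vector_field R).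

Definition px (i j : nat) : set (R * R) := rect i%:R i.+1%:R j%:R j.+1%:R.

Lemma vline_null (t : R) : area R ([set t] `*` setT) = 0%E.
Proof.
rewrite product_measure1E; [|exact: measurable_set1|exact: measurableT].
by rewrite /= lebesgue_measure_set1 mul0e.
Qed.

Lemma hline_null (t : R) : area R (setT `*` [set t]) = 0%E.
Proof.
rewrite product_measure1E; [|exact: measurableT|exact: measurable_set1].
by rewrite /= lebesgue_measure_set1 mule0.
Qed.

Lemma measurable_vline (t : R) : measurable ([set t] `*` setT : set (mplane R)).
Proof. by apply: measurableX; [exact: measurable_set1|exact: measurableT]. Qed.

Lemma measurable_hline (t : R) : measurable (setT `*` [set t] : set (mplane R)).
Proof. by apply: measurableX; [exact: measurableT|exact: measurable_set1]. Qed.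

Lemma pixel_strip (n0 n1 : nat) (t : R) : n0%:R < t < n1%:R ->
  (forall k : nat, t <> k%:R) -> exists i, (n0 <= i < n1)%N /\ i%:R < t < i.+1%:R.
Proof.
move=> /andP[t0 t1] tk; have t00 : 0 <= t by apply: le_trans (ltW t0).
exists (Num.truncn t).
have /andP[h1 h2] := truncn_itv t00.
have h1' : (Num.truncn t)%:R < t by rewrite lt_neqAle h1 andbT; apply/eqP => /esym /tk.
rewrite h1' h2; split=> //; apply/andP; split.
  by rewrite -ltnS -(ltr_nat R); apply: lt_trans h2.
by rewrite -(ltr_nat R); apply: lt_trans t1.
Qed.

Lemma ae_imp (P Q : R * R -> Prop) : (forall z, P z -> Q z) ->
  {ae (area R), forall z, P z} -> {ae (area R), forall z, Q z}.
Proof. by move=> PQ [N [mN N0 sub]]; exists N; split => // z nQ; apply: sub => /PQ. Qed.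

Lemma ae_imp2 (P1 P2 Q : R * R -> Prop) : (forall z, P1 z -> P2 z -> Q z) ->
  {ae (area R), forall z, P1 z} -> {ae (area R), forall z, P2 z} ->
  {ae (area R), forall z, Q z}.
Proof.
move=> PQ h1 h2; have FF := @ae_filter_ringOfSetsType _ (mplane R) R (area R).
exact: (filterS2 _ PQ h1 h2).
Qed.

(** The grid lines are countably many null sets. *)
Lemma ae_pixels (P : R * R -> Prop) x0 x1 y0 y1 :
  (forall i j, (x0 <= i < x1)%N -> (y0 <= j < y1)%N ->
    {ae (area R), forall z, px i j z -> P z}) ->
  {ae (area R), forall z, open_rect R x0 x1 y0 y1 z -> P z}.
Proof.
move=> H.
have hv : {ae (area R), forall z : R * R, forall k : nat, z.1 <> k%:R}.
  apply: ae_foralln => k; exists ([set (k%:R : R)] `*` setT); split => //.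
  - exact: measurable_vline.
  - exact: vline_null.
  - by move=> z /= /contrapT ->.
have hh : {ae (area R), forall z : R * R, forall k : nat, z.2 <> k%:R}.
  apply: ae_foralln => k; exists (setT `*` [set (k%:R : R)]); split => //.
  - exact: measurable_hline.
  - exact: hline_null.
  - by move=> z /= /contrapT ->.
have hP : {ae (area R), forall z, forall i j : nat, (x0 <= i < x1)%N -> (y0 <= j < y1)%N ->
    px i j z -> P z}.
  apply: ae_foralln => i; apply: ae_foralln => j.
  have [ij|ij] := boolP ((x0 <= i < x1)%N && (y0 <= j < y1)%N).
    by move: ij => /andP[hi hj]; apply: ae_imp (H i j hi hj) => z h _ _; exact: h.
  by apply: aeW => z hi hj; rewrite hi hj in ij.
apply: (ae_imp2 _ (ae_imp2 (fun z h1 h2 => conj h1 h2) hv hh) hP).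
move=> z [zv zh] zP [/= z1 z2].
move: z1 z2; rewrite !in_itv/= => z1 z2.
have [i [hi zi]] := pixel_strip z1 zv; have [j [hj zj]] := pixel_strip z2 zh.
by apply: (zP i j hi hj); split; rewrite /= in_itv.
Qed.

(** The vertical line between the two halves is a null set. *)
Lemma integral_split1 (a b c d e : R) (F : R * R -> \bar R) : a <= b -> b <= c ->
  (area R).-integrable (rect a c d e) F ->
  (\int[area R]_(z in rect a c d e) F z =
   \int[area R]_(z in rect a b d e) F z + \int[area R]_(z in rect b c d e) F z)%E.
Proof.
move=> ab bc iF.
rewrite (negligible_integral (measurable_vline b) (@measurable_rect R a c d e) iF (vline_null b)).
have -> : rect a c d e `\` ([set b] `*` setT) = rect a b d e `|` rect b c d e.
  apply/seteqP; split=> [[x y]|[x y]]; rewrite /rect /= !in_itv/=.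
    move=> [[/andP[x1 x2] ->] /not_andP[xb|//]].
    by case: (ltgtP x b) => [h|h|//]; [left|right]; split => //; rewrite ?x1 ?x2 ?h.
  by move=> [[/andP[x1 x2] ->]|[/andP[x1 x2] ->]]; (split; [split => //; lra|]);
     move=> [xb _]; lra.
rewrite integral_setU//.
- exact: measurable_rect.
- exact: measurable_rect.
- apply: measurable_funS (measurable_int _ iF); first exact: measurable_rect.
  by move=> [x y]; rewrite /rect /= !in_itv/=; case; lra.
- apply/disj_setPS => -[x y]; rewrite /rect /= !in_itv/=; lra.
Qed.

Lemma integral_split2 (a b c d e : R) (F : R * R -> \bar R) : c <= d -> d <= e ->
  (area R).-integrable (rect a b c e) F ->
  (\int[area R]_(z in rect a b c e) F z =
   \int[area R]_(z in rect a b c d) F z + \int[area R]_(z in rect a b d e) F z)%E.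
Proof.
move=> cd de iF.
rewrite (negligible_integral (measurable_hline d) (@measurable_rect R a b c e) iF (hline_null d)).
have -> : rect a b c e `\` (setT `*` [set d]) = rect a b c d `|` rect a b d e.
  apply/seteqP; split=> [[x y]|[x y]]; rewrite /rect /= !in_itv/=.
    move=> [[-> /andP[x1 x2]] /not_andP[//|xb]].
    by case: (ltgtP y d) => [h|h|//]; [left|right]; split => //; rewrite ?x1 ?x2 ?h.
  by move=> [[-> /andP[x1 x2]]|[-> /andP[x1 x2]]]; (split; [split => //; lra|]);
     move=> [_ xb]; lra.
rewrite integral_setU//.
- exact: measurable_rect.
- exact: measurable_rect.
- apply: measurable_funS (measurable_int _ iF); first exact: measurable_rect.
  by move=> [x y]; rewrite /rect /= !in_itv/=; case; lra.
- apply/disj_setPS => -[x y]; rewrite /rect /= !in_itv/=; lra.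
Qed.

Lemma rect_empty1 (a c d : R) : rect a a c d = set0.
Proof. by apply/seteqP; split=> // z; rewrite /rect /= !in_itv/=; lra. Qed.

Lemma rect_empty2 (a b c : R) : rect a b c c = set0.
Proof. by apply/seteqP; split=> // z; rewrite /rect /= !in_itv/=; lra. Qed.

Lemma integral_pixels x0 x1 y0 y1 (F : R * R -> \bar R) : (x0 <= x1)%N -> (y0 <= y1)%N ->
  (area R).-integrable (open_rect R x0 x1 y0 y1) F ->
  (\int[area R]_(z in open_rect R x0 x1 y0 y1) F z =
   \sum_(x0 <= i < x1) \sum_(y0 <= j < y1) \int[area R]_(z in px i j) F z)%E.
Proof.
move=> x01 y01 iF.
have strips : (\int[area R]_(z in open_rect R x0 x1 y0 y1) F z =
   \sum_(x0 <= i < x1) \int[area R]_(z in rect i%:R i.+1%:R y0%:R y1%:R) F z)%E.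
  elim: x1 x01 iF => [|n ih].
    by rewrite leqn0 => /eqP -> _; rewrite big_geq// /open_rect -/(rect _ _ _ _) rect_empty1 integral_set0.
  rewrite leq_eqVlt => /predU1P[<- _|]; first by rewrite big_geq// /open_rect -/(rect _ _ _ _) rect_empty1 integral_set0.
  rewrite ltnS => x0n iF; rewrite big_nat_recr//= -ih//; last first.
    apply: integrableS iF; [exact: measurable_rect|exact: measurable_rect|].
    move=> z [/= z1 z2]; split => //=; move: z1; rewrite !in_itv/= => /andP[-> /lt_le_trans]; apply.
    by rewrite ler_nat.
  by apply: integral_split1 => //; rewrite ler_nat.
rewrite strips [LHS]big_nat_cond [RHS]big_nat_cond; apply: eq_bigr => i /andP[/andP[x0i ix1] _].
have {}iF : (area R).-integrable (rect i%:R i.+1%:R y0%:R y1%:R) F.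
  apply: integrableS iF; [exact: measurable_rect|exact: measurable_rect|].
  move=> z [/= z1 z2]; split => //=; move: z1; rewrite !in_itv/= => /andP[h1 h2].
  rewrite (le_lt_trans _ h1) ?ler_nat// (lt_le_trans h2)// ler_nat//.
elim: y1 y01 iF {strips} => [|n ih].
  by rewrite leqn0 => /eqP -> _; rewrite big_geq// rect_empty2 integral_set0.
rewrite leq_eqVlt => /predU1P[<- _|]; first by rewrite big_geq// rect_empty2 integral_set0.
rewrite ltnS => y0n iF; rewrite big_nat_recr//= -ih//; last first.
  apply: integrableS iF; [exact: measurable_rect|exact: measurable_rect|].
  move=> z [/= z1 z2]; split => //=; move: z2; rewrite !in_itv/= => /andP[-> /lt_le_trans]; apply.
  by rewrite ler_nat.
by apply: integral_split2 => //; rewrite ler_nat.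
Qed.

Lemma px_sub_open_rect i j x0 x1 y0 y1 : (x0 <= i < x1)%N -> (y0 <= j < y1)%N ->
  px i j `<=` open_rect R x0 x1 y0 y1.
Proof.
move=> /andP[i0 i1] /andP[j0 j1] z [/= ]; rewrite !in_itv/= => /andP[z1 z2] /andP[z3 z4].
split; rewrite /= in_itv/=.
  by rewrite (le_lt_trans _ z1) ?ler_nat// (lt_le_trans z2)// ler_nat.
by rewrite (le_lt_trans _ z3) ?ler_nat// (lt_le_trans z4)// ler_nat.
Qed.

Lemma Rintegral_pixels x0 x1 y0 y1 g : (x0 <= x1)%N -> (y0 <= y1)%N ->
  (area R).-integrable (open_rect R x0 x1 y0 y1) (EFin \o g) ->
  \int[area R]_(z in open_rect R x0 x1 y0 y1) g z =
   \sum_(x0 <= i < x1) \sum_(y0 <= j < y1) \int[area R]_(z in px i j) g z.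
Proof.
move=> x01 y01 ig; rewrite /Rintegral integral_pixels//.
rewrite (_ : (\sum_(x0 <= i < x1) _)%E =
   (\sum_(x0 <= i < x1) \sum_(y0 <= j < y1) fine (\int[area R]_(z in px i j) (g z)%:E))%:E)//.
rewrite -sumEFin [LHS]big_nat_cond [RHS]big_nat_cond; apply: eq_bigr => i /andP[hi _].
rewrite -sumEFin [LHS]big_nat_cond [RHS]big_nat_cond; apply: eq_bigr => j /andP[hj _].
rewrite fineK//; apply: integrable_fin_num; first exact: measurable_rect.
apply: integrableS ig; [exact: measurable_rect|exact: measurable_rect|exact: px_sub_open_rect].
Qed.

(** A rectangle has finite area, and |g| <= 1 + g^2. *)
Lemma L2_integrable g a b c d : L2 (rect a b c d) g ->
  (area R).-integrable (rect a b c d) (EFin \o g).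
Proof.
move=> [mg ig2].
have i1 : (area R).-integrable (rect a b c d) (EFin \o (fun=> 1 : R)).
  by apply: continuous_integrable_rect; exact: cst_continuous.
have := integrableD (@measurable_rect R a b c d) i1 ig2.
apply: le_integrable; first exact: measurable_rect.
  exact/measurable_EFinP.
move=> z _ /=; rewrite lee_fin ler_norml; apply/andP; split; rewrite ger0_norm ?addr_ge0 ?sqr_ge0//; nra.
Qed.

Lemma integrableM_continuous g phi a b c d : (area R).-integrable (rect a b c d) (EFin \o g) ->
  continuous phi -> (area R).-integrable (rect a b c d) (EFin \o (fun z => g z * phi z)).
Proof.
move=> ig cphi; have [k k0 kP] := bounded_on_rect a b c d cphi.
have := integrableZl (@measurable_rect R a b c d) k ig.
apply: le_integrable; first exact: measurable_rect.
  apply/measurable_EFinP; apply: measurable_funM.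
    by apply/measurable_EFinP; exact: measurable_int ig.
  exact: measurable_funS (plane_continuous_measurable cphi).
move=> z Dz /=; rewrite lee_fin !normrM (gtr0_norm k0) mulrC; apply: ler_wpM2r => //.
exact: kP.
Qed.

Lemma ae_bounded_L2 g (a b c d k : R) : measurable_fun (rect a b c d) g ->
  {ae (area R), forall z, rect a b c d z -> `|g z| <= k} -> L2 (rect a b c d) g.
Proof.
move=> mg gk; split => //; apply/integrableP; split.
  by apply/measurable_EFinP; exact: measurable_funX.
apply: le_lt_trans.
  apply: (@integral_le_bound _ (mplane R) R (area R) (rect a b c d) (fun z => (g z ^+ 2)%:E) ((`|k| ^+ 2)%:E)).
  - exact: measurable_rect.
  - by apply/measurable_EFinP; exact: measurable_funX.
  - by rewrite lee_fin sqr_ge0.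
  apply: ae_imp gk => z h Dz; rewrite /= lee_fin normrX lerXn2r ?nnegrE//.
  by rewrite (le_trans (h Dz))// ler_norm.
by rewrite lte_mul_pinfty// ?lee_fin ?sqr_ge0// area_rect_lty.
Qed.

End pixel_grid.

(** * Piecewise Raviart-Thomas fields *)

Section local_fields.
Context {R : realType}.
Notation leb := (@lebesgue_measure R).
Implicit Types (g phi F : scalar_field R) (q : vector_field R) (a b : R * R).

(** The vertical edge has the lower end (k, l), the horizontal edge of htrace
    the left end (k, l). These two integrals are the functionals through which
    the test function enters in the Green formula. *)
Definition vtrace phi (k l : nat) : R := \int[leb]_(y in `]l%:R, l.+1%:R[) phi (k%:R, y).
Definition htrace phi (k l : nat) : R := \int[leb]_(x in `]k%:R, k.+1%:R[) phi (x, l%:R).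

Lemma fsupportP phi z : phi z != 0 -> fsupport phi z.
Proof. by move=> h; apply: subset_closure. Qed.

(** Outside its support a test function is zero in a neighbourhood, so its
    derivatives vanish too. *)
Lemma test_outside U phi z : test U phi -> ~ U z ->
  phi z = 0 /\ forall v, 'D_v phi z = 0.
Proof.
move=> [_ _ sub] nUz.
have nz : ~ fsupport phi z by move=> /sub.
split; first by apply/eqP/negPn/negP => /fsupportP.
move=> v.
have oC : open (~` fsupport phi) by apply: closed_openC; exact: closed_closure.
have : \forall w \near z, phi w = cst 0 w.
  have := open_nbhs_nbhs (conj oC (nz : (~` fsupport phi) z)); apply: filterS => w nw.
  by apply/eqP/negPn/negP => /fsupportP.
by move=> /(near_eq_derive v) ->; rewrite derive_cst.
Qed.

Lemma test_sub U U' phi : U `<=` U' -> test U phi -> test U' phi.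
Proof. by move=> UU [? ? s]; split => //; exact: subset_trans UU. Qed.

Lemma dot_grad_outside U q phi z : test U phi -> ~ U z -> dot_grad q phi z = 0.
Proof. by move=> t nU; have [_ d0] := test_outside t nU; rewrite /dot_grad !d0 !mulr0 addr0. Qed.

Lemma Rintegral_sub (D E : set (R * R)) F : E `<=` D -> (forall z, ~ E z -> F z = 0) ->
  \int[area R]_(z in D) F z = \int[area R]_(z in E) F z.
Proof.
move=> ED F0; rewrite Rintegral_mkcond [RHS]Rintegral_mkcond; congr Rintegral.
apply/funext => z; rewrite !patchE.
case: ifPn; rewrite ?inE ?notin_setE => zD; case: ifPn; rewrite ?inE ?notin_setE => zE //.
  exact: F0.
by exfalso; apply/zD/ED.
Qed.

Lemma ae_eq_Rintegral (D : set (mplane R)) F F' : measurable D ->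
  (area R).-integrable D (EFin \o F) -> (area R).-integrable D (EFin \o F') ->
  {ae (area R), forall z, D z -> F z = F' z} ->
  \int[area R]_(z in D) F z = \int[area R]_(z in D) F' z.
Proof.
move=> mD iF iF' ae; rewrite /Rintegral; congr fine; apply: ae_eq_integral => //.
- exact: measurable_int iF.
- exact: measurable_int iF'.
- by apply: ae_imp ae => z h Dz; rewrite /= h.
Qed.

Lemma dot_grad_integrable q phi (a b c d : R) : C1 phi ->
  (area R).-integrable (rect a b c d) (EFin \o (fun z => (q z).1)) ->
  (area R).-integrable (rect a b c d) (EFin \o (fun z => (q z).2)) ->
  (area R).-integrable (rect a b c d) (EFin \o dot_grad q phi).
Proof.
move=> [_ cphi] i1 i2.
have := integrableD (@measurable_rect R a b c d)
  (integrableM_continuous i1 (cphi (1, 0))) (integrableM_continuous i2 (cphi (0, 1))).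
by apply: eq_integrable => //; exact: measurable_rect.
Qed.

Lemma rt0_continuous1 a b : continuous (fun z => (rt0 a b z).1).
Proof. exact/C1_continuous/affine1_C1. Qed.

Lemma rt0_continuous2 a b : continuous (fun z => (rt0 a b z).2).
Proof. exact/C1_continuous/affine2_C1. Qed.

Lemma px_green i j a b phi : C1 phi ->
  \int[area R]_(z in px i j) (dot_grad (rt0 a b) phi z + (b.1 + b.2) * phi z) =
  (a.1 + b.1 * i.+1%:R) * vtrace phi i.+1 j - (a.1 + b.1 * i%:R) * vtrace phi i j
  + ((a.2 + b.2 * j.+1%:R) * htrace phi i j.+1 - (a.2 + b.2 * j%:R) * htrace phi i j).
Proof. by move=> C1p; apply: rt0_green => //; rewrite ltr_nat. Qed.

Lemma px_green_ae i j a b phi q g : C1 phi ->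
  (area R).-integrable (px i j) (EFin \o (fun z => (q z).1)) ->
  (area R).-integrable (px i j) (EFin \o (fun z => (q z).2)) ->
  (area R).-integrable (px i j) (EFin \o g) ->
  ae_eq_on (px i j) q (rt0 a b) ->
  {ae (area R), forall z, px i j z -> g z = b.1 + b.2} ->
  \int[area R]_(z in px i j) dot_grad q phi z + \int[area R]_(z in px i j) (g z * phi z) =
  (a.1 + b.1 * i.+1%:R) * vtrace phi i.+1 j - (a.1 + b.1 * i%:R) * vtrace phi i j
  + ((a.2 + b.2 * j.+1%:R) * htrace phi i j.+1 - (a.2 + b.2 * j%:R) * htrace phi i j).
Proof.
move=> C1p i1 i2 ig qe ge; rewrite -px_green//.
have cphi := C1_continuous C1p.
have mp : measurable (px i j : set (mplane R)) by exact: measurable_rect.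
have k1 := dot_grad_integrable C1p i1 i2.
have k2 := integrableM_continuous ig cphi.
have k3 : (area R).-integrable (px i j) (EFin \o (fun z => (b.1 + b.2) * phi z)).
  apply: (integrableM_continuous _ cphi).
  by apply: continuous_integrable_rect; exact: cst_continuous.
have k4 : (area R).-integrable (px i j) (EFin \o dot_grad (rt0 a b) phi).
  apply: dot_grad_integrable => //; apply: continuous_integrable_rect.
    exact: rt0_continuous1.
  exact: rt0_continuous2.
rewrite RintegralD//; congr (_ + _); apply: ae_eq_Rintegral => //.
  by apply: ae_imp qe => z h /h hz; rewrite /dot_grad hz.
by apply: ae_imp ge => z h /h ->.
Qed.

Lemma px_trace_test i j phi : test (px i j) phi ->
  [/\ vtrace phi i j = 0, vtrace phi i.+1 j = 0, htrace phi i j = 0 & htrace phi i j.+1 = 0].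
Proof.
move=> t.
have out z : ~ px i j z -> phi z = 0 by move=> /(test_outside t)[].
have z0 (D : set R) (h : R -> R) : (forall x, h x = 0) -> \int[leb]_(x in D) h x = 0.
  by move=> h0; rewrite (_ : h = cst 0) ?Rintegral_cst0 //; [rewrite /Rintegral integral0|apply/funext].
split; apply: z0 => x; apply: out; rewrite /px /rect /= !in_itv/= ltxx ?andbF; by case.
Qed.

(** A test function of the pixel is a test function of the whole rectangle.
    Comparing the weak divergence with Green's formula on the pixel, where all
    traces vanish, shows that g minus the classical divergence is orthogonal
    to all test functions of the pixel. *)
Lemma div_ae_px q g (x0 x1 y0 y1 i j : nat) a b :
  L2 (open_rect R x0 x1 y0 y1) (fun z => (q z).1) ->
  L2 (open_rect R x0 x1 y0 y1) (fun z => (q z).2) ->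
  is_div (open_rect R x0 x1 y0 y1) q g ->
  (x0 <= i < x1)%N -> (y0 <= j < y1)%N -> ae_eq_on (px i j) q (rt0 a b) ->
  {ae (area R), forall z, px i j z -> g z = b.1 + b.2}.
Proof.
move=> L1 L2' [Lg gd] hi hj qe.
have pD := @px_sub_open_rect R i j x0 x1 y0 y1 hi hj.
have mp : measurable (px i j : set (mplane R)) by exact: measurable_rect.
have mD : measurable (open_rect R x0 x1 y0 y1 : set (mplane R)) by exact: measurable_rect.
have iD (k : scalar_field R) : L2 (open_rect R x0 x1 y0 y1) k -> (area R).-integrable (px i j) (EFin \o k).
  by move=> /L2_integrable ik; apply: integrableS ik.
have ic : (area R).-integrable (px i j) (EFin \o (fun=> b.1 + b.2)).
  by apply: continuous_integrable_rect; exact: cst_continuous.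
have key : {ae (area R), forall z, px i j z -> g z - (b.1 + b.2) = 0}.
  apply: test_ae0; rewrite -?natr1//.
    have := integrableB mp (iD _ Lg) ic; rewrite /px -!natr1.
    by apply: eq_integrable => //; exact: measurable_rect.
  rewrite !natr1 -/(px i j) => phi t.
  have C1p : C1 phi by case: t.
  have tD := test_sub pD t.
  have e1 := gd _ tD.
  rewrite (Rintegral_sub pD) in e1; last by move=> z; exact: dot_grad_outside.
  rewrite [in RHS](Rintegral_sub pD) in e1; last first.
    by move=> z /(test_outside t)[-> _]; rewrite mulr0.
  have e2 := px_green_ae C1p (iD _ L1) (iD _ L2') ic qe (aeW _ (fun _ _ => erefl)).
  have [h1 h2 h3 h4] := px_trace_test t.
  rewrite h1 h2 h3 h4 !mulr0 !subr0 addr0 e1 in e2.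
  have cphi := C1_continuous C1p.
  transitivity (\int[area R]_(z in px i j) (g z * phi z - (b.1 + b.2) * phi z)).
    by apply: eq_Rintegral => z _; rewrite mulrBl.
  rewrite RintegralB//; last 2 first.
  - exact: (integrableM_continuous (iD _ Lg) cphi).
  - exact: (integrableM_continuous ic cphi).
  by rewrite -(opprK (\int[_]_(_ in _) (g _ * _))) -opprD e2 oppr0.
by apply: ae_imp key => z h /h /eqP; rewrite subr_eq0 => /eqP.
Qed.

Lemma piecewise_green q g (x0 x1 y0 y1 : nat) (A B : nat -> nat -> R * R) phi :
  (x0 <= x1)%N -> (y0 <= y1)%N -> C1 phi ->
  L2 (open_rect R x0 x1 y0 y1) (fun z => (q z).1) ->
  L2 (open_rect R x0 x1 y0 y1) (fun z => (q z).2) ->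
  L2 (open_rect R x0 x1 y0 y1) g ->
  (forall i j, (x0 <= i < x1)%N -> (y0 <= j < y1)%N ->
    ae_eq_on (px i j) q (rt0 (A i j) (B i j))) ->
  (forall i j, (x0 <= i < x1)%N -> (y0 <= j < y1)%N ->
    {ae (area R), forall z, px i j z -> g z = (B i j).1 + (B i j).2}) ->
  \int[area R]_(z in open_rect R x0 x1 y0 y1) dot_grad q phi z
  + \int[area R]_(z in open_rect R x0 x1 y0 y1) (g z * phi z) =
  \sum_(x0 <= i < x1) \sum_(y0 <= j < y1)
    (((A i j).1 + (B i j).1 * i.+1%:R) * vtrace phi i.+1 j
     - ((A i j).1 + (B i j).1 * i%:R) * vtrace phi i j
     + (((A i j).2 + (B i j).2 * j.+1%:R) * htrace phi i j.+1
     - ((A i j).2 + (B i j).2 * j%:R) * htrace phi i j)).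
Proof.
move=> x01 y01 C1p L1 L2' Lg qe ge.
have i1 := L2_integrable L1; have i2 := L2_integrable L2'; have ig := L2_integrable Lg.
have cphi := C1_continuous C1p.
rewrite (Rintegral_pixels x01 y01 (dot_grad_integrable C1p i1 i2)).
rewrite (Rintegral_pixels x01 y01 (integrableM_continuous ig cphi)).
rewrite -big_split/= [LHS]big_nat_cond [RHS]big_nat_cond; apply: eq_bigr => i /andP[hi _].
rewrite -big_split/= [LHS]big_nat_cond [RHS]big_nat_cond; apply: eq_bigr => j /andP[hj _].
have pD := @px_sub_open_rect R i j x0 x1 y0 y1 hi hj.
have mp : measurable (px i j : set (mplane R)) by exact: measurable_rect.
have mD : measurable (open_rect R x0 x1 y0 y1 : set (mplane R)) by exact: measurable_rect.
apply: px_green_ae => //; try exact: qe; try exact: ge.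
- exact: integrableS i1.
- exact: integrableS i2.
- exact: integrableS ig.
Qed.

End local_fields.

(** * The boundary of a rectangle *)

Section boundary_rect.
Context {R : realType}.

Lemma rect_open (a b c d : R) : open (rect a b c d).
Proof.
have -> : rect a b c d = (@fst R R @^-1` `]a, b[) `&` (@snd R R @^-1` `]c, d[) by [].
apply: openI; apply: open_comp; try exact: interval_open.
  by move=> z _; exact: cvg_fst.
by move=> z _; exact: cvg_snd.
Qed.

(** A point of the closed rectangle is approached along the segment to the
    centre, which lies inside. *)
Lemma closure_rect (a b c d : R) : a < b -> c < d ->
  closure (rect a b c d) = `[a, b]%classic `*` `[c, d]%classic.
Proof.
move=> ab cd; apply/seteqP; split.
  rewrite [X in _ `<=` X](closure_id _).1; last exact: closed_box.
  by apply: closure_subset => z [z1 z2]; split; apply: subset_itv_oo_cc.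
move=> [x y] [/=]; rewrite !in_itv/= => /andP[x0 x1] /andP[y0 y1] U.
rewrite -nbhs_ballE => -[e /= e0 sub].
(* small enough to stay within distance e of the given point *)
pose t := Num.min 1 (e / (2 * (1 + (b - a) + (d - c)))).
have w0 : 0 < 1 + (b - a) + (d - c) by lra.
have t0 : 0 < t by rewrite lt_min ltr01 divr_gt0// mulr_gt0.
have t1 : t <= 1 by rewrite ge_min lexx.
have te : t * (1 + (b - a) + (d - c)) < e.
  have : t <= e / (2 * (1 + (b - a) + (d - c))) by rewrite ge_min lexx orbT.
  rewrite ler_pdivlMr ?mulr_gt0// => h; nra.
exists (x + t * ((a + b) / 2 - x), y + t * ((c + d) / 2 - y)); split.
  by rewrite /rect/= !in_itv/=; split; apply/andP; split; nra.
apply: sub; split; rewrite /ball/= ltr_norml; apply/andP; split; nra.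
Qed.

Lemma boundary_rect (a b c d : R) z : a < b -> c < d ->
  boundary (rect a b c d) z <->
  [/\ a <= z.1 <= b, c <= z.2 <= d & ~ (a < z.1 < b /\ c < z.2 < d)].
Proof.
move=> ab cd; rewrite /boundary closure_rect//.
have -> : interior (rect a b c d) = rect a b c d.
  apply/seteqP; split; first exact: interior_subset.
  by have := @rect_open a b c d; rewrite openE.
by rewrite /setD /rect /= !in_itv/=; split=> [[[? ?] ?]|[? ? ?]]; split.
Qed.
End boundary_rect.

(** * Bumps concentrated on one edge *)

Section edge_bumps.
Context {R : realType}.
Notation leb := (@lebesgue_measure R).

Definition vseg (k l : nat) : set (R * R) := [set k%:R] `*` `]l%:R, l.+1%:R[.
Definition hseg (k l : nat) : set (R * R) := `]k%:R, k.+1%:R[ `*` [set l%:R].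

(** The box around the vertical edge stays 1/4 away from all other edges of
    the grid, so that the only nonzero trace is the one on the edge itself. *)
Definition vbump (k l : nat) : scalar_field R :=
  bump2 (k%:R - 4^-1) (k%:R + 4^-1) (l%:R + 4^-1) (l%:R + 1 - 4^-1).
Definition hbump (k l : nat) : scalar_field R :=
  bump2 (k%:R + 4^-1) (k%:R + 1 - 4^-1) (l%:R - 4^-1) (l%:R + 4^-1).

Lemma nat_gap (i k : nat) : i != k -> i%:R + 1 <= k%:R :> R \/ k%:R + 1 <= i%:R :> R.
Proof. by rewrite neq_ltn => /orP[h|h]; [left|right]; rewrite natr1 ler_nat. Qed.

Lemma bump1_off_nat (i l : nat) : bump1 (l%:R + 4^-1 : R) (l%:R + 1 - 4^-1) i%:R = 0.
Proof.
apply: bump1_eq0; apply/negP => /andP[h1 h2].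
have [e|/nat_gap] := eqVneq i l; first by move: h1 h2; rewrite e; lra.
by case; lra.
Qed.

Lemma bump1_far (i k : nat) : i != k -> bump1 (k%:R - 4^-1 : R) (k%:R + 4^-1) i%:R = 0.
Proof. by move=> /nat_gap h; apply: bump1_eq0; apply/negP => /andP[h1 h2]; case: h; lra. Qed.

Lemma bump1_at (k : nat) : 0 < bump1 (k%:R - 4^-1 : R) (k%:R + 4^-1) k%:R.
Proof. by apply: bump1_gt0; lra. Qed.

Lemma bump1_far_itv (j l : nat) (y : R) : j != l -> j%:R < y < j.+1%:R ->
  bump1 (l%:R + 4^-1 : R) (l%:R + 1 - 4^-1) y = 0.
Proof.
rewrite -natr1 => /nat_gap h /andP[y0 y1]; apply: bump1_eq0; apply/negP => /andP[h1 h2].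
by case: h; lra.
Qed.

Lemma bump1_continuous (a b : R) : continuous (bump1 a b).
Proof.
move=> t; apply: differentiable_continuous; apply/derivable1_diffP.
by case: (bump1_derive a b t).
Qed.

(** On the middle quarter of the interval the bump is at least 8^-4. *)
Lemma bump1_integral_gt0 (l : nat) :
  0 < \int[leb]_(y in `]l%:R, l.+1%:R[) bump1 (l%:R + 4^-1 : R) (l%:R + 1 - 4^-1) y.
Proof.
set h := bump1 _ _.
have ch : continuous h by exact: bump1_continuous.
(* where both factors of the bump are at least (1/8)^2 *)
pose J : set R := `]l%:R + 3 * 8^-1, l%:R + 5 * 8^-1[%classic.
have mJ : measurable J by exact: measurable_itv.
have sub : J `<=` `]l%:R, l.+1%:R[.
  by move=> y; rewrite /J/= !in_itv/= -natr1; lra.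
have i1 : leb.-integrable J (EFin \o h) by exact: continuous_integrable_itv.
have i2 : leb.-integrable J (EFin \o (fun=> (8^-1) ^+ 4)).
  by apply: continuous_integrable_itv; exact: cst_continuous.
have c0 : 0 < (8^-1 : R) ^+ 4 by rewrite exprn_gt0// invr_gt0.
apply: (@lt_le_trans _ _ (\int[leb]_(y in J) h y)); last first.
  rewrite /Rintegral fine_le//.
  - by apply: integrable_fin_num.
  - by apply: integrable_fin_num => //; exact: continuous_integrable_itv.
  apply: ge0_subset_integral => //.
    by apply: measurable_int; exact: (continuous_integrable_itv _ _ _ _ ch).
  by move=> y _; rewrite lee_fin bump1_ge0.
apply: (@lt_le_trans _ _ (\int[leb]_(y in J) ((8^-1) ^+ 4))).
  rewrite Rintegral_cst//= lebesgue_measure_itv/= lte_fin ifT; last by lra.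
  by rewrite -EFinD/= mulr_gt0//; lra.
apply: le_Rintegral => // y; rewrite /J /= in_itv/= => /andP[y0 y1].
have e1 : Num.max 0 (y - (l%:R + 4^-1)) = y - (l%:R + 4^-1) by apply: max_r; lra.
have e2 : Num.max 0 (l%:R + 1 - 4^-1 - y) = l%:R + 1 - 4^-1 - y by apply: max_r; lra.
have -> : (8^-1 : R) ^+ 4 = 8^-1 ^+ 2 * 8^-1 ^+ 2 by rewrite -exprD.
rewrite /h /bump1 /sqpos e1 e2.
by apply: ler_pM; rewrite ?sqr_ge0// lerXn2r ?nnegrE; lra.
Qed.

Lemma vtrace_vbump k l : exists2 v0 : R, 0 < v0 &
  forall i j, vtrace (vbump k l) i j = v0 * ((i == k) && (j == l))%:R.
Proof.
exists (vtrace (vbump k l) k l).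
  rewrite /vtrace /vbump /bump2/= RintegralZl//; last first.
    by apply: continuous_integrable_itv; exact: bump1_continuous.
  by rewrite mulr_gt0// ?bump1_at// bump1_integral_gt0.
move=> i j; have [->|ik] := eqVneq i k; have [->|jl] := eqVneq j l;
  rewrite ?mulr1 ?mulr0//= /vtrace /vbump /bump2/=.
- rewrite (@eq_Rintegral _ _ _ _ _ (cst 0)) ?Rintegral_cst0//.
    by rewrite /Rintegral integral0.
  by move=> y; rewrite inE/= in_itv/= => yj; rewrite (bump1_far_itv jl yj) mulr0.
- rewrite (@eq_Rintegral _ _ _ _ _ (cst 0)); last by move=> y _; rewrite bump1_far// mul0r.
  by rewrite /Rintegral integral0.
- rewrite (@eq_Rintegral _ _ _ _ _ (cst 0)); last by move=> y _; rewrite bump1_far// mul0r.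
  by rewrite /Rintegral integral0.
Qed.

Lemma htrace_vbump k l i j : htrace (vbump k l) i j = 0.
Proof.
rewrite /htrace /vbump /bump2/= (@eq_Rintegral _ _ _ _ _ (cst 0)).
  by rewrite /Rintegral integral0.
by move=> y _; rewrite bump1_off_nat mulr0.
Qed.

Lemma htrace_hbump k l : exists2 v0 : R, 0 < v0 &
  forall i j, htrace (hbump k l) i j = v0 * ((i == k) && (j == l))%:R.
Proof.
exists (htrace (hbump k l) k l).
  rewrite /htrace /hbump /bump2/= RintegralZr//; last first.
    by apply: continuous_integrable_itv; exact: bump1_continuous.
  by rewrite mulr_gt0// ?bump1_at// bump1_integral_gt0.
move=> i j; have [->|ik] := eqVneq i k; have [->|jl] := eqVneq j l;
  rewrite ?mulr1 ?mulr0//= /htrace /hbump /bump2/=.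
- rewrite (@eq_Rintegral _ _ _ _ _ (cst 0)); last by move=> y _; rewrite [X in _ * X]bump1_far// mulr0.
  by rewrite /Rintegral integral0.
- rewrite (@eq_Rintegral _ _ _ _ _ (cst 0)).
    by rewrite /Rintegral integral0.
  by move=> y; rewrite inE/= in_itv/= => yj; rewrite (bump1_far_itv ik yj) mul0r.
- rewrite (@eq_Rintegral _ _ _ _ _ (cst 0)); last by move=> y _; rewrite [X in _ * X]bump1_far// mulr0.
  by rewrite /Rintegral integral0.
Qed.

Lemma vtrace_hbump k l i j : vtrace (hbump k l) i j = 0.
Proof.
rewrite /vtrace /hbump /bump2/= (@eq_Rintegral _ _ _ _ _ (cst 0)).
  by rewrite /Rintegral integral0.
by move=> y _; rewrite bump1_off_nat mul0r.
Qed.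

Lemma vbump_test k l : test setT (vbump k l) /\
  fsupport (vbump k l) `<=` `[k%:R - 4^-1, k%:R + 4^-1] `*` `[l%:R + 4^-1, l%:R + 1 - 4^-1].
Proof.
have z0 z : ~ rect (k%:R - 4^-1) (k%:R + 4^-1) (l%:R + 4^-1) (l%:R + 1 - 4^-1) z -> vbump k l z = 0.
  exact: bump2_eq0.
split; last exact: fsupport_box.
by apply: (test_box _ z0) => //; exact: bump2_C1.
Qed.

Lemma hbump_test k l : test setT (hbump k l) /\
  fsupport (hbump k l) `<=` `[k%:R + 4^-1, k%:R + 1 - 4^-1] `*` `[l%:R - 4^-1, l%:R + 4^-1].
Proof.
have z0 z : ~ rect (k%:R + 4^-1) (k%:R + 1 - 4^-1) (l%:R - 4^-1) (l%:R + 4^-1) z -> hbump k l z = 0.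
  exact: bump2_eq0.
split; last exact: fsupport_box.
by apply: (test_box _ z0) => //; exact: bump2_C1.
Qed.

(** A trace that is nonzero on a single edge picks at most one term of the
    double sum over pixels. *)
Lemma sum_delta (F : nat -> nat -> R) v0 x0 x1 y0 y1 k l :
  \sum_(x0 <= i < x1) \sum_(y0 <= j < y1) F i j * (v0 * ((i == k) && (j == l))%:R) =
  if (x0 <= k < x1)%N && (y0 <= l < y1)%N then F k l * v0 else 0.
Proof.
transitivity (\sum_(x0 <= i < x1 | i == k) \sum_(y0 <= j < y1 | j == l) F i j * v0).
  rewrite [RHS]big_mkcond/=; apply: eq_bigr => i _; case: eqP => _ /=; last first.
    by apply: big1 => j _; rewrite !mulr0.
  rewrite [RHS]big_mkcond/=; apply: eq_bigr => j _; case: eqP => _ /=; first by rewrite mulr1.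
  by rewrite !mulr0.
by rewrite big_nat1_eq big_nat1_eq; case: ifP => // _; case: ifP.
Qed.

End edge_bumps.

(** * From edge values to H(div) fields *)

Section rt_edges.
Context {R : realType}.
Notation leb := (@lebesgue_measure R).
Implicit Types (u v : nat -> nat -> R) (q : vector_field R) (phi g : scalar_field R) (Z : set (R * R)).

(** rt_a and rt_b are the coefficients of the unique Raviart-Thomas polynomial
    on the pixel (i, j) whose normal components on the left, right, lower and
    upper edges are u i j, u i.+1 j, v i j and v i j.+1. *)
Definition rt_a u v (i j : nat) : R * R :=
  (u i j - (u i.+1 j - u i j) * i%:R, v i j - (v i j.+1 - v i j) * j%:R).
Definition rt_b u v (i j : nat) : R * R := (u i.+1 j - u i j, v i j.+1 - v i j).
Definition edge_div u v (i j : nat) : R := u i.+1 j - u i j + (v i j.+1 - v i j).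

(** The field q has the normal components u on the vertical edges and v on the
    horizontal edges of the rectangle. Having a single value for both pixels
    of an edge encodes the continuity of the normal component. *)
Definition edge_repr (x0 x1 y0 y1 : nat) q u v : Prop :=
  forall i j, (x0 <= i < x1)%N -> (y0 <= j < y1)%N ->
    ae_eq_on (px i j) q (rt0 (rt_a u v i j) (rt_b u v i j)).

(** The values of neighbouring pixels on a common edge cancel, so that the sum
    over pixels telescopes to the outer edges. *)
Lemma edge_green q g (x0 x1 y0 y1 : nat) u v phi :
  (x0 <= x1)%N -> (y0 <= y1)%N -> C1 phi ->
  L2 (open_rect R x0 x1 y0 y1) (fun z => (q z).1) ->
  L2 (open_rect R x0 x1 y0 y1) (fun z => (q z).2) ->
  L2 (open_rect R x0 x1 y0 y1) g ->
  edge_repr x0 x1 y0 y1 q u v ->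
  (forall i j, (x0 <= i < x1)%N -> (y0 <= j < y1)%N ->
    {ae (area R), forall z, px i j z -> g z = edge_div u v i j}) ->
  \int[area R]_(z in open_rect R x0 x1 y0 y1) dot_grad q phi z
  + \int[area R]_(z in open_rect R x0 x1 y0 y1) (g z * phi z) =
  \sum_(y0 <= j < y1) (u x1 j * vtrace phi x1 j - u x0 j * vtrace phi x0 j) +
  \sum_(x0 <= i < x1) (v i y1 * htrace phi i y1 - v i y0 * htrace phi i y0).
Proof.
move=> x01 y01 C1p L1 L2' Lg qe ge; rewrite (piecewise_green x01 y01 C1p L1 L2' Lg qe ge).
under eq_bigr => i _ do rewrite big_split/=.
rewrite big_split/= exchange_big/=; congr (_ + _); apply: eq_bigr => k _.
  transitivity (\sum_(x0 <= i < x1) (u i.+1 k * vtrace phi i.+1 k - u i k * vtrace phi i k)).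
    by apply: eq_bigr => i _; rewrite -natr1; congr (_ * _ - _ * _); ring.
  by rewrite telescope_sumr// .
transitivity (\sum_(y0 <= j < y1) (v k j.+1 * htrace phi k j.+1 - v k j * htrace phi k j)).
  by apply: eq_bigr => i _; rewrite -natr1; congr (_ * _ - _ * _); ring.
by rewrite telescope_sumr.
Qed.

Lemma vseg_boundary (x0 x1 y0 y1 k l : nat) z : (x0 < x1)%N -> (y0 < y1)%N ->
  k = x0 \/ k = x1 -> (y0 <= l < y1)%N -> vseg k l z ->
  boundary (open_rect R x0 x1 y0 y1) z.
Proof.
move=> x01 y01 hk /andP[l0 l1] [/= z1]; rewrite in_itv/= => /andP[z2 z3].
have l0' : y0%:R <= l%:R :> R by rewrite ler_nat.
have l1' : l.+1%:R <= y1%:R :> R by rewrite ler_nat.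
have x01' : x0%:R < x1%:R :> R by rewrite ltr_nat.
apply/boundary_rect; rewrite ?ltr_nat//.
by case: hk z1 => -> ->; split; rewrite ?lexx ?ltxx ?(ltW x01')//; lra.
Qed.

Lemma hseg_boundary (x0 x1 y0 y1 k l : nat) z : (x0 < x1)%N -> (y0 < y1)%N ->
  l = y0 \/ l = y1 -> (x0 <= k < x1)%N -> hseg k l z ->
  boundary (open_rect R x0 x1 y0 y1) z.
Proof.
move=> x01 y01 hk /andP[l0 l1] [/=] + z1; rewrite in_itv/= => /andP[z2 z3].
have l0' : x0%:R <= k%:R :> R by rewrite ler_nat.
have l1' : k.+1%:R <= x1%:R :> R by rewrite ler_nat.
have x01' : y0%:R < y1%:R :> R by rewrite ltr_nat.
apply/boundary_rect; rewrite ?ltr_nat//.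
by case: hk z1 => -> ->; split; rewrite ?lexx ?ltxx ?(ltW x01')//; lra.
Qed.

Lemma boundary_outside (a b c d : R) z : a < b -> c < d ->
  boundary (rect a b c d) z -> ~ rect a b c d z.
Proof. by move=> ab cd /boundary_rect -/(_ ab cd)[_ _ h]; rewrite /rect/= !in_itv. Qed.

Lemma vtrace0 phi k l : (forall z, vseg k l z -> phi z = 0) -> vtrace phi k l = 0.
Proof.
move=> h; rewrite /vtrace (@eq_Rintegral _ _ _ _ _ (cst 0)).
  by rewrite /Rintegral integral0.
by move=> y; rewrite inE/= => yl; apply: h.
Qed.

Lemma htrace0 phi k l : (forall z, hseg k l z -> phi z = 0) -> htrace phi k l = 0.
Proof.
move=> h; rewrite /htrace (@eq_Rintegral _ _ _ _ _ (cst 0)).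
  by rewrite /Rintegral integral0.
by move=> y; rewrite inE/= => yl; apply: h.
Qed.

Definition edges_vanish (x0 x1 y0 y1 : nat) Z u v : Prop :=
  (forall k l, k = x0 \/ k = x1 -> (y0 <= l < y1)%N -> u k l = 0 \/ (forall z, vseg k l z -> ~ Z z)) /\
  (forall k l, l = y0 \/ l = y1 -> (x0 <= k < x1)%N -> v k l = 0 \/ (forall z, hseg k l z -> ~ Z z)).

Lemma edge_div_ae q g x0 x1 y0 y1 u v :
  L2 (open_rect R x0 x1 y0 y1) (fun z => (q z).1) ->
  L2 (open_rect R x0 x1 y0 y1) (fun z => (q z).2) ->
  edge_repr x0 x1 y0 y1 q u v ->
  is_div (open_rect R x0 x1 y0 y1) q g ->
  forall i j, (x0 <= i < x1)%N -> (y0 <= j < y1)%N ->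
    {ae (area R), forall z, px i j z -> g z = edge_div u v i j}.
Proof. by move=> L1 L2' qe gd i j hi hj; exact: (div_ae_px L1 L2' gd hi hj (qe i j hi hj)). Qed.

(** The value on the grid lines, a null set, is 0; for continuous c the
    indicators make measurability immediate. *)
Definition piecewise (x1 y1 : nat) (c : nat -> nat -> scalar_field R) : scalar_field R :=
  fun z => \sum_(i < x1) \sum_(j < y1) \1_(px i j : set (mplane R)) z * c i j z.

Lemma px_inj i j i' j' (z : R * R) : px i j z -> px i' j' z -> i = i' /\ j = j'.
Proof.
rewrite /px /rect /= !in_itv/= -!natr1 => -[/andP[a1 a2] /andP[a3 a4]] [/andP[b1 b2] /andP[b3 b4]].
by split; apply/eqP; apply: contraT => /(@nat_gap R) []; lra.
Qed.

Lemma piecewiseE x1 y1 c i j z : (i < x1)%N -> (j < y1)%N -> px i j z -> piecewise x1 y1 c z = c i j z.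
Proof.
move=> hi hj pz; rewrite /piecewise (bigD1 (Ordinal hi))//= (bigD1 (Ordinal hj))//=.
rewrite indicE mem_set// mul1r !big1 ?addr0//.
  move=> k /eqP ki; apply: big1 => l _; rewrite indicE memNset ?mul0r// => pz'.
  by have [e _] := px_inj pz pz'; apply: ki; apply/val_inj.
move=> k /eqP kj; rewrite indicE memNset ?mul0r// => pz'.
by have [_ e] := px_inj pz pz'; apply: kj; apply/val_inj.
Qed.

Lemma measurable_piecewise x1 y1 c (D : set (R * R)) : (forall i j, continuous (c i j)) ->
  measurable_fun D (piecewise x1 y1 c).
Proof.
move=> cc; suff H : measurable_fun setT (piecewise x1 y1 c) by exact: measurable_funS H.
apply: measurable_sum => i; apply: measurable_sum => j.
apply: measurable_funM; last exact: plane_continuous_measurable.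
by apply: measurable_indic; exact: measurable_rect.
Qed.

Lemma ae_piecewise_L2 x0 x1 y0 y1 g c : measurable_fun (open_rect R x0 x1 y0 y1) g ->
  (forall i j, continuous (c i j)) ->
  (forall i j, (x0 <= i < x1)%N -> (y0 <= j < y1)%N ->
    {ae (area R), forall z, px i j z -> g z = c i j z}) ->
  L2 (open_rect R x0 x1 y0 y1) g.
Proof.
move=> mg cc ge.
have /choice [k kP] : forall ij : nat * nat, exists k : R, 0 < k /\
    forall z, px ij.1 ij.2 z -> `|c ij.1 ij.2 z| <= k.
  move=> [i j] /=; have [k k0 kP] := bounded_on_rect i%:R i.+1%:R j%:R j.+1%:R (cc i j).
  by exists k; split.
(* the sum of the bounds on the pixels, as an upper bound of their maximum *)
pose K := \sum_(i < x1) \sum_(j < y1) k (val i, val j).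
have kK i j : (i < x1)%N -> (j < y1)%N -> k (i, j) <= K.
  move=> hi hj; rewrite /K (bigD1 (Ordinal hi))//= (bigD1 (Ordinal hj))//=.
  rewrite -addrA lerDl addr_ge0//; apply: sumr_ge0 => i0 _.
    by have [/ltW] := kP (i, val i0).
  by apply: sumr_ge0 => j0 _; have [/ltW] := kP (val i0, val j0).
apply: (@ae_bounded_L2 _ _ _ _ _ _ K) => //.
apply: ae_pixels => i j hi hj; apply: ae_imp (ge i j hi hj) => z h pz.
have [_ kc] := kP (i, j).
rewrite h// (le_trans (kc _ pz))//; apply: kK.
  by case/andP: hi.
by case/andP: hj.
Qed.

Lemma piecewise_L2 x0 x1 y0 y1 c : (forall i j, continuous (c i j)) ->
  L2 (open_rect R x0 x1 y0 y1) (piecewise x1 y1 c).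
Proof.
move=> cc; apply: (@ae_piecewise_L2 _ _ _ _ _ c) => //.
  exact: measurable_piecewise.
move=> i j /andP[_ hi] /andP[_ hj]; apply: aeW => z pz; exact: piecewiseE.
Qed.

Lemma edge_repr_L2 x0 x1 y0 y1 q u v :
  measurable_fun (open_rect R x0 x1 y0 y1) (fun z => (q z).1) ->
  measurable_fun (open_rect R x0 x1 y0 y1) (fun z => (q z).2) ->
  edge_repr x0 x1 y0 y1 q u v ->
  L2 (open_rect R x0 x1 y0 y1) (fun z => (q z).1) /\
  L2 (open_rect R x0 x1 y0 y1) (fun z => (q z).2).
Proof.
move=> m1 m2 qe; split.
  apply: (@ae_piecewise_L2 _ _ _ _ _ (fun i j z => (rt0 (rt_a u v i j) (rt_b u v i j) z).1)) => //.
    by move=> i j; exact: rt0_continuous1.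
  by move=> i j hi hj; apply: ae_imp (qe i j hi hj) => z h /h ->.
apply: (@ae_piecewise_L2 _ _ _ _ _ (fun i j z => (rt0 (rt_a u v i j) (rt_b u v i j) z).2)) => //.
  by move=> i j; exact: rt0_continuous2.
by move=> i j hi hj; apply: ae_imp (qe i j hi hj) => z h /h ->.
Qed.

(** Matching edge values make the piecewise constant function edge_div the
    weak divergence: in the telescoped sum only traces on the outer boundary
    remain, where test functions vanish. *)
Lemma edge_repr_div x0 x1 y0 y1 q u v : (x0 < x1)%N -> (y0 < y1)%N ->
  measurable_fun (open_rect R x0 x1 y0 y1) (fun z => (q z).1) ->
  measurable_fun (open_rect R x0 x1 y0 y1) (fun z => (q z).2) ->
  edge_repr x0 x1 y0 y1 q u v ->
  is_div (open_rect R x0 x1 y0 y1) q (piecewise x1 y1 (fun i j => cst (edge_div u v i j))).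
Proof.
move=> x01 y01 m1 m2 qe; have [L1 L2'] := edge_repr_L2 m1 m2 qe.
have Lg : L2 (open_rect R x0 x1 y0 y1) (piecewise x1 y1 (fun i j => cst (edge_div u v i j))).
  by apply: piecewise_L2 => i j; exact: cst_continuous.
split=> // phi t.
have C1p : C1 phi by case: t.
apply/eqP; rewrite -subr_eq0 opprK; apply/eqP.
rewrite (edge_green (ltnW x01) (ltnW y01) C1p L1 L2' Lg qe); last first.
  by move=> i j /andP[_ hi] /andP[_ hj]; apply: aeW => z pz; rewrite (piecewiseE _ hi hj).
have bd z : boundary (open_rect R x0 x1 y0 y1) z -> phi z = 0.
  move=> bz; have [] // := test_outside t (_ : ~ open_rect R x0 x1 y0 y1 z).
  by apply: boundary_outside bz; rewrite ltr_nat.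
rewrite [X in X + _]big_nat_cond [X in _ + X]big_nat_cond !big1 ?addr0// => i /andP[hi _].
  by rewrite !htrace0 ?mulr0 ?subr0// => z hz; apply: bd;
    apply: (hseg_boundary x01 y01 _ hi hz); [left|right].
by rewrite !vtrace0 ?mulr0 ?subr0// => z hz; apply: bd;
  apply: (vseg_boundary x01 y01 _ hi hz); [left|right].
Qed.

(** Evaluate the inclusion at the centre of the pixel. *)
Lemma px_sub_range (x0 x1 y0 y1 i j : nat) :
  px i j `<=` open_rect R x0 x1 y0 y1 -> (x0 <= i < x1)%N /\ (y0 <= j < y1)%N.
Proof.
move=> /(_ (i%:R + 2^-1, j%:R + 2^-1)).
case.
  by rewrite /px /rect /= !in_itv/= -(natr1 i) -(natr1 j); lra.
rewrite /= !in_itv/= => /andP[a1 a2] /andP[a3 a4].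
have aux (m n : nat) : m%:R < n%:R + 2^-1 :> R -> (m <= n)%N.
  by move=> h; rewrite -ltnS -(ltr_nat R) -natr1; lra.
have aux2 (m n : nat) : m%:R + 2^-1 < n%:R :> R -> (m < n)%N.
  by move=> h; rewrite -(ltr_nat R); lra.
by split; apply/andP; split; by [apply: aux|apply: aux2].
Qed.

(** The normal trace functional is a sum over outer edges, where either the
    edge value or, by the condition on the support, the test function
    vanishes. *)
Lemma edge_repr_RT M N x0 x1 y0 y1 q u v Z : (x0 < x1)%N -> (y0 < y1)%N ->
  measurable_fun (open_rect R x0 x1 y0 y1) (fun z => (q z).1) ->
  measurable_fun (open_rect R x0 x1 y0 y1) (fun z => (q z).2) ->
  edge_repr x0 x1 y0 y1 q u v -> edges_vanish x0 x1 y0 y1 Z u v ->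
  RT_space M N (open_rect R x0 x1 y0 y1) Z q.
Proof.
move=> x01 y01 m1 m2 qe [uZ vZ]; have [L1 L2'] := edge_repr_L2 m1 m2 qe.
have dg := edge_repr_div x01 y01 m1 m2 qe.
have dd : is_div (open_rect R x0 x1 y0 y1) q (div (open_rect R x0 x1 y0 y1) q).
  exact: (xgetPex (fun=> 0) (ex_intro _ _ dg)).
split.
- by split => //; exists (piecewise x1 y1 (fun i j => cst (edge_div u v i j))).
- move=> phi t sub; have C1p : C1 phi by case: t.
  rewrite (edge_green (ltnW x01) (ltnW y01) C1p L1 L2' (proj1 dd) qe); last first.
    exact: edge_div_ae dd.
  have zero z : boundary (open_rect R x0 x1 y0 y1) z -> ~ Z z -> phi z = 0.
    move=> bz nZ; apply/eqP/negPn/negP => /fsupportP fz; apply: nZ; exact: sub.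
  have hu k l : k = x0 \/ k = x1 -> (y0 <= l < y1)%N -> u k l * vtrace phi k l = 0.
    move=> hk hl; case: (uZ k l hk hl) => [->|nZ]; first by rewrite mul0r.
    rewrite vtrace0 ?mulr0// => z hz; apply: zero; last exact: nZ.
    exact: vseg_boundary hz.
  have hv k l : l = y0 \/ l = y1 -> (x0 <= k < x1)%N -> v k l * htrace phi k l = 0.
    move=> hk hl; case: (vZ k l hk hl) => [->|nZ]; first by rewrite mul0r.
    rewrite htrace0 ?mulr0// => z hz; apply: zero; last exact: nZ.
    exact: hseg_boundary hz.
  rewrite [X in X + _]big_nat_cond [X in _ + X]big_nat_cond !big1 ?addr0// => i /andP[hi _].
    by rewrite !hv ?subrr//; [left|right].
  by rewrite !hu ?subrr//; [left|right].
- move=> T pT; have [hi hj] := px_sub_range pT.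
  by exists (rt_a u v T.1 T.2), (rt_b u v T.1 T.2); exact: qe.
Qed.

End rt_edges.

(** * From H(div) fields to edge values *)

Section rt_edges_converse.
Context {R : realType}.
Implicit Types (u v : nat -> nat -> R) (q : vector_field R) (phi g : scalar_field R) (Z : set (R * R)).

(** Tested with the bump of an edge, the sum of the pixel contributions
    reduces to the difference of the normal components seen from the two
    sides; outside of the rectangle there is no pixel and the term is missing. *)
Lemma flux_vbump (Rr Ll Tt Bb : nat -> nat -> R) x0 x1 y0 y1 k l : exists2 v0 : R, 0 < v0 &
  \sum_(x0 <= i < x1) \sum_(y0 <= j < y1)
    (Rr i j * vtrace (vbump k l) i.+1 j - Ll i j * vtrace (vbump k l) i j
     + (Tt i j * htrace (vbump k l) i j.+1 - Bb i j * htrace (vbump k l) i j)) =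
  ((if [&& (0 < k)%N, (x0 <= k.-1 < x1)%N & (y0 <= l < y1)%N] then Rr k.-1 l else 0)
   - (if (x0 <= k < x1)%N && (y0 <= l < y1)%N then Ll k l else 0)) * v0.
Proof.
have [v0 v0_gt0 vE] := @vtrace_vbump R k l; exists v0 => //.
transitivity (\sum_(x0 <= i < x1) \sum_(y0 <= j < y1)
    (Rr i j * ((0 < k)%:R * (v0 * ((i == k.-1) && (j == l))%:R))
     - Ll i j * (v0 * ((i == k) && (j == l))%:R))).
  apply: eq_bigr => i _; apply: eq_bigr => j _.
  rewrite !htrace_vbump !mulr0 subrr addr0 !vE; congr (_ * _ - _).
  by case: k {vE} => [|k] /=; rewrite ?mul0r ?mul1r ?mulr0// eqSS.
under eq_bigr => i _ do rewrite sumrB.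
rewrite sumrB sum_delta mulrBl; congr (_ - _); last by case: ifP => _; rewrite ?mul0r.
case: (ltnP 0 k) => k0 /=.
  under eq_bigr => i _ do under eq_bigr => j _ do rewrite mul1r.
  by rewrite sum_delta; case: ifP => _; rewrite ?mul0r.
by rewrite mul0r; apply: big1 => i _; apply: big1 => j _; rewrite mul0r mulr0.
Qed.

Lemma flux_hbump (Rr Ll Tt Bb : nat -> nat -> R) x0 x1 y0 y1 k l : exists2 v0 : R, 0 < v0 &
  \sum_(x0 <= i < x1) \sum_(y0 <= j < y1)
    (Rr i j * vtrace (hbump k l) i.+1 j - Ll i j * vtrace (hbump k l) i j
     + (Tt i j * htrace (hbump k l) i j.+1 - Bb i j * htrace (hbump k l) i j)) =
  ((if [&& (0 < l)%N, (x0 <= k < x1)%N & (y0 <= l.-1 < y1)%N] then Tt k l.-1 else 0)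
   - (if (x0 <= k < x1)%N && (y0 <= l < y1)%N then Bb k l else 0)) * v0.
Proof.
have [v0 v0_gt0 vE] := @htrace_hbump R k l; exists v0 => //.
transitivity (\sum_(x0 <= i < x1) \sum_(y0 <= j < y1)
    (Tt i j * ((0 < l)%:R * (v0 * ((i == k) && (j == l.-1))%:R))
     - Bb i j * (v0 * ((i == k) && (j == l))%:R))).
  apply: eq_bigr => i _; apply: eq_bigr => j _.
  rewrite !vtrace_hbump !mulr0 subrr add0r !vE; congr (_ * _ - _).
  by case: l {vE} => [|l] /=; rewrite ?mul0r ?mul1r ?mulr0 ?andbF ?mulr0// eqSS.
under eq_bigr => i _ do rewrite sumrB.
rewrite sumrB sum_delta mulrBl; congr (_ - _); last by case: ifP => _; rewrite ?mul0r.
case: (ltnP 0 l) => k0 /=.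
  under eq_bigr => i _ do under eq_bigr => j _ do rewrite mul1r.
  by rewrite sum_delta; case: ifP => _; rewrite ?mul0r.
by rewrite mul0r; apply: big1 => i _; apply: big1 => j _; rewrite mul0r mulr0.
Qed.

Lemma vbump_test_open_rect (x0 x1 y0 y1 k l : nat) : (x0 < k < x1)%N -> (y0 <= l < y1)%N ->
  test (open_rect R x0 x1 y0 y1) (vbump k l).
Proof.
move=> /andP[k0 k1] /andP[l0 l1]; have [[C1p cs _] sub] := @vbump_test R k l.
split=> //; apply: (subset_trans sub) => z [/=]; rewrite !in_itv/=.
have : x0%:R + 1 <= k%:R :> R by rewrite natr1 ler_nat.
have : k%:R + 1 <= x1%:R :> R by rewrite natr1 ler_nat.
have : y0%:R <= l%:R :> R by rewrite ler_nat.
have : l%:R + 1 <= y1%:R :> R by rewrite natr1 ler_nat.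
by move=> h1 h2 h3 h4 h5 h6; split; rewrite /= in_itv/=; lra.
Qed.

Lemma hbump_test_open_rect (x0 x1 y0 y1 k l : nat) : (x0 <= k < x1)%N -> (y0 < l < y1)%N ->
  test (open_rect R x0 x1 y0 y1) (hbump k l).
Proof.
move=> /andP[k0 k1] /andP[l0 l1]; have [[C1p cs _] sub] := @hbump_test R k l.
split=> //; apply: (subset_trans sub) => z [/=]; rewrite !in_itv/=.
have : y0%:R + 1 <= l%:R :> R by rewrite natr1 ler_nat.
have : l%:R + 1 <= y1%:R :> R by rewrite natr1 ler_nat.
have : x0%:R <= k%:R :> R by rewrite ler_nat.
have : k%:R + 1 <= x1%:R :> R by rewrite natr1 ler_nat.
by move=> h1 h2 h3 h4 h5 h6; split; rewrite /= in_itv/=; lra.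
Qed.

Lemma vbump_boundary (x0 x1 y0 y1 k l : nat) : (x0 < x1)%N -> (y0 < y1)%N ->
  k = x0 \/ k = x1 -> (y0 <= l < y1)%N ->
  fsupport (vbump k l) `&` boundary (open_rect R x0 x1 y0 y1) `<=` vseg k l.
Proof.
move=> x01 y01 hk /andP[l0 l1] z [/((@vbump_test R k l).2 z) + /boundary_rect].
rewrite !ltr_nat => + /(_ x01 y01) [b1 b2 b3] => -[/=]; rewrite !in_itv/= => h1 h2.
have l0' : y0%:R <= l%:R :> R by rewrite ler_nat.
have l1' : l%:R + 1 <= y1%:R :> R by rewrite natr1 ler_nat.
have x01' : x0%:R + 1 <= x1%:R :> R by rewrite natr1 ler_nat.
have n1 : ~ (x0%:R < z.1 < x1%:R) by move=> h; apply: b3; split => //; lra.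
split; rewrite /= ?in_itv/= -?(natr1 l); last by lra.
by case: hk h1 => -> h1; apply/eqP; apply: contrapT => /negP; rewrite neq_lt => h; apply: n1; lra.
Qed.

Lemma hbump_boundary (x0 x1 y0 y1 k l : nat) : (x0 < x1)%N -> (y0 < y1)%N ->
  l = y0 \/ l = y1 -> (x0 <= k < x1)%N ->
  fsupport (hbump k l) `&` boundary (open_rect R x0 x1 y0 y1) `<=` hseg k l.
Proof.
move=> x01 y01 hk /andP[l0 l1] z [/((@hbump_test R k l).2 z) + /boundary_rect].
rewrite !ltr_nat => + /(_ x01 y01) [b1 b2 b3] => -[/=]; rewrite !in_itv/= => h1 h2.
have l0' : x0%:R <= k%:R :> R by rewrite ler_nat.
have l1' : k%:R + 1 <= x1%:R :> R by rewrite natr1 ler_nat.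
have x01' : y0%:R + 1 <= y1%:R :> R by rewrite natr1 ler_nat.
have n1 : ~ (y0%:R < z.2 < y1%:R) by move=> h; apply: b3; split => //; lra.
split; rewrite /= ?in_itv/= -?(natr1 k); first by lra.
by case: hk h2 => -> h2; apply/eqP; apply: contrapT => /negP; rewrite neq_lt => h; apply: n1; lra.
Qed.

(** The normal components on the two sides of an inner edge agree because the
    bump of the edge is a test function of the rectangle; on an outer edge
    inside Z they vanish because the bump is admissible in the definition of
    the normal trace. *)
Lemma RT_edge_repr M N x0 x1 y0 y1 Z q : (x0 < x1 <= M)%N -> (y0 < y1 <= N)%N ->
  RT_space M N (open_rect R x0 x1 y0 y1) Z q ->
  exists u v, [/\ edge_repr x0 x1 y0 y1 q u v,
    forall k l, k = x0 \/ k = x1 -> (y0 <= l < y1)%N -> vseg k l `<=` Z -> u k l = 0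
  & forall k l, l = y0 \/ l = y1 -> (x0 <= k < x1)%N -> hseg k l `<=` Z -> v k l = 0].
Proof.
move=> /andP[x01 xM] /andP[y01 yN] [[L1 L2' [g0 dg0]] nz rt].
have dd : is_div (open_rect R x0 x1 y0 y1) q (div (open_rect R x0 x1 y0 y1) q).
  exact: (xgetPex (fun=> 0) (ex_intro _ _ dg0)).
have /choice [c cP] : forall ij : nat * nat, exists ab : (R * R) * (R * R),
    (x0 <= ij.1 < x1)%N -> (y0 <= ij.2 < y1)%N -> ae_eq_on (px ij.1 ij.2) q (rt0 ab.1 ab.2).
  move=> [i j] /=; have [h|h] := boolP ((x0 <= i < x1)%N && (y0 <= j < y1)%N); last first.
    by exists ((0, 0), (0, 0)) => h1 h2; rewrite h1 h2 in h.
  have /andP[hi hj] := h; have /andP[_ ix1] := hi; have /andP[_ jy1] := hj.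
  have iM := leq_trans ix1 xM; have jN := leq_trans jy1 yN.
  have := rt (Ordinal iM, Ordinal jN).
  case; first by move=> z pz; exact: (px_sub_open_rect hi hj).
  by move=> a [b ab]; exists (a, b).
pose A i j := (c (i, j)).1; pose B i j := (c (i, j)).2.
have AB i j : (x0 <= i < x1)%N -> (y0 <= j < y1)%N -> ae_eq_on (px i j) q (rt0 (A i j) (B i j)).
  exact: (cP (i, j)).
have flux0 phi : test (open_rect R x0 x1 y0 y1) phi \/ (test [set: R * R] phi /\
    fsupport phi `&` boundary (open_rect R x0 x1 y0 y1) `<=` Z) ->
    \sum_(x0 <= i < x1) \sum_(y0 <= j < y1)
    (((A i j).1 + (B i j).1 * i.+1%:R) * vtrace phi i.+1 j
     - ((A i j).1 + (B i j).1 * i%:R) * vtrace phi i j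
     + (((A i j).2 + (B i j).2 * j.+1%:R) * htrace phi i j.+1
     - ((A i j).2 + (B i j).2 * j%:R) * htrace phi i j)) = 0.
  move=> tphi; have C1p : C1 phi by case: tphi => [[]|[[]]].
  rewrite -(piecewise_green (ltnW x01) (ltnW y01) C1p L1 L2' (proj1 dd) AB); last first.
    by move=> i j hi hj; exact: (div_ae_px L1 L2' dd hi hj (AB i j hi hj)).
  case: tphi => [t|[t sub]]; last exact: nz.
  by rewrite (proj2 dd _ t) addNr.
(* normal components on the right, left, upper and lower edges, as seen from
   the pixel (i, j) *)
pose Rr i j := (A i j).1 + (B i j).1 * i.+1%:R.
pose Ll i j := (A i j).1 + (B i j).1 * i%:R.
pose Tt i j := (A i j).2 + (B i j).2 * j.+1%:R.
pose Bb i j := (A i j).2 + (B i j).2 * j%:R.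
have fluxV k l : test (open_rect R x0 x1 y0 y1) (vbump k l) \/ (test [set: R * R] (vbump k l) /\
    fsupport (vbump k l) `&` boundary (open_rect R x0 x1 y0 y1) `<=` Z) ->
    (if [&& (0 < k)%N, (x0 <= k.-1 < x1)%N & (y0 <= l < y1)%N] then Rr k.-1 l else 0)
   = (if (x0 <= k < x1)%N && (y0 <= l < y1)%N then Ll k l else 0).
  move=> /flux0; have [v0 v0_gt0 ->] := flux_vbump Rr Ll Tt Bb x0 x1 y0 y1 k l.
  by move=> /eqP; rewrite mulf_eq0 (gt_eqF v0_gt0) orbF subr_eq0 => /eqP.
have fluxH k l : test (open_rect R x0 x1 y0 y1) (hbump k l) \/ (test [set: R * R] (hbump k l) /\
    fsupport (hbump k l) `&` boundary (open_rect R x0 x1 y0 y1) `<=` Z) ->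
    (if [&& (0 < l)%N, (x0 <= k < x1)%N & (y0 <= l.-1 < y1)%N] then Tt k l.-1 else 0)
   = (if (x0 <= k < x1)%N && (y0 <= l < y1)%N then Bb k l else 0).
  move=> /flux0; have [v0 v0_gt0 ->] := flux_hbump Rr Ll Tt Bb x0 x1 y0 y1 k l.
  by move=> /eqP; rewrite mulf_eq0 (gt_eqF v0_gt0) orbF subr_eq0 => /eqP.
have matchV i j : (x0 <= i < x1)%N -> (y0 <= j < y1)%N -> (i.+1 < x1)%N -> Rr i j = Ll i.+1 j.
  move=> hi hj i1; have := fluxV i.+1 j; rewrite /= hi hj i1 andbT /=.
  have /andP[xi _] := hi; rewrite (leqW xi) /=; apply; left.
  by apply: vbump_test_open_rect => //; rewrite i1 andbT ltnS.
have matchH i j : (x0 <= i < x1)%N -> (y0 <= j < y1)%N -> (j.+1 < y1)%N -> Tt i j = Bb i j.+1.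
  move=> hi hj i1; have := fluxH i j.+1; rewrite /= hi hj i1 andbT /=.
  have /andP[xi _] := hj; rewrite (leqW xi) /=; apply; left.
  by apply: hbump_test_open_rect => //; rewrite i1 andbT ltnS.
(* The last vertical and horizontal grid lines bound no pixel of the rectangle
   on their right or upper side, so their values come from the other side. *)
pose u i j := if (i < x1)%N then Ll i j else Rr i.-1 j.
pose v i j := if (j < y1)%N then Bb i j else Tt i j.-1.
exists u, v; split.
- move=> i j hi hj; have /andP[_ i1] := hi; have /andP[_ j1] := hj.
  have e1 : u i.+1 j = Rr i j by rewrite /u; case: ifP => // h; rewrite matchV.
  have e2 : v i j.+1 = Tt i j by rewrite /v; case: ifP => // h; rewrite matchH.
  have e3 : u i j = Ll i j by rewrite /u i1.
  have e4 : v i j = Bb i j by rewrite /v j1.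
  have -> : rt_b u v i j = B i j.
    rewrite /rt_b e1 e2 e3 e4 /Rr /Ll /Tt /Bb -(natr1 i) -(natr1 j).
    by case: (B i j) => b1 b2 /=; congr (_, _); ring.
  have -> : rt_a u v i j = A i j.
    rewrite /rt_a e1 e2 e3 e4 /Rr /Ll /Tt /Bb -(natr1 i) -(natr1 j).
    by case: (A i j) => b1 b2 /=; congr (_, _); ring.
  exact: AB.
- move=> k l hk hl sZ.
  have := fluxV k l; rewrite hl !andbT /u.
  have -> // : test (open_rect R x0 x1 y0 y1) (vbump k l) \/ (test [set: R * R] (vbump k l) /\
      fsupport (vbump k l) `&` boundary (open_rect R x0 x1 y0 y1) `<=` Z) <-> True.
    split=> // _; right; split; first exact: (vbump_test k l).1.
    by apply: subset_trans sZ; exact: vbump_boundary.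
  move=> /(_ I); case: hk => ->.
    by rewrite x01 leqnn /=; case: ifP => // /andP[x0_gt0 /andP[]]; lia.
  rewrite ltnn andbF /= ifT //; lia.
- move=> k l hk hl sZ.
  have := fluxH k l; rewrite hl /v /=.
  have -> // : test (open_rect R x0 x1 y0 y1) (hbump k l) \/ (test [set: R * R] (hbump k l) /\
      fsupport (hbump k l) `&` boundary (open_rect R x0 x1 y0 y1) `<=` Z) <-> True.
    split=> // _; right; split; first exact: (hbump_test k l).1.
    by apply: subset_trans sZ; exact: hbump_boundary.
  move=> /(_ I); case: hk => ->.
    by rewrite y01 leqnn /=; case: ifP => // /andP[x0_gt0 /andP[]]; lia.
  rewrite ltnn andbF /= ifT //; lia.
Qed.

End rt_edges_converse.

(** * Degrees of freedom *)

Section dofs.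
Context {R : realType}.
Implicit Types (u v : nat -> nat -> R) (q : vector_field R) (Z : set (R * R)).

(** A nonzero value of a continuous function persists on a small square, which
    has positive area. *)
Lemma continuous_ae0 (F : R * R -> R) (a b c d : R) : continuous F ->
  {ae (area R), forall z, rect a b c d z -> F z = 0} ->
  forall z, rect a b c d z -> F z = 0.
Proof.
move=> cF [N [mN N0 sub]] z Dz; apply/eqP/negPn/negP => Fz.
have : nbhs z (rect a b c d `&` (F @^-1` [set t | t != 0])).
  apply: filterI; first by apply: open_nbhs_nbhs; split => //; exact: rect_open.
  apply: (cF z); apply/nbhs_ballP; exists `|F z|; rewrite /= ?normr_gt0// => t.
  by rewrite /ball/= => ht; apply: contraTN ht => /eqP ->; rewrite subr0 ltxx.
rewrite -nbhs_ballE => -[e /= e0 bsub].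
have sub' : rect (z.1 - e) (z.1 + e) (z.2 - e) (z.2 + e) `<=` N.
  move=> w; rewrite /rect/= !in_itv/= => -[h1 h2]; apply: sub => /= H.
  have [Dw /= Fw] : (rect a b c d `&` (F @^-1` [set t | t != 0])) w.
    by apply: bsub; split; rewrite /ball/= ltr_norml; apply/andP; split; lra.
  by move: Fw; rewrite H// eqxx.
have H : (area R (rect (z.1 - e) (z.1 + e) (z.2 - e) (z.2 + e)) <= area R N)%E := @le_measure _ R (mplane R) (area R) _ _ (mem_set (@measurable_rect R (z.1 - e) (z.1 + e) (z.2 - e) (z.2 + e))) (mem_set mN) sub'.
move: H; rewrite N0 area_rect; [|lra|lra]; rewrite lee_fin; nra.
Qed.

(** Equality almost everywhere on the pixel is equality everywhere by
    continuity, and an affine function of one coordinate is determined by its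
    values at two points. *)
Lemma rt0_ae_inj i j (a b a' b' : R * R) :
  {ae (area R), forall z, px i j z -> rt0 a b z = rt0 a' b' z} -> a = a' /\ b = b'.
Proof.
move=> ae.
have e1 z : px i j z -> (a.1 - a'.1) + (b.1 - b'.1) * z.1 = 0.
  apply: (@continuous_ae0 (fun z => (a.1 - a'.1) + (b.1 - b'.1) * z.1)).
    exact/C1_continuous/affine1_C1.
  apply: ae_imp ae => {}z h /h [h1 _]; move: h1; lra.
have e2 z : px i j z -> (a.2 - a'.2) + (b.2 - b'.2) * z.2 = 0.
  apply: (@continuous_ae0 (fun z => (a.2 - a'.2) + (b.2 - b'.2) * z.2)).
    exact/C1_continuous/affine2_C1.
  apply: ae_imp ae => {}z h /h [_ h1]; move: h1; lra.
have p1 : @px R i j (i%:R + 2^-1, j%:R + 2^-1).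
  by rewrite /px /rect /= !in_itv/= -(natr1 i) -(natr1 j); lra.
have p2 : @px R i j (i%:R + 4^-1, j%:R + 4^-1).
  by rewrite /px /rect /= !in_itv/= -(natr1 i) -(natr1 j); lra.
have := e1 _ p1; have := e1 _ p2; have := e2 _ p1; have := e2 _ p2 => /=.
case: a b a' b' {e1 e2 ae} => a1 a2 [b1 b2] [a1' a2'] [b1' b2'] /= h1 h2 h3 h4.
have hb1 : b1 = b1' by lra.
have hb2 : b2 = b2' by lra.
by subst b1' b2'; split; congr (_, _); lra.
Qed.

(** The pixel having e as its right or upper edge; high_ij is the one having e
    as its left or lower edge. *)
Definition low_ij {M N} (e : edge M N) : nat * nat :=
  match e with inl ij => (val ij.1, val ij.2) | inr ij => (val ij.1, val ij.2) end.
Definition high_ij {M N} (e : edge M N) : nat * nat :=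
  match e with inl ij => (ij.1.+1, val ij.2) | inr ij => (val ij.1, ij.2.+1) end.
Definition edge_val {M N} u v (e : edge M N) : R :=
  match e with inl ij => u ij.1.+1 ij.2 | inr ij => v ij.1 ij.2.+1 end.
(** The midpoint is the only point of an edge that has to be tested to locate
    the edge with respect to a rectangle of the grid. *)
Definition mid {M N} (e : edge M N) : R * R :=
  match e with inl ij => (ij.1.+1%:R, ij.2%:R + 2^-1)
             | inr ij => (ij.1%:R + 2^-1, ij.2.+1%:R) end.

Lemma mid_segment M N (e : edge M N) : segment R e (mid e).
Proof.
by case: e => [[i j]|[i j]]; split => //=; rewrite in_itv/=;
  [rewrite -(natr1 j)|rewrite -(natr1 i)]; lra.
Qed.

(** Comparing an integer with the half-integer coordinate of a midpoint is a
    comparison of integers. *)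
Lemma half_le (m n : nat) : m%:R <= n%:R + 2^-1 :> R -> (m <= n)%N.
Proof. by move=> h; rewrite -ltnS -(ltr_nat R) -natr1; lra. Qed.

Lemma half_lt (m n : nat) : m%:R + 2^-1 <= n%:R :> R -> (m < n)%N.
Proof. by move=> h; rewrite -(ltr_nat R); lra. Qed.

Lemma segment_closure_px M N (e : edge M N) k l :
  segment R e `<=` closure (px k l) <-> (k, l) = low_ij e \/ (k, l) = high_ij e.
Proof.
rewrite closure_rect ?ltr_nat//; split.
  move=> /(_ _ (mid_segment e)); case: e => [[i j]|[i j]] /= [/=]; rewrite !in_itv/= => /andP[h1 h2] /andP[h3 h4].
    have {h3}h3 := half_le h3; have {h4}h4 := half_lt h4.
    have e1 : l = j by lia.
    move: h1 h2; rewrite !ler_nat => h1 h2.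
    have [e2|e2] : (k = i \/ k = i.+1)%N by lia.
      by left; rewrite e1 e2.
    by right; rewrite e1 e2.
  have {h1}h1 := half_le h1; have {h2}h2 := half_lt h2.
  have e1 : k = i by lia.
  move: h3 h4; rewrite !ler_nat => h3 h4.
  have [e2|e2] : (l = j \/ l = j.+1)%N by lia.
    by left; rewrite e1 e2.
  by right; rewrite e1 e2.
by case: e => [[i j]|[i j]] /= [] [-> ->] z [/=]; rewrite !in_itv/= => h1 h2;
  rewrite ?h1 ?h2; split; rewrite /= ?in_itv/= ?lexx ?ler_nat ?leqnSn//=; lra.
Qed.

(** The edge has a pixel of the rectangle on at least one side; the polynomial
    of the field on that pixel is unique, which forces the value. *)
Lemma dof_edge M N x0 x1 y0 y1 q u v (e : edge M N) :
  (x1 <= M)%N -> (y1 <= N)%N -> edge_repr x0 x1 y0 y1 q u v ->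
  (exists i j, [/\ (x0 <= i < x1)%N, (y0 <= j < y1)%N & (i, j) = low_ij e \/ (i, j) = high_ij e]) ->
  dof (open_rect R x0 x1 y0 y1) q e = edge_val u v e.
Proof.
move=> xM yN qe [i [j [hi hj ije]]].
have val_of k l w : (k, l) = low_ij e \/ (k, l) = high_ij e -> segment R e w ->
    normal_comp e (rt0 (rt_a u v k l) (rt_b u v k l) w) = edge_val u v e.
  case: e {ije} => [[i' j']|[i' j']] /= [] [-> ->] [/=].
  - by move=> -> _; rewrite -natr1; ring.
  - by move=> -> _; ring.
  - by move=> _ ->; rewrite -natr1; ring.
  - by move=> _ ->; ring.
rewrite /dof (_ : [set _ | _] = [set edge_val u v e]).
  by have := xgetPex 0 (ex_intro [set edge_val u v e] (edge_val u v e) erefl).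
apply/seteqP; split=> x /=; last first.
  move=> -> T Tsub /segment_closure_px Te; have [hT1 hT2] := px_sub_range Tsub.
  exists (rt_a u v T.1 T.2), (rt_b u v T.1 T.2); split; first exact: qe.
  by move=> w; exact: val_of.
have iM : (i < M)%N by case/andP: hi => _ /leq_trans; apply.
have jN : (j < N)%N by case/andP: hj => _ /leq_trans; apply.
move=> /(_ (Ordinal iM, Ordinal jN)); case.
- exact: px_sub_open_rect.
- exact/segment_closure_px.
move=> a [b [ab ex]].
have [ea eb] : a = rt_a u v i j /\ b = rt_b u v i j.
  apply: (@rt0_ae_inj i j); apply: (ae_imp2 _ ab (qe i j hi hj)) => z h1 h2 pz.
  by rewrite -h1// -h2.
by rewrite -(ex _ (mid_segment e)) ea eb; apply: val_of => //; exact: mid_segment.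
Qed.

Lemma edge_repr_inj x0 x1 y0 y1 x0' x1' y0' y1' q q' u v u' v' i j :
  edge_repr x0 x1 y0 y1 q u v -> edge_repr x0' x1' y0' y1' q' u' v' ->
  (x0 <= i < x1)%N -> (y0 <= j < y1)%N -> (x0' <= i < x1')%N -> (y0' <= j < y1')%N ->
  ae_eq_on (px i j) q q' ->
  [/\ u i j = u' i j, u i.+1 j = u' i.+1 j, v i j = v' i j & v i j.+1 = v' i j.+1].
Proof.
move=> r r' hi hj hi' hj' qq.
have [] := @rt0_ae_inj i j (rt_a u v i j) (rt_b u v i j) (rt_a u' v' i j) (rt_b u' v' i j).
  apply: (ae_imp2 _ (ae_imp2 (fun z h1 h2 => conj h1 h2) (r i j hi hj) (r' i j hi' hj')) qq).
  by move=> z [h1 h2] h3 pz; rewrite -h1// h3// h2.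
rewrite /rt_a /rt_b => -[e1 e2] [e3 e4]; rewrite e3 e4 in e1 e2.
have h1 : u i j = u' i j by lra.
have h2 : v i j = v' i j by lra.
by split => //; lra.
Qed.

End dofs.

(** * The energy as a function of the edge values *)

Section energies.
Context {R : realType}.
Variables (alpha : R) (f : scalar_field R).

(** A pixel has area 1, so this integral is the mean value of f. *)
Definition px_mean (i j : nat) : R := \int[area R]_(z in px i j) f z.
Definition px_sq (i j : nat) : R := \int[area R]_(z in px i j) (f z ^+ 2).
(** The integral of (d + alpha f)^2 / (2 alpha) over the pixel, with the
    square expanded: the contribution of a pixel on which the divergence is
    the constant d. *)
Definition px_energy (i j : nat) (d : R) : R :=
  (2 * alpha)^-1 * (d ^+ 2 + 2 * alpha * d * px_mean i j + alpha ^+ 2 * px_sq i j).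

Lemma L2_sub (a b c d a' b' c' d' : R) g : rect a' b' c' d' `<=` rect a b c d ->
  L2 (rect a b c d) g -> L2 (rect a' b' c' d') g.
Proof.
move=> sub [mg ig]; split.
  exact: (measurable_funS (@measurable_rect R a b c d) sub mg).
by apply: integrableS ig; [exact: measurable_rect|exact: measurable_rect|exact: sub].
Qed.

(** The divergence is almost everywhere constant on each pixel, so that the
    integral over the pixel expands into the coefficients of px_energy. *)
Lemma energy_edge x0 x1 y0 y1 q u v : (x0 < x1)%N -> (y0 < y1)%N ->
  L2 (open_rect R x0 x1 y0 y1) f ->
  L2 (open_rect R x0 x1 y0 y1) (fun z => (q z).1) ->
  L2 (open_rect R x0 x1 y0 y1) (fun z => (q z).2) ->
  (exists g, is_div (open_rect R x0 x1 y0 y1) q g) ->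
  edge_repr x0 x1 y0 y1 q u v ->
  energy alpha f (open_rect R x0 x1 y0 y1) q =
  (\sum_(x0 <= i < x1) \sum_(y0 <= j < y1) px_energy i j (edge_div u v i j))%:E.
Proof.
move=> x01 y01 Lf L1 L2' [g0 dg0] qe.
set D := open_rect R x0 x1 y0 y1.
have dd : is_div D q (div D q) by exact: (xgetPex (fun=> 0) (ex_intro _ _ dg0)).
have mD : measurable (D : set (mplane R)) by exact: measurable_rect.
have [[mf if2] [[mg ig2] _]] := (Lf, dd).
have iF : (area R).-integrable D (EFin \o (fun z => (div D q z + alpha * f z) ^+ 2)).
  have := integrableD mD (integrableZl mD 2 ig2) (integrableZl mD (2 * alpha ^+ 2) if2).
  apply: le_integrable => //.
    apply/measurable_EFinP; apply: measurable_funX; apply: measurable_funD => //.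
    exact: measurable_funM.
  move=> z _ /=; rewrite lee_fin ger0_norm ?sqr_ge0// ger0_norm; last first.
    by have := sqr_ge0 (div D q z); have := sqr_ge0 (alpha * f z); lra.
  by have := sqr_ge0 (div D q z - alpha * f z); lra.
rewrite /energy integral_pixels//; [|exact: ltnW..].
rewrite (_ : (\sum_(x0 <= i < x1) _)%E = (\sum_(x0 <= i < x1) \sum_(y0 <= j < y1)
   (edge_div u v i j ^+ 2 + 2 * alpha * edge_div u v i j * px_mean i j + alpha ^+ 2 * px_sq i j))%:E).
  rewrite -EFinM; congr EFin; rewrite mulr_sumr; apply: eq_bigr => i _.
  by rewrite mulr_sumr.
rewrite -sumEFin [LHS]big_nat_cond [RHS]big_nat_cond; apply: eq_bigr => i /andP[hi _].
rewrite -sumEFin [LHS]big_nat_cond [RHS]big_nat_cond; apply: eq_bigr => j /andP[hj _].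
have pD := @px_sub_open_rect R i j x0 x1 y0 y1 hi hj.
have mp : measurable (px i j : set (mplane R)) by exact: measurable_rect.
have Lfp : L2 (px i j) f by exact: (L2_sub pD Lf).
have ifp := L2_integrable Lfp; have [_ if2p] := Lfp.
set d := edge_div u v i j.
have ic : (area R).-integrable (px i j) (EFin \o (fun=> d ^+ 2)).
  by apply: continuous_integrable_rect; exact: cst_continuous.
transitivity (\int[area R]_(z in px i j) ((d ^+ 2 + 2 * alpha * d * f z + alpha ^+ 2 * f z ^+ 2)%:E))%E.
  apply: ae_eq_integral => //.
  - by apply: measurable_int; apply: integrableS iF.
  - apply/measurable_EFinP; apply: measurable_funD.
      apply: measurable_funD => //; apply: measurable_funM => //.
      by case: Lfp.
    by apply: measurable_funM => //; apply: measurable_funX; case: Lfp.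
  apply: ae_imp (edge_div_ae L1 L2' qe dd hi hj) => z h pz; rewrite /= h//; congr EFin.
  by rewrite /d; ring.
have i2 : (area R).-integrable (px i j) (EFin \o (fun z => 2 * alpha * d * f z)).
  exact: (integrableZl mp _ ifp).
have i3 : (area R).-integrable (px i j) (EFin \o (fun z => alpha ^+ 2 * f z ^+ 2)).
  exact: (integrableZl mp _ if2p).
have i12 : (area R).-integrable (px i j) (EFin \o (fun z => d ^+ 2 + 2 * alpha * d * f z)).
  exact: (integrableD mp ic i2).
have i123 : (area R).-integrable (px i j)
    (EFin \o (fun z => d ^+ 2 + 2 * alpha * d * f z + alpha ^+ 2 * f z ^+ 2)).
  exact: (integrableD mp i12 i3).
rewrite -[LHS]fineK; last exact: integrable_fin_num.
congr EFin; rewrite -[LHS]/(\int[area R]_(z in px i j) (d ^+ 2 + 2 * alpha * d * f z + alpha ^+ 2 * f z ^+ 2)).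
have aE : area R (px i j) = 1%:E.
  by rewrite area_rect ?ler_nat// -(natr1 i) -(natr1 j); congr EFin; ring.
have cE : \int[area R]_(z in px i j) (d ^+ 2) = d ^+ 2.
  transitivity (d ^+ 2 * fine (area R (px i j))); first exact: Rintegral_cst.
  by rewrite aE mulr1.
rewrite RintegralD// RintegralD// cE RintegralZl// RintegralZl//.
Qed.

End energies.

(** * Combinatorics of the subdomains *)

Section cuts.
Variables (M N K : nat) (G : square_array M N K).
Implicit Types (s t : 'I_(K * K)) (i j k l : nat).

Lemma cut_mono (cut : nat -> nat) a b : (forall c, (c < K)%N -> (cut c < cut c.+1)%N) ->
  (a <= b <= K)%N -> (cut a <= cut b)%N.
Proof.
move=> H /andP[]; elim: b => [|b ih]; first by rewrite leqn0 => /eqP ->.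
rewrite leq_eqVlt => /predU1P[->//|]; rewrite ltnS => ab bK.
by apply: leq_trans (ih ab (ltnW bK)) (ltnW (H _ bK)).
Qed.

(** Increasing cuts starting at 0 partition the integers below the last cut. *)
Lemma cut_locate (cut : nat -> nat) n i : (forall c, (c < K)%N -> (cut c < cut c.+1)%N) ->
  cut 0 = 0%N -> (n <= K)%N -> (i < cut n)%N ->
  exists a, (a < n)%N /\ (cut a <= i < cut a.+1)%N.
Proof.
move=> H c0; elim: n => [|n ih]; first by rewrite c0.
move=> nK i_lt; case: (ltnP i (cut n)) => h.
  by have [a [an ai]] := ih (ltnW nK) h; exists a; split => //; exact: ltnW.
by exists n; split => //; rewrite h.
Qed.

Lemma cut_inj (cut : nat -> nat) a b i : (forall c, (c < K)%N -> (cut c < cut c.+1)%N) ->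
  (a < K)%N -> (b < K)%N -> (cut a <= i < cut a.+1)%N -> (cut b <= i < cut b.+1)%N -> a = b.
Proof.
move=> H aK bK /andP[a1 a2] /andP[b1 b2].
have aux c d : (c < K)%N -> (d < K)%N -> (cut c <= i)%N -> (i < cut d.+1)%N -> (c <= d)%N.
  move=> cK dK h1 h2; rewrite leqNgt; apply/negP => dc.
  have := cut_mono H (_ : (d.+1 <= c <= K)%N); rewrite dc (ltnW cK) => /(_ isT); lia.
by apply/eqP; rewrite eqn_leq (aux a b)//= (aux b a).
Qed.

Definition in_sub s (ij : nat * nat) : bool :=
  (xcut G (position G s).1 <= ij.1 < xcut G (position G s).1.+1)%N &&
  (ycut G (position G s).2 <= ij.2 < ycut G (position G s).2.+1)%N.

Lemma xcut_le_M s : (xcut G (position G s).1.+1 <= M)%N.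
Proof. by rewrite -[leqRHS](xcutK G); apply: cut_mono; [exact: xcut_lt|rewrite leqnn andbT]. Qed.

Lemma ycut_le_N s : (ycut G (position G s).2.+1 <= N)%N.
Proof. by rewrite -[leqRHS](ycutK G); apply: cut_mono; [exact: ycut_lt|rewrite leqnn andbT]. Qed.

Lemma xcut_lt_s s : (xcut G (position G s).1 < xcut G (position G s).1.+1)%N.
Proof. exact: xcut_lt. Qed.

Lemma ycut_lt_s s : (ycut G (position G s).2 < ycut G (position G s).2.+1)%N.
Proof. exact: ycut_lt. Qed.

Lemma in_sub_range s ij : in_sub s ij -> (ij.1 < M)%N /\ (ij.2 < N)%N.
Proof.
move=> /andP[/andP[_ h1] /andP[_ h2]]; split; first exact: leq_trans h1 (xcut_le_M s).
exact: leq_trans h2 (ycut_le_N s).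
Qed.

Lemma in_sub_inj s t ij : in_sub s ij -> in_sub t ij -> s = t.
Proof.
move=> /andP[s1 s2] /andP[t1 t2]; apply: (bij_inj (position_bij G)).
have h1 := cut_inj (@xcut_lt _ _ _ G) (ltn_ord _) (ltn_ord _) s1 t1.
have h2 := cut_inj (@ycut_lt _ _ _ G) (ltn_ord _) (ltn_ord _) s2 t2.
case: (position G s) (position G t) h1 h2 => [a b] [a' b'] /= h1 h2.
by congr (_, _); apply/val_inj.
Qed.

Lemma in_sub_at (a b : nat) i j : (a < K)%N -> (b < K)%N ->
  (xcut G a <= i < xcut G a.+1)%N -> (ycut G b <= j < ycut G b.+1)%N ->
  exists s, [/\ in_sub s (i, j), (position G s).1 = a :> nat & (position G s).2 = b :> nat].
Proof.
move=> aK bK ai bj; have [g fg gf] := position_bij G.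
by exists (g (Ordinal aK, Ordinal bK)); rewrite /in_sub gf /= ai bj.
Qed.

Lemma in_sub_exists ij : (ij.1 < M)%N -> (ij.2 < N)%N -> exists s, in_sub s ij.
Proof.
case: ij => i j /= iM jN.
have [a [aK ai]] : exists a, (a < K)%N /\ (xcut G a <= i < xcut G a.+1)%N.
  by apply: cut_locate; [exact: xcut_lt|exact: xcut0|exact: leqnn|rewrite xcutK].
have [b [bK bj]] : exists a, (a < K)%N /\ (ycut G a <= j < ycut G a.+1)%N.
  by apply: cut_locate; [exact: ycut_lt|exact: ycut0|exact: leqnn|rewrite ycutK].
by have [s [sP _ _]] := in_sub_at aK bK ai bj; exists s.
Qed.

Lemma owner_exists : (0 < M)%N -> (0 < N)%N -> exists own : nat * nat -> 'I_(K * K),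
  forall ij, (ij.1 < M)%N -> (ij.2 < N)%N -> in_sub (own ij) ij.
Proof.
move=> M_gt0 N_gt0; have [s0 _] := @in_sub_exists (0%N, 0%N) M_gt0 N_gt0.
have /choice [own ownP] : forall ij : nat * nat, exists s : 'I_(K * K),
    (ij.1 < M)%N -> (ij.2 < N)%N -> in_sub s ij.
  move=> ij; have [h|h] := boolP ((ij.1 < M)%N && (ij.2 < N)%N).
    by move: h => /andP[h1 h2]; have [s sP] := in_sub_exists h1 h2; exists s.
  by exists s0 => h1 h2; rewrite h1 h2 in h.
by exists own.
Qed.

Lemma low_range (e : edge M N) : ((low_ij e).1 < M)%N /\ ((low_ij e).2 < N)%N.
Proof. by case: e => [[i j]|[i j]] /=; have := ltn_ord i; have := ltn_ord j; lia. Qed.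

Lemma high_range (e : edge M N) : ((high_ij e).1 < M)%N /\ ((high_ij e).2 < N)%N.
Proof. by case: e => [[i j]|[i j]] /=; have := ltn_ord i; have := ltn_ord j; lia. Qed.

Lemma adjacentC s t : Defs.adjacent G s t = Defs.adjacent G t s.
Proof.
rewrite /Defs.adjacent; case: (position G s) (position G t) => [a b] [a' b'].
by rewrite (eq_sym a) (eq_sym b) (orbC (b.+1 == _)) (orbC (a.+1 == _)).
Qed.

(** The two pixels of an edge share one coordinate, so their subdomains lie in
    the same row or column of the array; in the other direction the cut
    between them forces consecutive positions. *)
Lemma neighbours_adjacent s t (e : edge M N) :
  in_sub s (low_ij e) -> in_sub t (high_ij e) -> s != t -> Defs.adjacent G s t.
Proof.
move=> /andP[s1 s2] /andP[t1 t2] st; rewrite /Defs.adjacent.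
have neq : position G s != position G t by apply: contra st => /eqP /(bij_inj (position_bij G)) ->.
case: (position G s) (position G t) s1 s2 t1 t2 neq => [a b] [a' b'] /= {st s t}.
case: e => [[i j]|[i j]] /= s1 s2 t1 t2 neq.
  have e2 : b = b' by apply/val_inj; exact: (cut_inj (@ycut_lt _ _ _ G) _ _ s2 t2).
  apply/orP; right; rewrite e2 eqxx /=; apply/orP; left.
  have aa : a != a' by apply: contraNN neq => /eqP ->; rewrite e2.
  have h : xcut G a.+1 = i.+1.
    apply/eqP; rewrite eqn_leq; have /andP[_ ->] := s1; rewrite andbT leqNgt; apply/negP => h.
    have /val_inj e1 : val a = val a'.
      apply: (cut_inj (@xcut_lt _ _ _ G) (ltn_ord a) (ltn_ord a') _ t1).
      have /andP[s11 _] := s1; rewrite h andbT; exact: (leq_trans s11 (leqnSn i)).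
    by rewrite e1 eqxx in aa.
  have a1K : (a.+1 < K)%N.
    rewrite ltn_neqAle ltn_ord andbT; apply/eqP => aK; move: h; rewrite aK xcutK => MM.
    by have := ltn_ord i; lia.
  apply/eqP; apply: (cut_inj (@xcut_lt _ _ _ G) _ _ _ t1) => //.
  by rewrite h leqnn /= -h xcut_lt.
have e2 : a = a' by apply/val_inj; exact: (cut_inj (@xcut_lt _ _ _ G) _ _ s1 t1).
apply/orP; left; rewrite e2 eqxx /=; apply/orP; left.
have aa : b != b' by apply: contraNN neq => /eqP ->; rewrite e2.
have h : ycut G b.+1 = j.+1.
  apply/eqP; rewrite eqn_leq; have /andP[_ ->] := s2; rewrite andbT leqNgt; apply/negP => h.
  have /val_inj e1 : val b = val b'.
    apply: (cut_inj (@ycut_lt _ _ _ G) (ltn_ord b) (ltn_ord b') _ t2).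
    have /andP[s11 _] := s2; rewrite h andbT; exact: (leq_trans s11 (leqnSn j)).
  by rewrite e1 eqxx in aa.
have a1K : (b.+1 < K)%N.
  rewrite ltn_neqAle ltn_ord andbT; apply/eqP => aK; move: h; rewrite aK ycutK => MM.
  by have := ltn_ord j; lia.
apply/eqP; apply: (cut_inj (@ycut_lt _ _ _ G) _ _ _ t2) => //.
by rewrite h leqnn /= -h ycut_lt.
Qed.

End cuts.

(** * Edges on the interface *)

Section interface.
Context {R : realType}.
Variables (M N K : nat) (G : square_array M N K).
Implicit Types (s t : 'I_(K * K)) (i j k l : nat) (e : edge M N).

Lemma px_subdomain s i j : @px R i j `<=` @subdomain R M N K G s <-> in_sub G s (i, j).
Proof.
split; first by move=> /px_sub_range[h1 h2]; rewrite /in_sub /= h1 h2.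
by move=> /andP[h1 h2]; exact: px_sub_open_rect.
Qed.

Lemma mid_boundary s e : boundary (@subdomain R M N K G s) (mid e) ->
  in_sub G s (low_ij e) (+) in_sub G s (high_ij e).
Proof.
move=> /boundary_rect []; rewrite ?ltr_nat ?xcut_lt_s ?ycut_lt_s// /in_sub.
have := xcut_lt_s G s; have := ycut_lt_s G s.
move: (xcut _ _) (xcut _ _) (ycut _ _) (ycut _ _) => x1 x0 y1 y0 y01 x01.
case: e => [[i j]|[i j]] /=; rewrite ?ler_nat ?ltr_nat.
  move=> /andP[h1 h2] /andP[/half_le h3 /half_lt h4] h5.
  have {}h5 : ~ (x0 < i.+1 < x1)%N.
    move=> /andP[h6 h7]; apply: h5; rewrite h6 h7; split => //.
    have : y0%:R <= j%:R :> R by rewrite ler_nat.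
    have : j%:R + 1 <= y1%:R :> R by rewrite natr1 ler_nat.
    by lra.
  by lia.
move=> /andP[/half_le h3 /half_lt h4] /andP[h1 h2] h5.
have {}h5 : ~ (y0 < j.+1 < y1)%N.
  move=> /andP[h6 h7]; apply: h5; rewrite h6 h7; split => //.
  have : x0%:R <= i%:R :> R by rewrite ler_nat.
  have : i%:R + 1 <= x1%:R :> R by rewrite natr1 ler_nat.
  by lra.
by lia.
Qed.

Lemma segment_boundary s e : in_sub G s (low_ij e) (+) in_sub G s (high_ij e) ->
  segment R e `<=` boundary (@subdomain R M N K G s).
Proof.
move=> h z hz; have := xcut_lt_s G s; have := ycut_lt_s G s; rewrite /subdomain.
move: h; rewrite /in_sub.
move: (xcut _ _) (xcut _ _) (ycut _ _) (ycut _ _) => x1 x0 y1 y0 h y01 x01.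
case: e h hz => [[i j]|[i j]] /= h hz.
  by apply: (@vseg_boundary R x0 x1 y0 y1 i.+1 j z x01 y01 _ _ hz); lia.
by apply: (@hseg_boundary R x0 x1 y0 y1 i j.+1 z x01 y01 _ _ hz); lia.
Qed.

Lemma mid_subdomain s e : @subdomain R M N K G s (mid e) ->
  in_sub G s (low_ij e) && in_sub G s (high_ij e).
Proof.
rewrite /subdomain /in_sub.
move: (xcut _ _) (xcut _ _) (ycut _ _) (ycut _ _) => x1 x0 y1 y0.
case: e => [[i j]|[i j]] [] /=; rewrite !in_itv/= ?ltr_nat => /andP[h1 h2] /andP[h3 h4].
  have {}h3 := half_le (ltW h3); have {}h4 := half_lt (ltW h4); lia.
have {}h1 := half_le (ltW h1); have {}h2 := half_lt (ltW h2); lia.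
Qed.

Lemma segment_subdomain s e : in_sub G s (low_ij e) -> in_sub G s (high_ij e) ->
  segment R e `<=` @subdomain R M N K G s.
Proof.
rewrite /subdomain /in_sub.
move: (xcut _ _) (xcut _ _) (ycut _ _) (ycut _ _) => x1 x0 y1 y0.
case: e => [[i j]|[i j]] /= h1 h2 z [/=]; rewrite ?in_itv/=.
  move=> hz /andP[h3 h4]; split; rewrite /= in_itv/= ?hz ?ltr_nat; first lia.
  have : y0%:R <= j%:R :> R by rewrite ler_nat; lia.
  have : j%:R + 1 <= y1%:R :> R by rewrite natr1 ler_nat; lia.
  by move: h4; rewrite -natr1; lra.
move=> /andP[h3 h4] hz; split; rewrite /= in_itv/= ?hz ?ltr_nat; last lia.
have : x0%:R <= i%:R :> R by rewrite ler_nat; lia.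
have : i%:R + 1 <= x1%:R :> R by rewrite natr1 ler_nat; lia.
by move: h4; rewrite -natr1; lra.
Qed.

Variable own : nat * nat -> 'I_(K * K).
Hypothesis ownP : forall ij, (ij.1 < M)%N -> (ij.2 < N)%N -> in_sub G (own ij) ij.

Lemma own_low e : in_sub G (own (low_ij e)) (low_ij e).
Proof. by have [h1 h2] := low_range e; exact: ownP. Qed.

Lemma own_high e : in_sub G (own (high_ij e)) (high_ij e).
Proof. by have [h1 h2] := high_range e; exact: ownP. Qed.

Lemma in_sub_own s ij : in_sub G s ij = (s == own ij) && ((ij.1 < M)%N && (ij.2 < N)%N).
Proof.
apply/idP/idP => [h|/andP[/eqP -> /andP[h1 h2]]]; last exact: ownP.
have [h1 h2] := in_sub_range h.
by rewrite h1 h2 !andbT (in_sub_inj h (ownP h1 h2)).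
Qed.

Lemma in_sub_low s e : in_sub G s (low_ij e) = (s == own (low_ij e)).
Proof. by rewrite in_sub_own; have [-> ->] := low_range e; rewrite !andbT. Qed.

Lemma in_sub_high s e : in_sub G s (high_ij e) = (s == own (high_ij e)).
Proof. by rewrite in_sub_own; have [-> ->] := high_range e; rewrite !andbT. Qed.

Definition crossing e : bool := own (low_ij e) != own (high_ij e).

Lemma Gamma_st_segment s t e :
  segment R e `<=` @Gamma_st R M N K G s t <->
  ((s == own (low_ij e)) (+) (s == own (high_ij e))) /\
  ((t == own (low_ij e)) (+) (t == own (high_ij e))).
Proof.
rewrite -!in_sub_low -!in_sub_high; split.
  by move=> /(_ _ (mid_segment e)) [/mid_boundary h1 /mid_boundary h2].
by move=> [/segment_boundary h1 /segment_boundary h2] z hz; split; [exact: h1|exact: h2].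
Qed.

(** An edge whose midpoint lies on the boundaries of two subdomains has one of
    its pixels in each; conversely the two subdomains of a crossing edge are
    adjacent. *)
Lemma segment_Gamma e : segment R e `<=` @Gamma R M N K G <-> crossing e.
Proof.
split.
  move=> /(_ _ (mid_segment e)) [s [t [st _ [/mid_boundary + /mid_boundary]]]].
  rewrite !in_sub_low !in_sub_high /crossing => h1 h2; apply/eqP => h; move: h1.
  by rewrite h addbb.
move=> cr z hz.
have adj : Defs.adjacent G (own (low_ij e)) (own (high_ij e)).
  by apply: neighbours_adjacent (own_low e) (own_high e) cr.
have hL : segment R e `<=` boundary (@subdomain R M N K G (own (low_ij e))).
  by apply: segment_boundary; rewrite in_sub_low in_sub_high eqxx (negbTE cr).
have hH : segment R e `<=` boundary (@subdomain R M N K G (own (high_ij e))).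
  by apply: segment_boundary; rewrite in_sub_low in_sub_high eqxx eq_sym (negbTE cr).
case: (ltngtP (own (low_ij e)) (own (high_ij e))) => [h|h|/val_inj h].
- by exists (own (low_ij e)), (own (high_ij e)); split => //; split; [exact: hL|exact: hH].
- exists (own (high_ij e)), (own (low_ij e)); split => //; first by rewrite adjacentC.
  by split; [exact: hH|exact: hL].
- by move: cr; rewrite /crossing h eqxx.
Qed.

Lemma I_GammaE e : (e \in I_Gamma R G) = crossing e.
Proof. by rewrite inE; apply/asboolP/idP => /segment_Gamma. Qed.

Lemma I_subE s e : I_sub R G s e <-> (s == own (low_ij e)) || (s == own (high_ij e)).
Proof.
rewrite -in_sub_low -in_sub_high; split.
  move=> [h|h]; first by have /andP[-> _] := mid_subdomain (h _ (mid_segment e)).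
  have [/mid_boundary + _] := h _ (mid_segment e).
  by case: (in_sub _ _ _).
case h1 : (in_sub _ _ (low_ij e)); case h2 : (in_sub _ _ (high_ij e)) => // _.
- by left; exact: segment_subdomain.
- right => z hz; split; first by apply: segment_boundary hz; rewrite h1 h2.
  apply: (proj2 (segment_Gamma e)) hz; rewrite /crossing; move: h1 h2; rewrite in_sub_low in_sub_high.
  by move=> /eqP <- /negbT.
- right => z hz; split; first by apply: segment_boundary hz; rewrite h1 h2.
  apply: (proj2 (segment_Gamma e)) hz; rewrite /crossing; move: h1 h2; rewrite in_sub_low in_sub_high.
  by move=> /negbT h /eqP <-; rewrite eq_sym.
Qed.

Lemma outer_signE s e : outer_sign R G s e = if s == own (low_ij e) then 1 else -1.
Proof.
rewrite /outer_sign -in_sub_low; case: e => [[i j]|[i j]];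
by case: asboolP => [/px_subdomain -> //|h]; case: ifP => // /px_subdomain.
Qed.

End interface.

(** * Edge values of global and local fields *)

Section decomposition.
Context {R : realType}.
Variables (M N K : nat) (G : square_array M N K).
Hypotheses (M_gt0 : (0 < M)%N) (N_gt0 : (0 < N)%N).
Variable own : nat * nat -> 'I_(K * K).
Hypothesis ownP : forall ij, (ij.1 < M)%N -> (ij.2 < N)%N -> in_sub G (own ij) ij.
Implicit Types (s t : 'I_(K * K)) (i j k l : nat) (e : edge M N).
Implicit Types (u v : nat -> nat -> R) (p q : vector_field R) (P : 'I_(K * K) -> vector_field R).
Implicit Types (uu vv : 'I_(K * K) -> nat -> nat -> R).

Local Notation X0 s := (xcut G (position G s).1).
Local Notation X1 s := (xcut G (position G s).1.+1).
Local Notation Y0 s := (ycut G (position G s).2).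
Local Notation Y1 s := (ycut G (position G s).2.+1).
Local Notation sub s := (@subdomain R M N K G s).

Definition outer_zero u v : Prop :=
  (forall l, (l < N)%N -> u 0 l = 0 /\ u M l = 0) /\
  (forall k, (k < M)%N -> v k 0 = 0 /\ v k N = 0).

Definition sub_repr s q u v : Prop := edge_repr (X0 s) (X1 s) (Y0 s) (Y1 s) q u v.

(** Each point of an open edge on the outer boundary is on the boundary of a
    single subdomain, the one of the pixel of that edge; hence the outer
    boundary and the interface have no such point in common. *)
Lemma boundary_in_sub_v s k l (z : R * R) : k = 0%N \/ k = M -> vseg k l z ->
  boundary (sub s) z -> in_sub G s ((if k == 0 then 0 else M.-1)%N, l).
Proof.
move=> hk [/= z1]; rewrite in_itv/= => /andP[z2 z3].
move=> /boundary_rect []; rewrite ?ltr_nat ?xcut_lt_s ?ycut_lt_s//.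
rewrite z1 !ler_nat => /andP[h1 h2] /andP[h3 h4] _.
have h5 : (Y0 s <= l)%N by rewrite -ltnS -(ltr_nat R); lra.
have h6 : (l < Y1 s)%N by rewrite -(ltr_nat R); lra.
rewrite /in_sub /= h5 h6 andbT.
have := xcut_lt_s G s; have := xcut_le_M G s.
by case: hk h1 h2 => -> /=; [|rewrite (gtn_eqF M_gt0)]; lia.
Qed.

Lemma boundary_in_sub_h s k l (z : R * R) : l = 0%N \/ l = N -> hseg k l z ->
  boundary (sub s) z -> in_sub G s (k, (if l == 0 then 0 else N.-1)%N).
Proof.
move=> hk [/= + z1]; rewrite in_itv/= => /andP[z2 z3].
move=> /boundary_rect []; rewrite ?ltr_nat ?xcut_lt_s ?ycut_lt_s//.
rewrite z1 !ler_nat => /andP[h3 h4] /andP[h1 h2] _.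
have h5 : (X0 s <= k)%N by rewrite -ltnS -(ltr_nat R); lra.
have h6 : (k < X1 s)%N by rewrite -(ltr_nat R); lra.
rewrite /in_sub /= h5 h6 /=.
have := ycut_lt_s G s; have := ycut_le_N G s.
by case: hk h1 h2 => -> /=; [|rewrite (gtn_eqF N_gt0)]; lia.
Qed.

Lemma Gamma_outer_v k l (z : R * R) : k = 0%N \/ k = M -> vseg k l z -> ~ Gamma G z.
Proof.
move=> hk hz [s [t [st _ [bs bt]]]].
have := in_sub_inj (boundary_in_sub_v hk hz bs) (boundary_in_sub_v hk hz bt).
by move=> e; rewrite e ltnn in st.
Qed.

Lemma Gamma_outer_h k l (z : R * R) : l = 0%N \/ l = N -> hseg k l z -> ~ Gamma G z.
Proof.
move=> hk hz [s [t [st _ [bs bt]]]].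
have := in_sub_inj (boundary_in_sub_h hk hz bs) (boundary_in_sub_h hk hz bt).
by move=> e; rewrite e ltnn in st.
Qed.

(** Of the edges on the boundary of a subdomain, those on the outer boundary
    carry the value 0 and all others are crossing, hence contained in the
    interface. *)
Lemma outer_zero_vanish s u v : outer_zero u v ->
  edges_vanish (X0 s) (X1 s) (Y0 s) (Y1 s) (boundary (sub s) `\` Gamma G) u v.
Proof.
move=> [u0 v0]; have xM := xcut_le_M G s; have yN := ycut_le_N G s.
have x01 := xcut_lt_s G s; have y01 := ycut_lt_s G s.
split=> k l hk hl.
- have lN : (l < N)%N by lia.
  have [->|k0] := eqVneq k 0%N; first by left; have [] := u0 l lN.
  have [->|kM] := eqVneq k M; first by left; have [] := u0 l lN.
  right=> z hz [bz]; apply.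
  have kM1 : (k.-1 < M.-1)%N by lia.
  pose e : edge M N := inl (Ordinal kM1, Ordinal lN).
  have segE : segment R e = vseg k l by rewrite /e /= /vseg prednK// lt0n.
  have cr : crossing own e.
    have : in_sub G s (low_ij e) (+) in_sub G s (high_ij e).
      by rewrite /e /in_sub /= prednK ?lt0n//; lia.
    rewrite (in_sub_low ownP) (in_sub_high ownP) /crossing => h; apply/eqP => h'.
    by rewrite h' addbb in h.
  by apply: (proj2 (@segment_Gamma R _ _ _ _ _ ownP e) cr); rewrite segE.
- have lN : (k < M)%N by lia.
  have [->|k0] := eqVneq l 0%N; first by left; have [] := v0 k lN.
  have [->|kM] := eqVneq l N; first by left; have [] := v0 k lN.
  right=> z hz [bz]; apply.
  have kM1 : (l.-1 < N.-1)%N by lia.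
  pose e : edge M N := inr (Ordinal lN, Ordinal kM1).
  have segE : segment R e = hseg k l by rewrite /e /= /hseg prednK// lt0n.
  have cr : crossing own e.
    have : in_sub G s (low_ij e) (+) in_sub G s (high_ij e).
      by rewrite /e /in_sub /= prednK ?lt0n//; lia.
    rewrite (in_sub_low ownP) (in_sub_high ownP) /crossing => h; apply/eqP => h'.
    by rewrite h' addbb in h.
  by apply: (proj2 (@segment_Gamma R _ _ _ _ _ ownP e) cr); rewrite segE.
Qed.

Lemma Yspace_repr p : Yspace M N p ->
  exists u v, edge_repr 0 M 0 N p u v /\ outer_zero u v.
Proof.
move=> Yp; have [||u [v [r hu hv]]] := @RT_edge_repr R M N 0 M 0 N _ p _ _ Yp.
- by rewrite M_gt0 leqnn.
- by rewrite N_gt0 leqnn.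
exists u, v; split => //; split => k hk; split.
- by apply: hu; [left| |move=> z; apply: vseg_boundary => //; left].
- by apply: hu; [right| |move=> z; apply: vseg_boundary => //; right].
- by apply: hv; [left| |move=> z; apply: hseg_boundary => //; left].
- by apply: hv; [right| |move=> z; apply: hseg_boundary => //; right].
Qed.

Definition sub_outer_zero s u v : Prop :=
  (forall l, (in_sub G s (0%N, l) -> u 0 l = 0) /\ (in_sub G s (M.-1, l) -> u M l = 0)) /\
  (forall k, (in_sub G s (k, 0%N) -> v k 0 = 0) /\ (in_sub G s (k, N.-1) -> v k N = 0)).

Lemma Ysub_repr s q : Ysub G s q -> exists u v, sub_repr s q u v /\ sub_outer_zero s u v.
Proof.
have xM := xcut_le_M G s; have yN := ycut_le_N G s.
have x01 := xcut_lt_s G s; have y01 := ycut_lt_s G s.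
move=> Yq; have [||u [v [r hu hv]]] := RT_edge_repr _ _ Yq.
- by rewrite x01 xM.
- by rewrite y01 yN.
exists u, v; split => //; split => k; split => /andP[/= h1 h2].
- apply: hu => //; first by left; lia.
  move=> z hz; split; last by apply: Gamma_outer_v hz; left.
  by apply: (vseg_boundary x01 y01 _ h2 hz); lia.
- apply: hu => //; first by right; lia.
  move=> z hz; split; last by apply: Gamma_outer_v hz; right.
  by apply: (vseg_boundary x01 y01 _ h2 hz); lia.
- apply: hv => //; first by left; lia.
  move=> z hz; split; last by apply: Gamma_outer_h hz; left.
  by apply: (hseg_boundary x01 y01 _ h1 hz); lia.
- apply: hv => //; first by right; lia.
  move=> z hz; split; last by apply: Gamma_outer_h hz; right.
  by apply: (hseg_boundary x01 y01 _ h1 hz); lia.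
Qed.

Lemma sub_image s : sub s `<=` image_domain R M N.
Proof.
have xM := xcut_le_M G s; have yN := ycut_le_N G s.
move=> z [/=]; rewrite !in_itv/= => /andP[h1 h2] /andP[h3 h4].
split; rewrite /= in_itv/=.
  by rewrite (le_lt_trans _ h1) ?ler_nat// (lt_le_trans h2)// ler_nat.
by rewrite (le_lt_trans _ h3) ?ler_nat// (lt_le_trans h4)// ler_nat.
Qed.

Lemma Phi_repr p s u v : edge_repr 0 M 0 N p u v -> sub_repr s (Phi G p s) u v.
Proof.
have xM := xcut_le_M G s; have yN := ycut_le_N G s.
move=> r i j hi hj.
have hi' : (0 <= i < M)%N by lia.
have hj' : (0 <= j < N)%N by lia.
apply: ae_imp (r i j hi' hj') => z h pz; rewrite -h// /Phi patchE mem_set//.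
exact: (px_sub_open_rect hi hj).
Qed.

Lemma Phi_Ysub p s u v : Yspace M N p -> edge_repr 0 M 0 N p u v -> outer_zero u v ->
  Ysub G s (Phi G p s).
Proof.
move=> [[[m1 _] [m2 _] _] _ _] r oz.
have mD : measurable (sub s : set (mplane R)) by exact: measurable_rect.
have pE z : sub s z -> Phi G p s z = p z by move=> hz; rewrite /Phi patchE mem_set.
have H := @edge_repr_RT R M N (X0 s) (X1 s) (Y0 s) (Y1 s) (Phi G p s) u v
  (boundary (sub s) `\` Gamma G) (xcut_lt_s G s) (ycut_lt_s G s).
apply: H.
- apply: (@eq_measurable_fun _ _ _ _ _ (fun z => (p z).1)).
    by move=> z; rewrite inE => hz; rewrite pE.
  apply: (measurable_funS (E := image_domain R M N)) => //; first exact: (@measurable_rect R 0%:R M%:R 0%:R N%:R).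
  exact: sub_image.
- apply: (@eq_measurable_fun _ _ _ _ _ (fun z => (p z).2)).
    by move=> z; rewrite inE => hz; rewrite pE.
  apply: (measurable_funS (E := image_domain R M N)) => //; first exact: (@measurable_rect R 0%:R M%:R 0%:R N%:R).
  exact: sub_image.
- exact: Phi_repr.
- exact: outer_zero_vanish.
Qed.

(** Restricting to pixels makes the polynomials into a single function on the
    plane, which realizes prescribed edge values. *)
Definition edge_field u v : vector_field R := fun z =>
  (piecewise M N (fun i j z => (rt0 (rt_a u v i j) (rt_b u v i j) z).1) z,
   piecewise M N (fun i j z => (rt0 (rt_a u v i j) (rt_b u v i j) z).2) z).

Lemma edge_field_repr u v : edge_repr 0 M 0 N (edge_field u v) u v.
Proof.
move=> i j /andP[_ hi] /andP[_ hj]; apply: aeW => z pz.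
by rewrite /edge_field (piecewiseE _ hi hj pz) (piecewiseE _ hi hj pz).
Qed.

Lemma edge_field_Yspace u v : outer_zero u v -> Yspace M N (edge_field u v).
Proof.
move=> [u0 v0]; apply: (edge_repr_RT M N M_gt0 N_gt0 _ _ (edge_field_repr u v)).
- by apply: measurable_piecewise => i j; exact: rt0_continuous1.
- by apply: measurable_piecewise => i j; exact: rt0_continuous2.
split=> k l; first by move=> hk hl; left; have [] := u0 l hl; case: hk => ->.
by move=> hl hk; left; have [] := v0 k hk; case: hl => ->.
Qed.

Lemma dof_image p u v e : edge_repr 0 M 0 N p u v ->
  dof (image_domain R M N) p e = edge_val u v e.
Proof.
move=> r; apply: (dof_edge (leqnn M) (leqnn N) r).
have [h1 h2] := low_range e.
by exists (low_ij e).1, (low_ij e).2; rewrite h1 h2 -surjective_pairing; split => //; left.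
Qed.

Lemma dof_sub s q u v e : sub_repr s q u v ->
  (s == own (low_ij e)) || (s == own (high_ij e)) ->
  dof (sub s) q e = edge_val u v e.
Proof.
move=> r h; apply: (dof_edge (xcut_le_M G s) (ycut_le_N G s) r).
case/orP: h.
  rewrite -(in_sub_low ownP) => /andP[h1 h2].
  by exists (low_ij e).1, (low_ij e).2; split => //; left; rewrite -surjective_pairing.
rewrite -(in_sub_high ownP) => /andP[h1 h2].
by exists (high_ij e).1, (high_ij e).2; split => //; right; rewrite -surjective_pairing.
Qed.

Lemma Cset_repr p u v : Yspace M N p -> edge_repr 0 M 0 N p u v ->
  Cset M N p <-> forall e, `|edge_val u v e| <= 1.
Proof.
move=> Yp r; split=> [[_ h] e|h]; first by rewrite -(dof_image e r).
by split => // e; rewrite (dof_image e r).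
Qed.

Lemma Csub_repr s q u v : Ysub G s q -> sub_repr s q u v ->
  Csub G s q <-> forall e, (s == own (low_ij e)) || (s == own (high_ij e)) ->
    `|edge_val u v e| <= 1.
Proof.
move=> Yq r; split=> [[_ h] e he|h].
  by rewrite -(dof_sub r he); apply: h; apply/(@I_subE R _ _ _ _ _ ownP).
split => // e /(@I_subE R _ _ _ _ _ ownP) he; rewrite (dof_sub r he); exact: h.
Qed.

(** On a crossing edge a family of local fields has two values: low_val is the
    one of the subdomain of the left or lower pixel, high_val the one of the
    subdomain of the right or upper pixel. *)
Definition low_val uu vv e : R := edge_val (uu (own (low_ij e))) (vv (own (low_ij e))) e.
Definition high_val uu vv e : R := edge_val (uu (own (high_ij e))) (vv (own (high_ij e))) e.

(** Exactly one ordered pair of subdomains contributes to the jump, the two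
    subdomains of the pixels of e in increasing order of their numbers; the
    sign of the outer normal of the first one makes the result independent of
    the numbering. *)
Lemma jumpE P uu vv e : (forall s, sub_repr s (P s) (uu s) (vv s)) -> crossing own e ->
  jump G P e = low_val uu vv e - high_val uu vv e.
Proof.
move=> r cr; rewrite /jump.
have cr' : own (high_ij e) != own (low_ij e) by rewrite eq_sym.
have adj : Defs.adjacent G (own (low_ij e)) (own (high_ij e)).
  exact: neighbours_adjacent (own_low ownP e) (own_high ownP e) cr.
have term s t : s != t ->
    `[< segment R e `<=` Gamma_st G s t >] =
    ((s == own (low_ij e)) && (t == own (high_ij e))) ||
    ((s == own (high_ij e)) && (t == own (low_ij e))).
  move=> st; apply/asboolP/idP.
    have n0 x : ~~ ((s == x) && (t == x)).
      by apply: contra st => /andP[/eqP -> /eqP ->].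
    have n1 x : ~~ ((x == own (low_ij e)) && (x == own (high_ij e))).
      by apply: contra cr => /andP[/eqP <- /eqP <-].
    move=> /(@Gamma_st_segment R _ _ _ _ _ ownP)[].
    move: (n0 (own (low_ij e))) (n0 (own (high_ij e))) (n1 s) (n1 t).
    by case: (s == own (low_ij e)); case: (s == own (high_ij e));
       case: (t == own (low_ij e)); case: (t == own (high_ij e)).
  move=> h; apply/(@Gamma_st_segment R _ _ _ _ _ ownP).
  by case/orP: h => /andP[/eqP -> /eqP ->]; rewrite !eqxx (negbTE cr) (negbTE cr').
pose F s t := outer_sign R G s e * dof (sub s) (P s) e - outer_sign R G s e * dof (sub t) (P t) e.
have F1 : F (own (low_ij e)) (own (high_ij e)) = low_val uu vv e - high_val uu vv e.
  rewrite /F (@outer_signE R _ _ _ _ _ ownP) eqxx !mul1r.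
  by rewrite (dof_sub (r _)) ?eqxx// (dof_sub (r _)) ?eqxx ?orbT.
have F2 : F (own (high_ij e)) (own (low_ij e)) = low_val uu vv e - high_val uu vv e.
  rewrite /F (@outer_signE R _ _ _ _ _ ownP) (negbTE cr').
  by rewrite (dof_sub (r _)) ?eqxx ?orbT// (dof_sub (r _)) ?eqxx// /low_val /high_val; ring.
rewrite -/(F _ _).
have pick s0 t0 : (s0 < t0)%N -> Defs.adjacent G s0 t0 ->
    (forall s t, s != t -> `[< segment R e `<=` Gamma_st G s t >] =
      ((s == s0) && (t == t0)) || ((s == t0) && (t == s0))) ->
    \sum_(s < K * K) \sum_(t < K * K |
      [&& (s < t)%N, Defs.adjacent G s t & `[< segment R e `<=` Gamma_st G s t >]]) F s t = F s0 t0.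
  move=> st0 adj0 H.
  have HH s t : [&& (s < t)%N, Defs.adjacent G s t & `[< segment R e `<=` Gamma_st G s t >]]
      = (s == s0) && (t == t0).
    apply/idP/idP; last first.
      move=> /andP[/eqP -> /eqP ->]; rewrite st0 adj0 H ?eqxx//.
      by apply/eqP => h; rewrite h ltnn in st0.
    move=> /and3P[st _]; rewrite H; last by apply/eqP => h; rewrite h ltnn in st.
    by case/orP => // /andP[/eqP e1 /eqP e2]; move: st; rewrite e1 e2 ltnNge (ltnW st0).
  rewrite (bigD1 s0)//= [X in _ + X]big1 ?addr0; last first.
    by move=> s ss; apply: big_pred0 => t; rewrite HH (negbTE ss).
  by rewrite (eq_bigl (pred1 t0)) ?big_pred1_eq// => t; rewrite HH eqxx.
case: (ltngtP (own (low_ij e)) (own (high_ij e))) => [h|h|/val_inj h].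
- by rewrite (pick _ _ h adj).
- rewrite (pick _ _ h) => //; first by rewrite adjacentC.
  by move=> s t st; rewrite term// orbC.
- by move: cr; rewrite /crossing h eqxx.
Qed.

End decomposition.

(** * Sums over pixels and edges *)

Section range_sums.
Context {R : realType}.

Lemma sum_subrange (g : nat -> R) x0 x1 M : (x0 <= x1 <= M)%N ->
  \sum_(x0 <= i < x1) g i = \sum_(i < M) (if (x0 <= i < x1)%N then g i else 0).
Proof.
move=> /andP[x01 xM]; rewrite -(big_mkord xpredT (fun i => if (x0 <= i < x1)%N then g i else 0)).
rewrite (big_cat_nat (leq0n x0) (leq_trans x01 xM))/=.
rewrite [X in _ + X](big_cat_nat x01 xM)/=.
rewrite [X in X + _]big_nat_cond [X in X + _]big1 ?add0r; last by move=> i /andP[h _]; rewrite ifF//; lia.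
rewrite [X in _ + X]big_nat_cond [X in _ + X]big1 ?addr0; last by move=> i /andP[h _]; rewrite ifF//; lia.
by apply: eq_big_nat => i ->.
Qed.

Lemma sum_pred_ord (g : nat -> R) M : (0 < M)%N -> g M.-1 = 0 ->
  \sum_(i < M) g i = \sum_(i < M.-1) g i.
Proof. by case: M => // m _ /= g0; rewrite big_ord_recr/= g0 addr0. Qed.

Lemma sum_edges M N (g : edge M N -> R) :
  \sum_e g e = \sum_(i < M.-1) \sum_(j < N) g (inl (i, j)) + \sum_(i < M) \sum_(j < N.-1) g (inr (i, j)).
Proof.
rewrite big_sumType/=; congr (_ + _).
  by rewrite pair_big/=; apply: eq_bigr => -[].
by rewrite pair_big/=; apply: eq_bigr => -[].
Qed.

End range_sums.

(** * The discrete problems *)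

Section discrete.
Context {R : realType}.
Variables (M N K : nat) (G : square_array M N K).
Hypotheses (M_gt0 : (0 < M)%N) (N_gt0 : (0 < N)%N).
Variable own : nat * nat -> 'I_(K * K).
Hypothesis ownP : forall ij, (ij.1 < M)%N -> (ij.2 < N)%N -> in_sub G (own ij) ij.
Variables (alpha : R) (f : scalar_field R).
Hypotheses (alpha_gt0 : 0 < alpha) (f_L2 : L2 (image_domain R M N) f).
Implicit Types (s t : 'I_(K * K)) (i j k l : nat) (e : edge M N).
Implicit Types (u v : nat -> nat -> R) (p q : vector_field R) (P : 'I_(K * K) -> vector_field R).
Implicit Types (uu vv : 'I_(K * K) -> nat -> nat -> R).

Local Notation X0 s := (xcut G (position G s).1).
Local Notation X1 s := (xcut G (position G s).1.+1).
Local Notation Y0 s := (ycut G (position G s).2).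
Local Notation Y1 s := (ycut G (position G s).2.+1).
Local Notation sub s := (@subdomain R M N K G s).
Local Notation low_val := (low_val own).
Local Notation high_val := (high_val own).

(** Each pixel belongs to exactly one subdomain. *)
Lemma sum_subdomains (g : 'I_(K * K) -> nat -> nat -> R) :
  \sum_s \sum_(X0 s <= i < X1 s) \sum_(Y0 s <= j < Y1 s) g s i j =
  \sum_(i < M) \sum_(j < N) g (own (val i, val j)) i j.
Proof.
transitivity (\sum_s \sum_(i < M) \sum_(j < N) (if in_sub G s (val i, val j) then g s i j else 0)).
  apply: eq_bigr => s _.
  rewrite (@sum_subrange _ _ _ _ M); last by rewrite (ltnW (xcut_lt_s G s)) xcut_le_M.
  apply: eq_bigr => i _; case: ifP => hi; last first.
    by rewrite big1// => j _; rewrite /in_sub /= hi.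
  rewrite (@sum_subrange _ _ _ _ N); last by rewrite (ltnW (ycut_lt_s G s)) ycut_le_N.
  by apply: eq_bigr => j _; rewrite /in_sub /= hi.
rewrite exchange_big/=; apply: eq_bigr => i _; rewrite exchange_big/=; apply: eq_bigr => j _.
rewrite -big_mkcond/= (eq_bigl (pred1 (own (val i, val j)))) ?big_pred1_eq// => s.
by rewrite (in_sub_own ownP) /= !ltn_ord !andbT.
Qed.

Definition total_energy u v : R := \sum_(i < M) \sum_(j < N) px_energy alpha f i j (edge_div u v i j).
Definition own_div uu vv i j : R := edge_div (uu (own (i, j))) (vv (own (i, j))) i j.
Definition total_energy_tilde uu vv : R :=
  \sum_(i < M) \sum_(j < N) px_energy alpha f i j (own_div uu vv i j).

Lemma energy_image p u v : Yspace M N p -> edge_repr 0 M 0 N p u v ->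
  energy alpha f (image_domain R M N) p = (total_energy u v)%:E.
Proof.
move=> [[L1 L2' dp] _ _] r.
rewrite (energy_edge alpha M_gt0 N_gt0 f_L2 L1 L2' dp r) /total_energy big_mkord; congr EFin.
by apply: eq_bigr => i _; rewrite big_mkord.
Qed.

Lemma energy_tildeE P uu vv : Ytilde G P -> (forall s, sub_repr G s (P s) (uu s) (vv s)) ->
  energy_tilde G alpha f P = (total_energy_tilde uu vv)%:E.
Proof.
move=> YP r.
rewrite /energy_tilde (eq_bigr (fun s => (\sum_(X0 s <= i < X1 s) \sum_(Y0 s <= j < Y1 s)
    px_energy alpha f i j (edge_div (uu s) (vv s) i j))%:E)).
  by rewrite sumEFin; congr EFin; rewrite (sum_subdomains (fun s i j => px_energy alpha f i j (edge_div (uu s) (vv s) i j))).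
move=> s _; have [[L1 L2' dp] _ _] := YP s.
apply: (energy_edge alpha (xcut_lt_s G s) (ycut_lt_s G s) _ L1 L2' dp (r s)).
exact: (L2_sub (sub_image (s := s)) f_L2).
Qed.

(** The derivative of the energy of the pixel (i, j) at the divergence of the
    field with edge values u, v. *)
Definition weight u v i j : R := alpha^-1 * (edge_div u v i j + alpha * px_mean f i j).

(** The Taylor expansion of the quadratic pixel energy is exact; its
    second-order term is nonnegative, which gives convexity. *)
Lemma px_energyD i j (d d' : R) : px_energy alpha f i j d' =
  px_energy alpha f i j d + alpha^-1 * (d + alpha * px_mean f i j) * (d' - d)
  + (2 * alpha)^-1 * (d' - d) ^+ 2.
Proof. by rewrite /px_energy; field; rewrite (gt_eqF alpha_gt0). Qed.

Definition admissible u v : Prop := outer_zero M N u v /\ forall e, `|edge_val u v e| <= 1.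

(** Along the segment from (u, v) to (u', v') the energy is total + t A + t^2
    Q with Q >= 0; minimality at t = 0 forces A >= 0. *)
Lemma variational_ineq u v u' v' : admissible u v -> admissible u' v' ->
  (forall u1 v1, admissible u1 v1 -> total_energy u v <= total_energy u1 v1) ->
  0 <= \sum_(i < M) \sum_(j < N) weight u v i j * (edge_div u' v' i j - edge_div u v i j).
Proof.
move=> [oz c] [oz' c'] min.
set A := \sum_(i < M) _.
pose Q := \sum_(i < M) \sum_(j < N) (2 * alpha)^-1 * (edge_div u' v' i j - edge_div u v i j) ^+ 2.
have Q0 : 0 <= Q.
  apply: sumr_ge0 => i _; apply: sumr_ge0 => j _; by rewrite mulr_ge0 ?sqr_ge0// invr_ge0 mulr_ge0// ltW.
have step (t : R) : 0 < t <= 1 -> 0 <= A + t * Q.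
  move=> /andP[t0 t1].
  pose ut i j := u i j + t * (u' i j - u i j); pose vt i j := v i j + t * (v' i j - v i j).
  have adm : admissible ut vt.
    split.
      have [h1 h2] := oz; have [h1' h2'] := oz'; rewrite /ut /vt; split=> k hk.
        have [-> ->] := h1 k hk; have [-> ->] := h1' k hk; lra.
      have [-> ->] := h2 k hk; have [-> ->] := h2' k hk; lra.
    move=> e; have := c e; have := c' e; rewrite /edge_val /ut /vt.
    by case: e => -[i j]; rewrite !ler_norml => /andP[? ?] /andP[? ?]; apply/andP; split; nra.
  have := min _ _ adm.
  have -> : total_energy ut vt = total_energy u v + t * A + t ^+ 2 * Q.
    rewrite /total_energy /A /Q !mulr_sumr -!big_split/=; apply: eq_bigr => i _.
    rewrite !mulr_sumr -!big_split/=; apply: eq_bigr => j _.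
    rewrite (px_energyD i j (edge_div u v i j) (edge_div ut vt i j)) /weight.
    have -> : edge_div ut vt i j - edge_div u v i j = t * (edge_div u' v' i j - edge_div u v i j).
      by rewrite /edge_div /ut /vt; ring.
    by ring.
  by move=> h; rewrite -(pmulr_rge0 _ t0); lra.
rewrite leNgt; apply/negP => A0.
(* The parameter t below is at most 1 only if -A <= 2 (Q + 1); otherwise t = 1
   already gives a contradiction. *)
have [h|h] := leP (- A) (2 * (Q + 1)); last first.
  by have := step 1; rewrite ltr01 lexx => /(_ isT); lra.
(* If A < 0, this t makes A + t Q at most A / 2. *)
have t0 : 0 < - A / (2 * (Q + 1)) by rewrite divr_gt0 ?oppr_gt0//; lra.
have := step (- A / (2 * (Q + 1))); rewrite t0 ler_pdivrMr ?mul1r; last by lra.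
move=> /(_ h) h2.
have e1 : - A / (2 * (Q + 1)) * (2 * (Q + 1)) = - A by rewrite divfK//; lra.
by nra.
Qed.

(** A global field obtained from a family of local ones by taking, on each
    edge, the value of the subdomain owning the right or upper pixel; edges on
    the right and upper sides of the image have no such pixel and get 0. *)
Definition glue_u uu i j : R := if (i < M)%N then uu (own (i, j)) i j else 0.
Definition glue_v vv i j : R := if (j < N)%N then vv (own (i, j)) i j else 0.

Definition family_outer_zero uu vv : Prop :=
  forall s, sub_outer_zero G s (uu s) (vv s).

Lemma glue_outer_zero uu vv : family_outer_zero uu vv ->
  outer_zero M N (glue_u uu) (glue_v vv).
Proof.
move=> oz; rewrite /glue_u /glue_v; split=> k hk; rewrite ltnn; split=> //.
  rewrite M_gt0; have [h _] := oz (own (0%N, k)); apply: (h k).1.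
  exact: ownP.
rewrite N_gt0; have [_ h] := oz (own (k, 0%N)); apply: (h k).1.
exact: ownP.
Qed.

Lemma glue_edge_val uu vv e : edge_val (glue_u uu) (glue_v vv) e = high_val uu vv e.
Proof.
rewrite /high_val /edge_val /glue_u /glue_v.
have [h1 h2] := high_range e.
by case: e h1 h2 => -[i j] /= h1 h2; rewrite ?h1 ?h2.
Qed.

(** Gluing changes the divergence only on pixels whose right or upper edge is
    crossing, and there by the jump of the family on that edge. This identity
    is the reason for the choice of the multiplier. *)
Lemma glue_div_sum uu vv (w : nat -> nat -> R) : family_outer_zero uu vv ->
  \sum_(i < M) \sum_(j < N) w i j * own_div uu vv i j =
  \sum_(i < M) \sum_(j < N) w i j * edge_div (glue_u uu) (glue_v vv) i j +
  \sum_(e : edge M N) w (low_ij e).1 (low_ij e).2 * (low_val uu vv e - high_val uu vv e).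
Proof.
move=> oz; rewrite sum_edges.
pose gv i j := w i j * (uu (own (i, j)) i.+1 j - glue_u uu i.+1 j).
pose gh i j := w i j * (vv (own (i, j)) i j.+1 - glue_v vv i j.+1).
have e1 : \sum_(i < M.-1) \sum_(j < N) w (low_ij (inl (i, j) : edge M N)).1 (low_ij (inl (i, j) : edge M N)).2
    * (low_val uu vv (inl (i, j)) - high_val uu vv (inl (i, j))) = \sum_(i < M) \sum_(j < N) gv i j.
  rewrite (sum_pred_ord (g := fun i => \sum_(j < N) gv i j))//.
    apply: eq_bigr => i _; apply: eq_bigr => j _.
    by rewrite -glue_edge_val /gv.
  apply: big1 => j _; rewrite /gv prednK// /glue_u ltnn subr0.
  have [h _] := oz (own (M.-1, val j)); rewrite (h j).2 ?mulr0//.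
  by apply: ownP => //=; rewrite prednK.
have e2 : \sum_(i < M) \sum_(j < N.-1) w (low_ij (inr (i, j) : edge M N)).1 (low_ij (inr (i, j) : edge M N)).2
    * (low_val uu vv (inr (i, j)) - high_val uu vv (inr (i, j))) = \sum_(i < M) \sum_(j < N) gh i j.
  apply: eq_bigr => i _; rewrite (sum_pred_ord (g := fun j => gh i j))//.
    by apply: eq_bigr => j _; rewrite -glue_edge_val /gh.
  rewrite /gh prednK// /glue_v ltnn subr0.
  have [_ h] := oz (own (val i, N.-1)); rewrite (h i).2 ?mulr0//.
  by apply: ownP => //=; rewrite prednK.
rewrite e1 e2 -!big_split/=; apply: eq_bigr => i _.
rewrite -!big_split/=; apply: eq_bigr => j _.
rewrite /own_div /edge_div /gv /gh.
have -> : glue_u uu i j = uu (own (val i, val j)) i j by rewrite /glue_u ltn_ord.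
have -> : glue_v vv i j = vv (own (val i, val j)) i j by rewrite /glue_v ltn_ord.
ring.
Qed.

Lemma not_crossing uu vv e : ~~ crossing own e -> low_val uu vv e = high_val uu vv e.
Proof. by move=> /negPn /eqP h; rewrite /low_val /high_val h. Qed.

(** Edges that are not crossing have no jump, so the sum over the interface
    extends to all edges. *)
Lemma inner_jump P uu vv (mu : edge M N -> R) :
  (forall s, sub_repr G s (P s) (uu s) (vv s)) ->
  inner (B G P) (\row_k mu (enum_val k)) =
  \sum_(e : edge M N) mu e * (low_val uu vv e - high_val uu vv e).
Proof.
move=> r; rewrite /inner.
transitivity (\sum_(k < #|I_Gamma R G|) (fun e => jump G P e * mu e) (enum_val k)).
  by apply: eq_bigr => k _; rewrite !mxE.
rewrite -(big_enum_val (fun e => jump G P e * mu e))/=.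
rewrite big_mkcond/=; apply: eq_bigr => e _; rewrite (@I_GammaE R _ _ _ _ _ ownP).
case: ifP => [cr|/negbT ncr]; last by rewrite (not_crossing _ _ ncr) subrr mulr0.
by rewrite (jumpE ownP r cr) mulrC.
Qed.

Lemma kerB_vals P uu vv : (forall s, sub_repr G s (P s) (uu s) (vv s)) ->
  B G P = 0 <-> forall e, low_val uu vv e = high_val uu vv e.
Proof.
move=> r; split=> [B0 e|h].
  have [cr|ncr] := boolP (crossing own e); last exact: not_crossing.
  have eI : e \in I_Gamma R G by rewrite (@I_GammaE R _ _ _ _ _ ownP).
  have := congr1 (fun b : 'rV_#|I_Gamma R G| => b 0 (enum_rank_in eI e)) B0.
  rewrite !mxE enum_rankK_in// (jumpE ownP r cr) => /eqP.
  by rewrite subr_eq0 => /eqP.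
apply/rowP => k; rewrite !mxE (jumpE ownP r); first by rewrite h subrr.
by rewrite -(@I_GammaE R _ _ _ _ _ ownP) enum_valP.
Qed.

Lemma Ctilde_repr P uu vv : Ytilde G P -> (forall s, sub_repr G s (P s) (uu s) (vv s)) ->
  Ctilde G P <-> forall e, `|low_val uu vv e| <= 1 /\ `|high_val uu vv e| <= 1.
Proof.
move=> YP r; split=> [CP e|h s].
  split.
    by have [h _] := Csub_repr ownP (YP _) (r (own (low_ij e))); apply: (h (CP _)); rewrite eqxx.
  by have [h _] := Csub_repr ownP (YP _) (r (own (high_ij e))); apply: (h (CP _)); rewrite eqxx orbT.
apply/(Csub_repr ownP (YP s) (r s)) => e /orP[/eqP ->|/eqP ->].
  by have [] := h e.
by have [] := h e.
Qed.

Lemma Ytilde_repr P : Ytilde G P -> exists uu vv,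
  (forall s, sub_repr G s (P s) (uu s) (vv s)) /\ family_outer_zero uu vv.
Proof.
move=> YP.
have /choice [uv uvP] : forall s, exists uv : (nat -> nat -> R) * (nat -> nat -> R),
    sub_repr G s (P s) uv.1 uv.2 /\ sub_outer_zero G s uv.1 uv.2.
  by move=> s; have [u [v uvP]] := Ysub_repr M_gt0 N_gt0 (YP s); exists (u, v).
exists (fun s => (uv s).1), (fun s => (uv s).2); split=> s; have [] := uvP s => //.
Qed.

End discrete.

(** * Duality *)

(** When the jumps vanish, the value taken from the right or upper pixel is
    also the value seen from the left or lower one, so that gluing reproduces
    the local field on every pixel. *)
Lemma glued_field {R : realType} (M N K : nat) (G : square_array M N K)
    (M_gt0 : (0 < M)%N) (N_gt0 : (0 < N)%N) (own : nat * nat -> 'I_(K * K))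
    (ownP : forall ij, (ij.1 < M)%N -> (ij.2 < N)%N -> in_sub G (own ij) ij)
    (P : 'I_(K * K) -> vector_field R) :
  kerB G P -> exists2 p, Yspace M N p & tilde_eq G (Phi G p) P.
Proof.
move=> [YP B0]; have [uu [vv [r oz]]] := Ytilde_repr M_gt0 N_gt0 YP.
have /(kerB_vals ownP r) eqv := B0.
pose u := glue_u M own uu; pose v := glue_v N own vv.
have ozg : outer_zero M N u v by exact: (glue_outer_zero M_gt0 N_gt0 ownP).
exists (edge_field M N u v); first exact: edge_field_Yspace.
move=> s; apply: ae_pixels => i j hi hj.
have hs : in_sub G s (i, j) by rewrite /in_sub /= hi hj.
have [/= iM jN] := in_sub_range hs.
have os : own (i, j) = s by apply/esym/(in_sub_inj hs)/ownP.
have [hu hv] := oz s.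
have e1 : u i j = uu s i j by rewrite /u /glue_u iM os.
have e2 : v i j = vv s i j by rewrite /v /glue_v jN os.
have e3 : u i.+1 j = uu s i.+1 j.
  rewrite /u /glue_u; case: ltnP => h.
    have iM1 : (i < M.-1)%N by lia.
    have := eqv (inl (Ordinal iM1, Ordinal jN)).
    by rewrite /low_val /high_val /= os => ->.
  have iE : i = M.-1 by lia.
  by rewrite iE prednK// (hu j).2// -iE.
have e4 : v i j.+1 = vv s i j.+1.
  rewrite /v /glue_v; case: ltnP => h.
    have jN1 : (j < N.-1)%N by lia.
    have := eqv (inr (Ordinal iM, Ordinal jN1)).
    by rewrite /low_val /high_val /= os => ->.
  have jE : j = N.-1 by lia.
  by rewrite jE prednK// (hv i).2// -jE.
have rs := r s i j hi hj.
have rp := Phi_repr M_gt0 N_gt0 (G := G) (s := s) (@edge_field_repr R M N u v) hi hj.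
apply: (ae_imp2 _ rp rs) => z h1 h2 pz; rewrite h1// h2//.
by rewrite /rt_a /rt_b e1 e2 e3 e4.
Qed.

Section duality.
Context {R : realType}.
Variables (M N K : nat) (G : square_array M N K).
Hypotheses (M_gt0 : (0 < M)%N) (N_gt0 : (0 < N)%N).
Variable own : nat * nat -> 'I_(K * K).
Hypothesis ownP : forall ij, (ij.1 < M)%N -> (ij.2 < N)%N -> in_sub G (own ij) ij.
Variables (alpha : R) (f : scalar_field R).
Hypotheses (alpha_gt0 : 0 < alpha) (f_L2 : L2 (image_domain R M N) f).
Implicit Types (s t : 'I_(K * K)) (i j k l : nat) (e : edge M N).
Implicit Types (u v : nat -> nat -> R) (p q : vector_field R) (P Q : 'I_(K * K) -> vector_field R).
Implicit Types (uu vv : 'I_(K * K) -> nat -> nat -> R).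

Local Notation lowv := (low_val own).
Local Notation highv := (high_val own).
Local Notation energy_of := (total_energy M N alpha f).
Local Notation energy_of_tilde := (total_energy_tilde M N own alpha f).

Lemma chi_in (X : Type) (S : set X) x : S x -> chi S x = 0%E :> \bar R.
Proof. by move=> h; rewrite /chi asboolT. Qed.

Lemma chi_out (X : Type) (S : set X) x : ~ S x -> chi S x = +oo%E :> \bar R.
Proof. by move=> h; rewrite /chi asboolF. Qed.

Lemma objective_in p u v : edge_repr 0 M 0 N p u v -> Cset M N p ->
  objective M N alpha f p = (energy_of u v)%:E.
Proof.
move=> r Cp; have Yp : Yspace M N p by case: Cp.
by rewrite /objective (energy_image M_gt0 N_gt0 alpha f_L2 Yp r) chi_in// adde0.
Qed.

Lemma objective_out p : Yspace M N p -> ~ Cset M N p -> objective M N alpha f p = +oo%E.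
Proof.
move=> Yp nC; have [u [v [r _]]] := Yspace_repr M_gt0 N_gt0 Yp.
by rewrite /objective (energy_image M_gt0 N_gt0 alpha f_L2 Yp r) chi_out.
Qed.

Lemma admissible_field u v : admissible M N u v ->
  Yspace M N (edge_field M N u v) /\ Cset M N (edge_field M N u v).
Proof.
move=> [oz c]; have Y := edge_field_Yspace M_gt0 N_gt0 oz; split=> //.
by apply/(Cset_repr Y (@edge_field_repr R M N u v)).
Qed.

Lemma zero_admissible : admissible M N (fun _ _ => 0 : R) (fun _ _ => 0).
Proof.
split; first by split.
by move=> e; rewrite /edge_val; case: e => -[i j]; rewrite normr0.
Qed.

(** The zero field has finite objective, so a minimizer does too. *)
Lemma solves_P_admissible p u v : solves_P M N alpha f p ->
  edge_repr 0 M 0 N p u v -> outer_zero M N u v -> Cset M N p.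
Proof.
move=> [Yp min] r oz; apply: contrapT => nC.
have [Y0 C0] := admissible_field zero_admissible.
have := min _ Y0; rewrite (objective_out Yp nC) (objective_in (@edge_field_repr R M N _ _) C0).
by rewrite leye_eq.
Qed.

Lemma LagrangianE P uu vv (mu : edge M N -> R) : Ctilde G P ->
  (forall s, sub_repr G s (P s) (uu s) (vv s)) ->
  Lagrangian (G := G) alpha f P (\row_k mu (enum_val k)) =
  (energy_of_tilde uu vv + \sum_(e : edge M N) mu e * (lowv uu vv e - highv uu vv e))%:E.
Proof.
move=> CP r; have YP : Ytilde G P by move=> s; have [] := CP s.
rewrite /Lagrangian (energy_tildeE ownP alpha f_L2 YP r) chi_in// adde0.
by rewrite (inner_jump ownP _ r) -EFinD.
Qed.

Lemma Lagrangian_out P lam : Ytilde G P -> ~ Ctilde G P ->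
  Lagrangian (G := G) alpha f P lam = +oo%E.
Proof.
move=> YP nC; have [uu [vv [r _]]] := Ytilde_repr M_gt0 N_gt0 YP.
by rewrite /Lagrangian (energy_tildeE ownP alpha f_L2 YP r) chi_out.
Qed.

(** Multipliers indexed by the enumeration of the interface are restrictions
    of functions of edges. *)
Lemma multiplier_row (lam : 'rV[R]_#|I_Gamma R G|) :
  exists mu : edge M N -> R, lam = \row_k mu (enum_val k).
Proof.
exists (fun e => if pselect (e \in I_Gamma R G) is left eI then lam 0 (enum_rank_in eI e) else 0).
apply/rowP => k; rewrite !mxE; case: pselect => [eI|]; last by rewrite enum_valP.
by rewrite enum_valK_in.
Qed.

Lemma total_energy_tilde_cst u v : energy_of_tilde (fun=> u) (fun=> v) = energy_of u v.
Proof. by []. Qed.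

Lemma Phi_data p u v : Yspace M N p -> edge_repr 0 M 0 N p u v -> outer_zero M N u v ->
  Ytilde G (Phi G p) /\ (forall s, sub_repr G s (Phi G p s) u v).
Proof. by move=> Yp r oz; split=> s; [exact: (Phi_Ysub M_gt0 N_gt0 ownP s Yp r oz)|exact: (Phi_repr M_gt0 N_gt0 (G := G) (s := s) r)]. Qed.

Lemma Phi_Ctilde p u v : Yspace M N p -> edge_repr 0 M 0 N p u v -> outer_zero M N u v ->
  Cset M N p -> Ctilde G (Phi G p).
Proof.
move=> Yp r oz /(Cset_repr Yp r) c; have [YP rP] := Phi_data Yp r oz.
by apply/(Ctilde_repr ownP (uu := fun=> u) (vv := fun=> v) YP rP) => e; split; exact: c.
Qed.

(** The multiplier on e is minus the derivative of the energy of the left or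
    lower pixel of e; convexity, the variational inequality and the gluing
    identity add up to the right-hand saddle point inequality. *)
Lemma primal_of_solution p : solves_P M N alpha f p -> primal_solution G alpha f (Phi G p).
Proof.
move=> sol; have [Yp min] := sol.
have [u [v [r oz]]] := Yspace_repr M_gt0 N_gt0 Yp.
have Cp := solves_P_admissible sol r oz.
have [YP rP] := Phi_data Yp r oz.
have CP := Phi_Ctilde Yp r oz Cp.
have adm : admissible M N u v by split => //; apply/(Cset_repr Yp r).
have minT u1 v1 : admissible M N u1 v1 -> energy_of u v <= energy_of u1 v1.
  move=> adm1; have [Y1 C1'] := admissible_field adm1.
  have := min _ Y1; rewrite (objective_in r Cp) (objective_in (@edge_field_repr R M N _ _) C1').
  by rewrite lee_fin.
pose w i j := weight alpha f u v i j.
pose mu (e : edge M N) := - w (low_ij e).1 (low_ij e).2.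
have LP nu : Lagrangian (G := G) alpha f (Phi G p) nu = (energy_of u v)%:E.
  have [m ->] := multiplier_row nu.
  rewrite (LagrangianE (uu := fun=> u) (vv := fun=> v) _ CP rP) total_energy_tilde_cst.
  by rewrite big1 ?addr0// => e _; rewrite /low_val /high_val subrr mulr0.
exists (\row_k mu (enum_val k)); split => //.
- by rewrite LP.
- by move=> nu; rewrite !LP.
move=> Q YQ; rewrite LP.
have [CQ|nCQ] := pselect (Ctilde G Q); last by rewrite Lagrangian_out// leey.
have [uu [vv [rQ ozQ]]] := Ytilde_repr M_gt0 N_gt0 YQ.
rewrite (LagrangianE _ CQ rQ) lee_fin.
have admQ : admissible M N (glue_u M own uu) (glue_v N own vv).
  split; first exact: (glue_outer_zero M_gt0 N_gt0 ownP).
  by move=> e; rewrite glue_edge_val; have [] := (Ctilde_repr ownP YQ rQ).1 CQ e.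
have VI := variational_ineq alpha_gt0 adm admQ minT.
have convex : energy_of u v + \sum_(i < M) \sum_(j < N) w i j * (own_div own uu vv i j - edge_div u v i j)
    <= energy_of_tilde uu vv.
  rewrite /total_energy /total_energy_tilde -big_split/=; apply: ler_sum => i _.
  rewrite -big_split/=; apply: ler_sum => j _.
  rewrite (px_energyD f alpha_gt0 i j (edge_div u v i j) (own_div own uu vv i j)) /w /weight.
  rewrite lerDl mulr_ge0 ?sqr_ge0// invr_ge0 mulr_ge0// ltW//.
have glue := glue_div_sum M_gt0 N_gt0 ownP w ozQ.
have muE : \sum_(e : edge M N) mu e * (lowv uu vv e - highv uu vv e) =
   - \sum_(e : edge M N) w (low_ij e).1 (low_ij e).2 * (lowv uu vv e - highv uu vv e).
  by rewrite -sumrN; apply: eq_bigr => e _; rewrite mulNr.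
have expand (h : nat -> nat -> R) :
    \sum_(i < M) \sum_(j < N) w i j * (h i j - edge_div u v i j) =
    \sum_(i < M) \sum_(j < N) w i j * h i j - \sum_(i < M) \sum_(j < N) w i j * edge_div u v i j.
  rewrite -sumrB; apply: eq_bigr => i _; rewrite -sumrB; apply: eq_bigr => j _.
  by rewrite mulrBr.
move: VI convex; rewrite (expand (own_div own uu vv)) (expand (edge_div (glue_u M own uu) (glue_v N own vv))) muE glue.
lra.
Qed.

(** Fields without jumps have the same Lagrangian as objective, whatever the
    multiplier. *)
Lemma solution_of_primal P p : kerB G P -> primal_solution G alpha f P ->
  Yspace M N p -> tilde_eq G (Phi G p) P -> solves_P M N alpha f p.
Proof.
move=> [YP B0] [lam [_ Lfin _ Lmin]] Yp pP.
have CP : Ctilde G P.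
  by apply: contrapT => nC; move: Lfin; rewrite Lagrangian_out.
have [uu [vv [rP _]]] := Ytilde_repr M_gt0 N_gt0 YP.
have [u [v [r oz]]] := Yspace_repr M_gt0 N_gt0 Yp.
have agree s i j : in_sub G s (i, j) -> [/\ u i j = uu s i j, u i.+1 j = uu s i.+1 j,
    v i j = vv s i j & v i j.+1 = vv s i j.+1].
  move=> /andP[hi hj]; apply: (edge_repr_inj (Phi_repr M_gt0 N_gt0 (G := G) (s := s) r) (rP s) hi hj hi hj).
  by apply: ae_imp (pP s) => z h pz; apply: h; exact: (px_sub_open_rect hi hj pz).
have tE : energy_of_tilde uu vv = energy_of u v.
  apply: eq_bigr => i _; apply: eq_bigr => j _; rewrite /own_div.
  have [|h1 h2 h3 h4] := agree (own (val i, val j)) i j; first by apply: ownP => /=.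
  by rewrite /edge_div h1 h2 h3 h4.
have Cp : Cset M N p.
  apply/(Cset_repr Yp r) => e; have [h _] := (Ctilde_repr ownP YP rP).1 CP e.
  suff -> : edge_val u v e = lowv uu vv e by [].
  have [h1 h2] := low_range e; have := ownP h1 h2.
  rewrite /low_val; case: e {h h1 h2} => -[i j] /= /agree[] //.
have [mu lamE] := multiplier_row lam.
split=> // q Yq; have [Cq|nCq] := pselect (Cset M N q); last by rewrite (objective_out Yq nCq) leey.
have [u' [v' [r' oz']]] := Yspace_repr M_gt0 N_gt0 Yq.
have [YQ rQ] := Phi_data Yq r' oz'.
have CQ := Phi_Ctilde Yq r' oz' Cq.
have := Lmin _ YQ; rewrite lamE (LagrangianE _ CP rP).
rewrite (LagrangianE (uu := fun=> u') (vv := fun=> v') _ CQ rQ) total_energy_tilde_cst tE.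
have eqv := (kerB_vals ownP rP).1 B0.
rewrite big1 ?addr0; last by move=> e _; rewrite eqv subrr mulr0.
rewrite big1 ?addr0; last by move=> e _; rewrite /low_val /high_val subrr mulr0.
by rewrite (objective_in r Cp) (objective_in r' Cq).
Qed.

End duality.

Theorem proposition4p2 (R : realType) (M N K : nat)
    (M_gt0 : (0 < M)%N) (N_gt0 : (0 < N)%N) (G : square_array M N K)
    (alpha : R) (alpha_gt0 : 0 < alpha)
    (f : scalar_field R) (f_L2 : L2 (image_domain R M N) f) :
  (forall p : vector_field R,
     solves_P M N alpha f p ->
     primal_solution G alpha f (Phi G p)) /\
  (forall P : 'I_(K * K) -> vector_field R,
     kerB G P -> primal_solution G alpha f P ->
     (exists2 p, Yspace M N p & tilde_eq G (Phi G p) P) /\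
     (forall p, Yspace M N p -> tilde_eq G (Phi G p) P ->
        solves_P M N alpha f p)).
Proof.
have [own ownP] := owner_exists G M_gt0 N_gt0; split.
  by move=> p sol; exact: (primal_of_solution M_gt0 N_gt0 ownP alpha_gt0 f_L2 sol).
move=> P kP prim; split; first exact: (glued_field M_gt0 N_gt0 ownP kP).
by move=> p Yp pP; exact: (solution_of_primal M_gt0 N_gt0 ownP f_L2 kP prim Yp pP).
Qed.
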